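(* Let $\theta$ be a collineation of a hyperbolic polar space $\Gamma$ of rank $n\ge 4$ (equivalently, an automorphism of the associated building of type $\mathsf{D}_n$ not of triality type). Then $\theta$ is a polar $\{1,2'\}$-kangaroo if and only if either $\theta$ is anisotropic, or (i) the set of points fixed by $\theta$ is an ideal subspace of $\Gamma$, or (ii) $\theta$ fixes every member of some line spread of $\Gamma$. Consequently, $\theta$ is a polar $\{1,2'\}$-kangaroo if and only if it is uniclass.
   Context: A hyperbolic polar space of rank $n$ is the polar space of a nondegenerate quadric of maximal Witt index in a $(2n-1)$-dimensional projective space; every submaximal singular subspace lies in exactly two maximal singular subspaces. The long root subgroup geometry has as points the lines of $\Gamma$. Two lines $L,M$ of $\Gamma$ are at mutual position: $0$ if equal; $1$ (adjacent) if distinct and contained in a common plane; $2$ if not adjacent and either sharing a point or contained in a common singular subspace; $2'$ if there is a unique point on either of them collinear to all points of the other; $3$ (opposite) if each point of either is collinear to exactly one point of the other. For $D\subseteq\{0,1,2,2',3\}$, $\theta$ is a polar $D$-kangaroo if for no line $L$ the mutual position of $L$ and $L^\theta$ lies in $D$. An ovoid of a polar space is a set of points meeting every maximal singular subspace in exactly one point. A subspace $U$ of $\Gamma$ is ideal if for each submaximal singular subspace $V$ of $\Gamma$ contained in $U$, the set of singular subspaces of dimension $\dim V+1$ containing $V$ and contained in $U$ forms an ovoid of the upper residue of $V$ (the polar space whose points are the singular subspaces of dimension $\dim V+1$ through $V$). A line spread is a set of lines partitioning the point set. $\theta$ is anisotropic if it maps every chamber of the building to an opposite chamber. Uniclass: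 with Weyl distance $\delta$ and companion diagram automorphism $\sigma$ ($\delta(C^\theta,D^\theta)=\delta(C,D)^\sigma$), $\theta$ is uniclass if $\{\delta(C,C^\theta): C\text{ chamber}\}$ lies in a single set $\{v^{-1}wv^\sigma: v\in W\}$ of the Coxeter group $W$.
   Formalization: An ideal subspace U is taken nonempty, with ''submaximal'' meaning submaximal among the singular subspaces contained in U rather than in Γ, and position 2' excludes lines already at position 0, 1 or 2; read literally, the equivalence fails. *)

(* Defs.v *)
(* The hyperbolic polar space of rank n over a field K is
   realised concretely as the quadric Q(x) = sum_{i<n} x_i x_{n+i} in K^(2n). *)
From HB Require Import structures.
From mathcomp Require Import all_boot all_order all_algebra.
Set Implicit Arguments. Unset Strict Implicit. Unset Printing Implicit Defensive.
Import GRing.Theory.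
Local Open Scope ring_scope.

Section HyperbolicPolar.
Variables (K : fieldType) (n : nat).
Notation V := 'rV[K]_(n + n).
Notation sub := {vspace V}.

Definition Qf (x : V) : K := \sum_(i < n) x 0 (lshift n i) * x 0 (rshift n i).

(* totally singular vector subspaces = singular subspaces of Gamma
   (projective dimension = \dim - 1) *)
Definition ts (U : sub) : Prop := forall x, x \in U -> Qf x = 0.
Definition is_point (p : sub) : Prop := ts p /\ \dim p = 1%N.
Definition is_line (L : sub) : Prop := ts L /\ \dim L = 2%N.
Definition pts (U p : sub) : Prop := is_point p /\ (p <= U)%VS.
Definition maxsing (M : sub) : Prop :=
  ts M /\ forall W, ts W -> (M <= W)%VS -> W = M.

(* theta (a map on points) maps the singular subspace U onto W *)
Definition imgS (th : sub -> sub) (U W : sub) : Prop :=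
  ts W /\ forall p, is_point p ->
    ((p <= W)%VS <-> exists q, pts U q /\ th q = p).

Definition collineation (th : sub -> sub) : Prop :=
  (forall p, is_point p -> is_point (th p)) /\
  (forall p q, is_point p -> is_point q -> th p = th q -> p = q) /\
  (forall p', is_point p' -> exists p, is_point p /\ th p = p') /\
  (forall L, is_line L -> exists L', is_line L' /\ imgS th L L') /\
  (forall L', is_line L' -> exists L, is_line L /\ imgS th L L').

Definition pos1 (L M : sub) : Prop :=
  L <> M /\ exists P, ts P /\ \dim P = 3%N /\ (L <= P)%VS /\ (M <= P)%VS.
Definition pos2 (L M : sub) : Prop :=
  L <> M /\ ~ pos1 L M /\
  ((exists p, pts L p /\ pts M p) \/ exists S, ts S /\ (L <= S)%VS /\ (M <= S)%VS).
Definition coll_all (p M : sub) : Prop := forall q, pts M q -> ts (p + q)%VS.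
Definition pos2' (L M : sub) : Prop :=
  L <> M /\ ~ pos1 L M /\ ~ pos2 L M /\
  (exists! p, pts L p /\ coll_all p M) /\ (exists! q, pts M q /\ coll_all q L).

Definition kangaroo12' (th : sub -> sub) : Prop :=
  forall L L', is_line L -> imgS th L L' -> ~ pos1 L L' /\ ~ pos2' L L'.

Definition gsubspace (U : sub -> Prop) : Prop :=
  (forall p, U p -> is_point p) /\
  forall L p q, is_line L -> pts L p -> pts L q -> p <> q -> U p -> U q ->
    forall r, pts L r -> U r.
Definition inU (U : sub -> Prop) (S : sub) : Prop :=
  ts S /\ forall p, pts S p -> U p.
Definition maxInU (U : sub -> Prop) (S : sub) : Prop :=
  inU U S /\ forall T, inU U T -> (S <= T)%VS -> T = S.
Definition submaxInU (U : sub -> Prop) (S : sub) : Prop :=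
  inU U S /\ ~ maxInU U S /\
  forall T, inU U T -> (S <= T)%VS -> T <> S -> maxInU U T.
(* ideal subspace: for each submaximal S, the (dim S + 1)-spaces through S in U
   form an ovoid of the upper residue of S, i.e. every maximal singular
   subspace through S contains exactly one of them *)
Definition ideal (U : sub -> Prop) : Prop :=
  gsubspace U /\ (exists p, U p) /\
  forall S, submaxInU U S -> forall M, maxsing M -> (S <= M)%VS ->
    exists! T, inU U T /\ \dim T = (\dim S).+1 /\ (S <= T)%VS /\ (T <= M)%VS.

Definition fixed_points (th : sub -> sub) : sub -> Prop :=
  fun p => is_point p /\ th p = p.

Definition fixes_line_spread (th : sub -> sub) : Prop :=
  exists Sp : sub -> Prop,
    (forall L, Sp L -> is_line L) /\
    (forall p, is_point p -> exists! L, Sp L /\ (p <= L)%VS) /\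
    (forall L, Sp L -> imgS th L L).

(* a fixed maximal singular subspace, used to split maximals in two classes *)
Definition M0 : sub := <<[seq delta_mx ord0 (lshift n i) | i : 'I_n]>>%VS.
Definition cls_low (M : sub) : bool := odd (\dim (M :&: M0)) == odd n.

(* chambers: vertex of type i < n-2 is a singular subspace of vector
   dimension i+1; types n-2 and n-1 are maximal singular subspaces of the two
   classes, meeting in a subspace of vector dimension n-1 *)
Definition chamber (C : 'I_n -> sub) : Prop :=
  (forall i : 'I_n, (i < n - 2)%N -> ts (C i) /\ \dim (C i) = i.+1) /\
  (forall i j : 'I_n, (i < j)%N -> (i < n - 2)%N -> (C i <= C j)%VS) /\
  (forall i : 'I_n, val i = (n - 2)%N -> maxsing (C i) /\ cls_low (C i)) /\
  (forall i : 'I_n, val i = (n - 1)%N -> maxsing (C i) /\ ~~ cls_low (C i)) /\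
  (forall i j : 'I_n, val i = (n - 2)%N -> val j = (n - 1)%N ->
     \dim (C i :&: C j) = (n - 1)%N).

Definition adj (i : nat) (C D : 'I_n -> sub) : Prop :=
  (i < n)%N /\ (forall j : 'I_n, val j <> i -> C j = D j) /\
  exists j : 'I_n, val j = i /\ C j <> D j.

Fixpoint galleryP (C : 'I_n -> sub) (cs : seq ('I_n -> sub)) (u : seq nat) : Prop :=
  match cs, u with
  | [::], [::] => True
  | D :: cs', i :: u' => adj i C D /\ chamber D /\ galleryP D cs' u'
  | _, _ => False
  end.

Definition gallery (C D : 'I_n -> sub) (u : seq nat) : Prop :=
  chamber C /\ exists cs, galleryP C cs u /\ last C cs = D.
Definition min_gallery (C D : 'I_n -> sub) (u : seq nat) : Prop :=
  gallery C D u /\ forall u', gallery C D u' -> (size u <= size u')%N.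

(* Coxeter group W(D_n) as signed permutations of {0..n-1}
   (with an even number of sign changes); generator s_i for i <= n-2 is the
   transposition (i i+1), s_{n-1} maps e_{n-2} -> -e_{n-1}, e_{n-1} -> -e_{n-2}.
   A word u = [i1;...;ik] represents s_{i1} ... s_{ik}. *)
Definition sgen (i : nat) (x : nat * bool) : nat * bool :=
  let: (k, b) := x in
  if (i.+1 < n)%N then
    (if k == i then (i.+1, b) else if k == i.+1 then (i, b) else (k, b))
  else
    (if k == (n - 2)%N then ((n - 1)%N, ~~ b)
     else if k == (n - 1)%N then ((n - 2)%N, ~~ b) else (k, b)).
Definition weval (u : seq nat) (x : nat * bool) : nat * bool := foldr sgen x u.
Definition weq (u v : seq nat) : Prop :=
  forall k b, (k < n)%N -> weval u (k, b) = weval v (k, b).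
Definition wordW (u : seq nat) : bool := all (fun i => (i < n)%N) u.
(* longest element of W(D_n) *)
Definition w0f (x : nat * bool) : nat * bool :=
  let: (k, b) := x in if odd n && (k == (n - 1)%N) then (k, b) else (k, ~~ b).
(* Weyl distance: delta(C,D) is the element represented by the type of any
   minimal gallery from C to D *)
Definition opposite (C D : 'I_n -> sub) : Prop :=
  exists u, min_gallery C D u /\ forall k b, (k < n)%N -> weval u (k, b) = w0f (k, b).

(* theta maps chamber C to chamber D (as simplices) *)
Definition imgC (th : sub -> sub) (C D : 'I_n -> sub) : Prop :=
  chamber D /\ forall i, exists j, imgS th (C i) (D j).

Definition anisotropic (th : sub -> sub) : Prop :=
  forall C D, chamber C -> imgC th C D -> opposite C D.

(* diagram automorphisms of D_n that can be companions of a collineation: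
   identity (sw = false) or the swap of the types n-2, n-1 (sw = true) *)
Definition sigma (sw : bool) (i : nat) : nat :=
  if sw then (if i == (n - 2)%N then (n - 1)%N
              else if i == (n - 1)%N then (n - 2)%N else i)
  else i.

Definition companion (th : sub -> sub) (sw : bool) : Prop :=
  forall C D C' D' u, chamber C -> chamber D -> imgC th C C' -> imgC th D D' ->
    min_gallery C D u -> exists u', min_gallery C' D' u' /\ weq u' (map (sigma sw) u).

Definition uniclass (th : sub -> sub) : Prop :=
  exists sw, companion th sw /\
  exists w, wordW w /\
  forall C D u, chamber C -> imgC th C D -> min_gallery C D u ->
    exists v, wordW v /\ weq u (rev v ++ w ++ map (sigma sw) v).

End HyperbolicPolar.

(* Main.v *)
(** Let Bf be the polar form and let tau x span the image of the singular point
    <x>. A line L is at position 1 or 2' from its image L' exactly when the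
    dimensions of L :&: L' and L :&: perp L' differ by one. Testing this on lines
    through x shows that a kangaroo maps each line <x, tau x> with
    Bf x (tau x) = 0 and <x> moved to itself, and then that either every point is
    fixed or opposite to its image, or no point is fixed and the lines
    <x, tau x> form a spread of fixed lines. In the first case the collineation
    is anisotropic when it has no fixed point; otherwise, by the parity of
    \dim (M :&: theta M), all maximal singular subspaces M meet the fixed
    subspace in the same dimension, which is the ideal condition.

    For the uniclass property, chambers are described by hyperbolic bases
    ("frames") a, indexed by pairs (k, sign), in which the Weyl group acts by
    signed permutations: the Weyl distance from C to D is the class of u when some
    frame a is adapted to C and a \o weval u is adapted to D. In the situations
    above, the underlying unsigned permutation of the distance from a chamber to
    its image is the identity, respectively a fixed-point-free involution, for
    all chambers; this forces the distances at adjacent chambers to be twisted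
    conjugates by the generator s_i. Conversely, the displacements of a uniclass
    collineation have constant parity, so for two points of a line L the
    positions of the flags (point, L) relative to their images agree up to
    conjugation by s_0. In particular all or none of the points of a fixed line
    are fixed, and if L is not fixed but meets its image, the common point is
    fixed; such rules exclude the positions 1 and 2'. *)

From Pilot Require Import Defs.
From HB Require Import structures.
From mathcomp Require Import all_boot all_order all_algebra.
From mathcomp Require Import fingroup perm.
From mathcomp Require Import ring zify.
From Stdlib Require Import Classical ClassicalEpsilon FunctionalExtensionality.
Set Implicit Arguments.
Unset Strict Implicit.
Unset Printing Implicit Defensive.
Import GRing.Theory.
Local Open Scope ring_scope.

(** The datum is a bijection of points preserving lines, with no semilinear map behind it. Only the
    point spanned by [tau x] is meaningful, so all arguments use spans and the vanishing of [Bf]; on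
    a line one only knows that [tau z] lies in the span of [tau x] and [tau y]. Lines may have just
    three points, and in characteristic 2 [Bf] does not determine [Qf], so singularity is tracked
    through [Qf].

    On the building side no length function is computed: words need not be reduced, and a comparison
    of flags shows that the signed permutation between two chambers is well defined.

    If C and D are i-adjacent, the distance d from C to its image becomes d, s_i d, d s_j or s_i d
    s_j at D, where j = sigma(i). Both implications about uniclass rest on excluding the two middle
    cases. For kangaroos this holds because, after dropping signs, X and sX (or Xs) with s a
    transposition are never both the identity, nor both fixed-point-free involutions. For uniclass
    collineations it holds because the parity of the length is constant on a twisted conjugacy
    class. *)

Section Form.
Variables (K : fieldType) (n : nat).
Notation V := 'rV[K]_(n + n).
Notation sub := {vspace V}.
Implicit Types (x y z : V) (U W M N H : sub).

Definition Bf x y : K :=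
  \sum_(i < n) (x 0 (lshift n i) * y 0 (rshift n i)
                + x 0 (rshift n i) * y 0 (lshift n i)).

Lemma BfC x y : Bf x y = Bf y x.
Proof. by apply: eq_bigr => i _; rewrite addrC; congr (_ + _); rewrite mulrC. Qed.

Lemma Bf_linear x : linear (Bf x : V -> K^o).
Proof.
move=> a y z; rewrite /Bf scaler_sumr -big_split /=; apply: eq_bigr => i _.
by rewrite !mxE /GRing.scale /=; ring.
Qed.
HB.instance Definition _ x :=
  GRing.isLinear.Build K V K^o _ (Bf x : V -> K^o) (Bf_linear x).

Lemma BfDr x y z : Bf x (y + z) = Bf x y + Bf x z.
Proof. exact: (raddfD (Bf x : V -> K^o)). Qed.
Lemma BfZr x a y : Bf x (a *: y) = a * Bf x y.
Proof. exact: (linearZ_LR (Bf x : V -> K^o)). Qed.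
Lemma Bf0r x : Bf x 0 = 0.
Proof. exact: (raddf0 (Bf x : V -> K^o)). Qed.
Lemma BfNr x y : Bf x (- y) = - Bf x y.
Proof. exact: (raddfN (Bf x : V -> K^o)). Qed.
Lemma BfBr x y z : Bf x (y - z) = Bf x y - Bf x z.
Proof. exact: (raddfB (Bf x : V -> K^o)). Qed.
Lemma BfDl x y z : Bf (y + z) x = Bf y x + Bf z x.
Proof. by rewrite !(BfC _ x) BfDr. Qed.
Lemma BfZl x a y : Bf (a *: y) x = a * Bf y x.
Proof. by rewrite !(BfC _ x) BfZr. Qed.
Lemma Bf0l x : Bf 0 x = 0.
Proof. by rewrite BfC Bf0r. Qed.
Lemma BfNl x y : Bf (- y) x = - Bf y x.
Proof. by rewrite !(BfC _ x) BfNr. Qed.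
Lemma BfBl x y z : Bf (y - z) x = Bf y x - Bf z x.
Proof. by rewrite !(BfC _ x) BfBr. Qed.
Definition BfE := (BfDr, BfDl, BfZr, BfZl, BfNr, BfNl, Bf0r, Bf0l).

Lemma QfD x y : Qf (x + y) = Qf x + Qf y + Bf x y.
Proof.
rewrite /Qf /Bf -!big_split /=; apply: eq_bigr => i _.
by rewrite !mxE; ring.
Qed.
Lemma QfZ a x : Qf (a *: x) = a ^+ 2 * Qf x.
Proof. by rewrite /Qf mulr_sumr; apply: eq_bigr => i _; rewrite !mxE; ring. Qed.
Lemma Qf0 : Qf (0 : V) = 0.
Proof. by rewrite -(scale0r (0 : V)) QfZ expr2 mul0r mul0r. Qed.
Lemma QfN x : Qf (- x) = Qf x.
Proof. by rewrite -scaleN1r QfZ sqrrN expr1n mul1r. Qed.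
Lemma Bfxx x : Bf x x = Qf x + Qf x.
Proof.
have: Qf (x + x) = Qf x *+ 4.
  by rewrite -mulr2n -scaler_nat QfZ -mulr_natl; ring.
rewrite QfD => h; apply: (addrI (Qf x + Qf x)); rewrite h; ring.
Qed.
Lemma Bfxx0 x : Qf x = 0 -> Bf x x = 0.
Proof. by move=> h; rewrite Bfxx h addr0. Qed.

Lemma Bf_delta_l x (i : 'I_n) : Bf x (delta_mx 0 (lshift n i)) = x 0 (rshift n i).
Proof.
rewrite /Bf (bigD1 i) //= !mxE !eqxx /= big1 ?addr0; last first.
  move=> j ji; rewrite !mxE /= eq_lshift (negPf ji) /=.
  by rewrite [_ == lshift n i]eq_sym eq_lrshift /= !mulr0 addr0.
by rewrite [_ == lshift n i]eq_sym eq_lrshift /= mulr0 mulr1 add0r.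
Qed.
Lemma Bf_delta_r x (i : 'I_n) : Bf x (delta_mx 0 (rshift n i)) = x 0 (lshift n i).
Proof.
rewrite /Bf (bigD1 i) //= !mxE !eqxx /= big1 ?addr0; last first.
  by move=> j ji; rewrite !mxE /= eq_rshift (negPf ji) /= eq_lrshift !mulr0 addr0.
by rewrite eq_lrshift /= mulr0 mulr1 addr0.
Qed.

Lemma Bf_nondeg x : (forall y, Bf x y = 0) -> x = 0.
Proof.
move=> h; apply/rowP => j; rewrite mxE -(splitK j).
by case: (split j) => i /=; rewrite -?Bf_delta_r -?Bf_delta_l h.
Qed.

(** A subspace has to be built by finite operations, hence the intersection of kernels over a basis
    of [U]; [perpP] recovers orthogonality to all of [U]. *)
Definition perp U : sub :=
  (\bigcap_(i < \dim U) lker (linfun (Bf (vbasis U)`_i : V -> K^o)))%VS.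

Lemma perpP U x : reflect (forall u, u \in U -> Bf u x = 0) (x \in perp U).
Proof.
rewrite /perp memvE; apply: (iffP subv_bigcapP) => h.
  move=> u uU; rewrite (coord_vbasis uU).
  rewrite BfC raddf_sum big1 // => i _.
  have /= := h i isT; rewrite -memvE memv_ker lfunE /= => /eqP h1.
  by rewrite BfZr BfC h1 mulr0.
move=> i _; rewrite -memvE memv_ker lfunE /= h //.
by apply: vbasis_mem; rewrite mem_nth // size_tuple.
Qed.

Lemma perp_mem U x u : x \in perp U -> u \in U -> Bf u x = 0.
Proof. by move/perpP => h /h. Qed.
Lemma perp_mem' U x u : x \in perp U -> u \in U -> Bf x u = 0.
Proof. by rewrite BfC; exact: perp_mem. Qed.

Lemma perpS U W : (U <= W)%VS -> (perp W <= perp U)%VS.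
Proof. by move=> /subvP UW; apply/subvP => x /perpP h; apply/perpP => u /UW /h. Qed.

Lemma perp_sym U W : (U <= perp W)%VS -> (W <= perp U)%VS.
Proof.
move=> /subvP UW; apply/subvP => x xW; apply/perpP => u uU.
by rewrite BfC; apply: perp_mem xW; apply: UW.
Qed.

Lemma sub_perpp U : (U <= perp (perp U))%VS.
Proof. exact: perp_sym. Qed.

Lemma perp1P y x : reflect (Bf y x = 0) (x \in perp <[y]>).
Proof.
apply: (iffP (perpP _ _)) => [|h u /vlineP[k ->]]; first by apply; exact: memv_line.
by rewrite BfZl h mulr0.
Qed.

Lemma perpD U W : perp (U + W) = (perp U :&: perp W)%VS.
Proof.
apply/eqP; rewrite eqEsubv subv_cap !perpS ?addvSl ?addvSr //=.
apply/subvP => x /memv_capP[/perpP h1 /perpP h2]; apply/perpP => u.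
by case/memv_addP => u1 m1 [u2 m2 ->]; rewrite BfDl h1 // h2 // addr0.
Qed.

Lemma dim_cap_perp1 W x : (\dim W <= (\dim (W :&: perp <[x]>)).+1)%N.
Proof.
have <- := limg_ker_dim (linfun (Bf x : V -> K^o)) W.
have -> : lker (linfun (Bf x : V -> K^o)) = perp <[x]>.
  apply/vspaceP => y; rewrite memv_ker lfunE /=.
  by apply/eqP/perp1P.
rewrite -[X in (_ <= X)%N]addn1 leq_add2l; apply: leq_trans (dimvS (subvf _)) _.
by rewrite dimvf.
Qed.

Lemma dim_cap_perp W U : (\dim W <= \dim (W :&: perp U) + \dim U)%N.
Proof.
have [k] := ubnP (\dim U); elim: k U W => // k IH U W kU.
have [->|U0] := eqVneq U 0%VS.
  rewrite dimv0 addn0; apply: dimvS; rewrite subv_cap subvv /=.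
  by apply/subvP => x _; apply/perpP => u; rewrite memv0 => /eqP ->; rewrite Bf0l.
pose x := vpick U; pose U1 := (U :\: <[x]>)%VS.
have x0 : x != 0 by rewrite vpick0.
have xU : (<[x]> <= U)%VS by rewrite -memvE memv_pick.
have dU : \dim U = (\dim U1).+1.
  by rewrite -(dimv_cap_compl U <[x]>) (capv_idPr xU) dim_vline x0.
have Us : (U1 + <[x]> = U)%VS by rewrite addv_diff; apply/addv_idPl.
have := IH U1 (W :&: perp <[x]>)%VS; rewrite -ltnS -dU => /(_ kU).
rewrite -capvA -perpD addvC Us => h.
by apply: leq_trans (dim_cap_perp1 W x) _; rewrite dU addnS ltnS.
Qed.

Lemma perpf : perp fullv = 0%VS.
Proof.
apply/eqP; rewrite -subv0; apply/subvP => x /perpP h; rewrite memv0; apply/eqP.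
by apply: Bf_nondeg => y; rewrite BfC h // memvf.
Qed.

Lemma dim_full : \dim (fullv : sub) = (n + n)%N.
Proof. by rewrite dimvf /dim /= mul1n. Qed.

(** One bound is [dim_cap_perp] in the full space. The other applies it to [perp U] and a complement
    of [U]: the two perps meet in [perp fullv], which is 0 by nondegeneracy. *)
Lemma dim_perp U : \dim (perp U) = (n + n - \dim U)%N.
Proof.
have h1 := dim_cap_perp fullv U; rewrite capfv dim_full in h1.
have h2 := dim_cap_perp (perp U) (U^C)%VS.
rewrite -perpD addv_complf perpf dimv0 add0n dimv_compl dim_full in h2.
by apply/eqP; rewrite eqn_leq h2 leq_subLR addnC.
Qed.

Lemma dim_le U : (\dim U <= n + n)%N.
Proof. have := dimvS (subvf U); rewrite dim_full; exact. Qed.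

Lemma perpK U : perp (perp U) = U.
Proof.
apply/esym/eqP; rewrite eqEdim sub_perpp !dim_perp /=.
by rewrite subKn // dim_le.
Qed.

Lemma sep_perp U q : q \notin U -> exists2 y, y \in perp U & Bf y q != 0.
Proof.
move=> qU; apply: NNPP => h; case/negP: qU.
rewrite -(perpK U); apply/perpP => u uU.
by apply/eqP/negPn/negP => h1; apply: h; exists u.
Qed.

Lemma subvPn' U W : ~~ (U <= W)%VS -> exists2 u, u \in U & u \notin W.
Proof. by move/subvPn. Qed.

Lemma perp_cap U W : perp (U :&: W) = (perp U + perp W)%VS.
Proof. by rewrite -[RHS]perpK perpD !perpK. Qed.

(** * Totally singular subspaces *)

Definition sv x := Qf x = 0 /\ x != 0.

Lemma tsP U : ts U -> (U <= perp U)%VS.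
Proof.
move=> h; apply/subvP => x xU; apply/perpP => u uU.
have := h _ (memvD uU xU); rewrite QfD !h // !add0r; exact.
Qed.

Lemma ts_orth U x y : ts U -> x \in U -> y \in U -> Bf x y = 0.
Proof. by move=> /tsP/subvP h xU yU; apply: perp_mem (h _ yU) xU. Qed.

Lemma ts_sub U W : ts W -> (U <= W)%VS -> ts U.
Proof. by move=> h /subvP UW x /UW /h. Qed.

Lemma ts_cap U W : ts U -> ts (U :&: W).
Proof. by move=> h; apply: ts_sub (capvSl _ _). Qed.

Lemma ts0 : ts (0%VS : sub).
Proof. by move=> x; rewrite memv0 => /eqP ->; exact: Qf0. Qed.

Lemma ts_add U W : ts U -> ts W -> (U <= perp W)%VS -> ts (U + W).
Proof.
move=> tU tW /subvP h x /memv_addP[u uU [w wW ->]].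
by rewrite QfD tU // tW // BfC (perp_mem (h _ uU) wW) !addr0.
Qed.

Lemma ts_line x : Qf x = 0 -> ts <[x]>.
Proof. by move=> h y /vlineP[k ->]; rewrite QfZ h mulr0. Qed.

Lemma ts_addl U x : ts U -> Qf x = 0 -> x \in perp U -> ts (U + <[x]>).
Proof.
move=> tU q h; rewrite addvC; apply: ts_add => //; first exact: ts_line.
Qed.

Lemma ts_dim U : ts U -> (\dim U <= n)%N.
Proof.
move=> /tsP /dimvS; rewrite dim_perp => h; have := dim_le U; lia.
Qed.

Lemma add_line_mem U x y : y \in (U + <[x]>)%VS <-> exists k, y - k *: x \in U.
Proof.
split=> [/memv_addP[u uU [v /vlineP[k ->] ->]]|[k h]].
  by exists k; rewrite addrK.
by rewrite -(subrK (k *: x) y) memv_add // memvZ // memv_line.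
Qed.

Lemma dim_add_line U x : x \notin U -> \dim (U + <[x]>) = (\dim U).+1.
Proof.
move=> xU; rewrite dimv_disjoint_sum ?dim_vline.
  by case: eqP xU => [->|]; rewrite ?mem0v // addn1.
apply/eqP; rewrite -subv0; apply/subvP => y /memv_capP[yU /vlineP[k yk]].
rewrite memv0; have [k0|k0] := eqVneq k 0; first by rewrite yk k0 scale0r.
case/negP: xU; rewrite -(scalerK k0 x) -yk; exact: memvZ.
Qed.

Lemma M0_ts : ts (M0 K n).
Proof.
move=> x; rewrite /M0.
have h : (<<[seq delta_mx ord0 (lshift n i) | i : 'I_n]>> <= perp (M0 K n))%VS.
  apply/span_subvP => _ /mapP[i _ ->]; apply/perpP => u; rewrite /M0 => hu.
  have : (<<[seq delta_mx ord0 (lshift n i) | i : 'I_n]>> <=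
          perp <[delta_mx 0%R (lshift n i) : V]>)%VS.
    apply/span_subvP => _ /mapP[j _ ->]; apply/perp1P.
    by rewrite Bf_delta_l mxE eq_sym eq_lrshift andbF.
  by move=> /subvP /(_ _ hu) /perp1P; rewrite BfC.
move=> xM; rewrite /Qf big1 // => i _.
have /subvP /(_ _ xM) /perpP /(_ (delta_mx 0 (lshift n i))) := h.
rewrite BfC Bf_delta_l => ->; first by rewrite mulr0.
by apply: memv_span; apply/mapP; exists i; rewrite ?mem_enum.
Qed.

Lemma M0_dim : \dim (M0 K n) = n.
Proof.
apply/eqP; rewrite eqn_leq (ts_dim M0_ts) /=.
have : (perp (M0 K n) <= M0 K n)%VS.
  apply/subvP => x /perpP h.
  have hr i : x 0 (rshift n i) = 0.
    rewrite -Bf_delta_l BfC h // /M0 memv_span //; apply/mapP; exists i => //.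
    by rewrite mem_enum.
  rewrite (row_sum_delta x) big_split_ord /= [X in _ + X]big1 ?addr0.
    apply: memv_suml => i _; apply: memvZ; apply: memv_span.
    by apply/mapP; exists i; rewrite ?mem_enum.
  by move=> i _; rewrite hr scale0r.
move/dimvS; rewrite dim_perp; have := dim_le (M0 K n); lia.
Qed.

Lemma perp_max M : ts M -> \dim M = n -> perp M = M.
Proof.
move=> tM dM; apply/esym/eqP; rewrite eqEdim tsP // dim_perp dM; lia.
Qed.

(* The maximal singular subspace through U closest to M. *)
Definition projM M U : sub := (U + (M :&: perp U))%VS.

(** As [M] is its own perp, [M + perp U] is the perp of [M :&: U]; the dimension formula for sums
    does the rest. *)
Lemma dim_max_perp M U : ts M -> \dim M = n ->
  (\dim (M :&: perp U) + \dim U = n + \dim (M :&: U))%N.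
Proof.
move=> tM dM; have := dimv_sum_cap M (perp U).
rewrite -{1}(perp_max tM dM) -perp_cap !dim_perp dM.
have := dim_le U; have := dim_le (M :&: U)%VS; lia.
Qed.

Lemma projM_ts M U : ts M -> ts U -> ts (projM M U).
Proof.
move=> tM tU; rewrite /projM addvC; apply: ts_add => //; first exact: ts_cap.
exact: capvSr.
Qed.

Lemma projM_dim M U : ts M -> \dim M = n -> ts U -> \dim (projM M U) = n.
Proof.
move=> tM dM tU; apply/eqP; rewrite eqn_leq (ts_dim (projM_ts tM tU)) /=.
have := dimv_sum_cap U (M :&: perp U)%VS; rewrite -/(projM M U).
have := dim_max_perp U tM dM.
have : (\dim (U :&: (M :&: perp U)) <= \dim (M :&: U))%N.
  by apply: dimvS; rewrite capvA capvC [(M :&: U)%VS]capvC capvSr.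
lia.
Qed.

Lemma ext_max U : ts U -> exists M, [/\ ts M, \dim M = n & (U <= M)%VS].
Proof.
move=> tU; exists (projM (M0 K n) U).
split; [exact: projM_ts M0_ts tU|exact: projM_dim M0_ts M0_dim tU|exact: addvSl].
Qed.

Lemma maxsingP M : maxsing M <-> ts M /\ \dim M = n.
Proof.
split=> [[tM h]|[tM dM]].
  by split=> //; have [N [tN dN MN]] := ext_max tM; rewrite -(h N tN MN).
split=> // W tW MW; apply/esym/eqP; rewrite eqEdim MW dM; exact: ts_dim.
Qed.

(** [sep_perp] gives a separating [y] that may be nonsingular. A maximal [M] above [U] then contains
    an [x] with [Bf x y != 0], since otherwise [y] would lie in [perp M = M]; either [x] separates
    too, or [y] is corrected along [x]. *)
Lemma sing_sep U q : ts U -> q \notin U ->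
  exists z, [/\ Qf z = 0, z \in perp U & Bf z q != 0].
Proof.
move=> tU qU; have [y yU yq] := sep_perp qU.
have [qy|qy] := eqVneq (Qf y) 0; first by exists y.
have [M [tM dM UM]] := ext_max tU.
have yM : y \notin M by apply/negP => /tM /eqP; rewrite (negPf qy).
have [x xM xy] := sep_perp yM; rewrite (perp_max tM dM) in xM.
have xU : x \in perp U by apply: (subvP (perpS UM)); rewrite perp_max.
have [h|h] := eqVneq (Bf x q) 0; last by exists x; rewrite (tM x).
(* The scalar [s] solves [Qf (y - s *: x) = Qf y - s * Bf x y = 0]. *)
exists (y - (Qf y / Bf x y) *: x); split.
- by rewrite QfD QfN QfZ (tM x) // mulr0 addr0 BfNr BfZr (BfC y) divfK // subrr.
- by rewrite memvB // memvZ.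
- by rewrite BfBl BfZl h mulr0 subr0.
Qed.

Lemma sing_sep_out U q : ts U -> (\dim U < n)%N -> q \notin U ->
  exists z, [/\ Qf z = 0, z \in perp U, z \notin U & Bf z q != 0].
Proof.
move=> tU dU qU; have [z [qz zU zq]] := sing_sep tU qU.
have [zin|zout] := boolP (z \in U); last by exists z.
have [M [tM dM UM]] := ext_max tU.
have : ~~ (M <= U)%VS by apply/negP => /dimvS; lia.
case/subvPn' => y yM yU.
have yP : y \in perp U by apply: (subvP (perpS UM)); rewrite perp_max.
have [h|h] := eqVneq (Bf y q) 0; last by exists y; rewrite (tM y).
exists (y + z); split.
- by rewrite QfD (tM y) // qz (perp_mem' yP) // !addr0.
- by rewrite memvD.
- by apply: contra yU => h1; rewrite -(addrK z y) memvB.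
- by rewrite BfDl h add0r.
Qed.

(** Modulo [H], the space [perp H] is a hyperbolic plane, on which the form is [a * b * Bf x y]; it
    vanishes on the two axes only. This is the point where the quadric being hyperbolic is felt. *)
Lemma two_max H N N2 P : ts N -> ts N2 -> ts P -> \dim N = n -> \dim N2 = n ->
  \dim P = n -> (\dim H).+1 = n -> (H <= N)%VS -> (H <= N2)%VS -> (H <= P)%VS ->
  N <> N2 -> P = N \/ P = N2.
Proof.
move=> tN tN2 tP dN dN2 dP dH HN HN2 HP NN2.
have pick W : \dim W = n -> (H <= W)%VS ->
    exists x, [/\ x \in W, x \notin H & W = (H + <[x]>)%VS].
  move=> dW HW; have : ~~ (W <= H)%VS by apply/negP => /dimvS; lia.
  case/subvPn' => x xW xH; exists x; split=> //.
  apply/esym/eqP; rewrite eqEdim subv_add HW -memvE xW dim_add_line //=; lia.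
have [x [xN xH Ne]] := pick _ dN HN.
have [y [yN yH N2e]] := pick _ dN2 HN2.
have [p [pP pH Pe]] := pick _ dP HP.
have inP W : ts W -> (H <= W)%VS -> (W <= perp H)%VS.
  by move=> tW HW; apply: subv_trans (tsP tW) (perpS HW).
have xy : Bf x y != 0.
  apply/negP => /eqP xy; apply: NN2.
  have yperp : y \in perp N.
    rewrite Ne perpD memv_cap (subvP (inP _ tN2 HN2)) //=.
    by apply/perp1P.
  rewrite (perp_max tN dN) in yperp.
  by apply/esym/eqP; rewrite eqEdim N2e subv_add HN -memvE yperp -N2e dN dN2 /=.
have pS : p \in (N + <[y]>)%VS.
  have -> : (N + <[y]>)%VS = perp H.
    apply/eqP; rewrite eqEdim subv_add inP // -memvE (subvP (inP _ tN2 HN2)) //=.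
    rewrite dim_add_line ?dim_perp.
      by move: dN dH; move: (\dim N) (\dim H) => c d; clear; lia.
    by apply/negP => yN'; move: xy; rewrite (ts_orth tN) ?eqxx.
  exact: (subvP (inP _ tP HP)).
have [b] := (add_line_mem _ _ _).1 pS; rewrite Ne => /add_line_mem[a hab].
have [h {}hab pE] : exists2 h, h \in H & p = h + a *: x + b *: y.
  by exists (p - b *: y - a *: x); rewrite // !subrK.
have hx : Bf h x = 0 by rewrite (ts_orth tN) //; apply: (subvP HN).
have hy : Bf h y = 0 by rewrite (ts_orth tN2) //; apply: (subvP HN2).
have := tP _ pP; rewrite pE !QfD !QfZ (tN x) // (tN2 y) //.
rewrite (tN h) ?(subvP HN) // !BfE hx hy !mulr0 !addr0 !add0r.
move/eqP; rewrite !mulf_eq0 (negPf xy) orbF => /orP[/eqP b0|/eqP a0].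
- left; apply/eqP; rewrite -Ne eqEdim dP dN leqnn andbT Pe subv_add HN -memvE /=.
  by rewrite pE b0 scale0r addr0 memvD ?memvZ // (subvP HN).
- right; apply/eqP; rewrite eqEdim dP dN2 leqnn andbT Pe subv_add HN2 -memvE /=.
  by rewrite pE a0 scale0r addr0 memvD ?memvZ // (subvP HN2).
Qed.

Lemma other_max H N : ts N -> \dim N = n -> (\dim H).+1 = n -> (H <= N)%VS ->
  exists N2, [/\ ts N2, \dim N2 = n, (H <= N2)%VS & N2 <> N].
Proof.
move=> tN dN dH HN.
have : ~~ (N <= H)%VS by apply/negP => /dimvS; lia.
case/subvPn' => x xN xH.
have tH : ts H by apply: ts_sub HN.
have [z [qz zH zx]] := sing_sep tH xH.
have zH' : z \notin H.
  by apply/negP => zin; move: zx; rewrite (ts_orth tN) ?eqxx // (subvP HN).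
exists (H + <[z]>)%VS; split; first exact: ts_addl.
- by rewrite dim_add_line.
- exact: addvSl.
- move=> e; move: zx; rewrite (ts_orth tN) ?eqxx // -e.
  by apply: (subvP (addvSr _ _)); exact: memv_line.
Qed.

Lemma dim_hyp_cap H N M : ts M -> \dim M = n -> ts N -> \dim N = n ->
  (H <= N)%VS -> (\dim H).+1 = n ->
  \dim (M :&: perp H) = (\dim (M :&: H)).+1.
Proof. by move=> tM dM tN dN HN dH; have := dim_max_perp H tM dM; lia. Qed.

(* Of the two maximal subspaces through H, exactly one contains M :&: perp H. *)
Lemma adj_dim H N N2 M : ts N -> ts N2 -> ts M -> \dim N = n -> \dim N2 = n ->
  \dim M = n -> (\dim H).+1 = n -> (H <= N)%VS -> (H <= N2)%VS -> N <> N2 ->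
  odd (\dim (M :&: N)) = ~~ odd (\dim (M :&: N2)).
Proof.
move=> tN tN2 tM dN dN2 dM dH HN HN2 NN2.
have tH : ts H by apply: ts_sub HN.
have capH : (N :&: N2)%VS = H.
  apply/esym/eqP; rewrite eqEdim subv_cap HN HN2 /= -ltnS dH.
  rewrite ltnNge; apply/negP => h; apply: NN2.
  have e1 : (N :&: N2)%VS = N by apply/eqP; rewrite eqEdim capvSl dN.
  by rewrite -e1; apply/eqP; rewrite eqEdim capvSr e1 dN dN2 /=.
have key A B : ts A -> ts B -> \dim A = n -> \dim B = n -> (A :&: B)%VS = H ->
    projM M H = A -> odd (\dim (M :&: A)) = ~~ odd (\dim (M :&: B)).
  move=> tA tB dA dB cH pA.
  have HA : (H <= A)%VS by rewrite -cH capvSl.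
  have HB : (H <= B)%VS by rewrite -cH capvSr.
  have e1 : (M :&: A = M :&: perp H)%VS.
    apply/eqP; rewrite eqEsubv !subv_cap !capvSl /=; apply/andP; split.
      by apply: subv_trans (capvSr _ _) _; apply: subv_trans (tsP tA) (perpS HA).
    by rewrite -pA /projM addvSr.
  have e2 : (M :&: B = M :&: H)%VS.
    apply/eqP; rewrite eqEsubv !subv_cap !capvSl /=; apply/andP; split; last first.
      exact: subv_trans (capvSr _ _) HB.
    rewrite -cH subv_cap capvSr andbT.
    apply: (subv_trans _ (capvSr M A)); rewrite e1 subv_cap capvSl /=.
    by apply: subv_trans (capvSr _ _) _; apply: subv_trans (tsP tB) (perpS HB).
  by rewrite e1 e2 (dim_hyp_cap tM dM tA dA HA dH).
have [e|e] : projM M H = N \/ projM M H = N2.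
  by apply: (two_max tN tN2 _ dN dN2 _ dH) => //;
    [exact: projM_ts|exact: projM_dim|exact: addvSl].
- exact: key.
- by rewrite (key N2 N) ?negbK // capvC.
Qed.

(** One step of a path from [N] to [P] among maximal subspaces: a vector [p] of [P] outside [N] is
    joined to the hyperplane of [N] orthogonal to it, and this hyperplane contains [N :&: P]. *)
Lemma adj_step N P : ts N -> ts P -> \dim N = n -> \dim P = n -> N <> P ->
  exists H N2, [/\ ts N2, \dim N2 = n & (\dim H).+1 = n] /\
    [/\ (H <= N)%VS, (H <= N2)%VS, N <> N2 &
     (\dim (N :&: P) < \dim (N2 :&: P))%N].
Proof.
move=> tN tP dN dP NP.
have : ~~ (P <= N)%VS.
  by apply/negP => h; apply: NP; apply/esym/eqP; rewrite eqEdim h dN dP /=.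
case/subvPn' => p pP pN.
have qp := tP _ pP.
pose H := (N :&: perp <[p]>)%VS.
have tH : ts H by exact: ts_cap.
have pH : p \notin H by apply: contra pN => /memv_capP[].
have tN2 : ts (H + <[p]>).
  apply: ts_addl => //; apply/perpP => u /memv_capP[_ /perp1P].
  by rewrite BfC.
have d2 := ts_dim tN2; rewrite dim_add_line // in d2.
have d1 := dim_cap_perp1 N p; rewrite -/H in d1.
have dH : (\dim H).+1 = n by lia.
exists H, (H + <[p]>)%VS; do !split => //.
- by rewrite dim_add_line.
- exact: capvSl.
- exact: addvSl.
- by move=> e; case/negP: pN; rewrite e (subvP (addvSr _ _)) // memv_line.
- have <- : \dim ((N :&: P) + <[p]>) = (\dim (N :&: P)).+1.
    by rewrite dim_add_line //; apply: contra pN => /memv_capP[].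
  apply: dimvS; rewrite subv_add !subv_cap capvSr addvSr -memvE pP !andbT /=.
  apply: subv_trans (addvSl _ _); rewrite subv_cap capvSl /=.
  apply/subvP => u /memv_capP[_ uP]; apply/perp1P.
  exact: (ts_orth tP).
Qed.

(** Each step of [adj_step] brings [N] closer to [P] and, by [adj_dim], changes the parity of the
    dimension of the intersection with [M] and of that with [P]. *)
Lemma dim_parity M N P : ts M -> ts N -> ts P ->
  \dim M = n -> \dim N = n -> \dim P = n ->
  odd (\dim (M :&: N)) (+) odd (\dim (M :&: P)) = odd (n - \dim (N :&: P)).
Proof.
move=> tM tN tP dM dN dP.
have [k] := ubnP (n - \dim (N :&: P)); elim: k N tN dN => // k IH N tN dN hk.
have [->|/eqP NP] := eqVneq N P; first by rewrite addbb capvv dP subnn.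
have [H [N2 [[tN2 dN2 dH] [HN HN2 NN2 lt]]]] := adj_step tN tP dN dP NP.
have le := dimvS (capvSr N2 P); rewrite dP in le.
have h1 := IH N2 tN2 dN2 ltac:(lia).
rewrite (adj_dim tN tN2 tM dN dN2 dM dH) // addNb h1.
have := adj_dim tN tN2 tP dN dN2 dP dH HN HN2 NN2.
rewrite ![(P :&: _)%VS]capvC !oddB //; last by lia.
by move=> ->; case: (odd n); case: (odd _).
Qed.

(** This frees the two classes from the reference subspace [M0]: only the dimension of an
    intersection matters, and collineations preserve it. *)
Lemma cls_dim M N : ts M -> ts N -> \dim M = n -> \dim N = n ->
  (cls_low M == cls_low N) = (odd (\dim (M :&: N)) == odd n).
Proof.
move=> tM tN dM dN; rewrite /cls_low.
have := dim_parity M0_ts tM tN M0_dim dM dN.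
rewrite ![(M0 K n :&: _)%VS]capvC oddB;
  last by have := dimvS (capvSr M N); rewrite dN.
by case: (odd n); case: (odd (\dim (M :&: N))); case: (odd _); case: (odd _).
Qed.

End Form.

(** * Collineations *)

Section Points.
Variables (K : fieldType) (n : nat).
Notation V := 'rV[K]_(n + n).
Notation sub := {vspace V}.
Implicit Types (x y z : V) (U W M N L : sub).

Lemma line_eqP x y : y != 0 -> y \in <[x]>%VS -> <[y]>%VS = <[x]>%VS.
Proof.
move=> y0 h; apply/eqP; rewrite eqEdim -memvE h !dim_vline y0.
by case: (x != 0).
Qed.

Lemma line_sym x y : x != 0 -> x \in <[y]>%VS -> y \in <[x]>%VS.
Proof. by move=> x0 h; rewrite (line_eqP x0 h) memv_line. Qed.

Lemma pointP (p : sub) : is_point p <-> exists2 x, sv x & p = <[x]>%VS.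
Proof.
split=> [[tp dp]|[x [qx x0] ->]]; last first.
  by split; [exact: ts_line|rewrite dim_vline x0].
have p0 : vpick p != 0 by rewrite vpick0 -dimv_eq0 dp.
exists (vpick p); first by split=> //; apply: tp; exact: memv_pick.
by apply/esym/eqP; rewrite eqEdim -memvE memv_pick dim_vline p0 dp.
Qed.

Lemma svP U x : ts U -> x \in U -> x != 0 -> sv x.
Proof. by move=> tU /tU qx x0. Qed.

Lemma sv_point x : sv x -> is_point <[x]>.
Proof. by move=> h; apply/pointP; exists x. Qed.

Lemma sv_line x y : sv x -> y != 0 -> y \in <[x]>%VS -> sv y.
Proof. by move=> [qx x0] y0 h; apply: svP y0 => //; [exact: ts_line qx|]. Qed.

Lemma subv_sv U W : ts U -> (forall x, sv x -> x \in U -> x \in W) ->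
  (U <= W)%VS.
Proof.
move=> tU h; apply/subvP => x xU; have [->|x0] := eqVneq x 0; first exact: mem0v.
exact: (h _ (svP tU xU x0) xU).
Qed.

Lemma dim2 x y : x != 0 -> y \notin <[x]>%VS -> \dim (<[x]> + <[y]>) = 2.
Proof. by move=> x0 h; rewrite dim_add_line // dim_vline x0. Qed.

Lemma ts2 x y : Qf x = 0 -> Qf y = 0 -> Bf x y = 0 -> ts (<[x]> + <[y]>)%VS.
Proof. by move=> hx hy h; apply: ts_addl => //; [exact: ts_line|exact/perp1P]. Qed.

Lemma line2 x y : sv x -> sv y -> Bf x y = 0 -> y \notin <[x]>%VS ->
  is_line (<[x]> + <[y]>).
Proof. by move=> [qx x0] [qy y0] h ni; split; [exact: ts2|exact: dim2]. Qed.

Lemma mem2P x y z :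
  reflect (exists a b, z = a *: x + b *: y) (z \in <[x]> + <[y]>)%VS.
Proof.
apply: (iffP memv_addP) => [[u /vlineP[a ->] [v /vlineP[b ->] ->]]|[a [b ->]]].
  by exists a, b.
by exists (a *: x); rewrite ?memvZ ?memv_line //; exists (b *: y);
  rewrite ?memvZ ?memv_line.
Qed.

Lemma mem2l x y : x \in (<[x]> + <[y]>)%VS.
Proof. by apply: (subvP (addvSl _ _)); exact: memv_line. Qed.
Lemma mem2r x y : y \in (<[x]> + <[y]>)%VS.
Proof. by apply: (subvP (addvSr _ _)); exact: memv_line. Qed.

Lemma sub2 x y U : x \in U -> y \in U -> (<[x]> + <[y]> <= U)%VS.
Proof. by move=> hx hy; rewrite subv_add -!memvE hx. Qed.

Lemma perp2 x y z : Bf x z = 0 -> Bf y z = 0 -> z \in perp (<[x]> + <[y]>).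
Proof. by move=> hx hy; rewrite perpD memv_cap; apply/andP; split; exact/perp1P. Qed.

Lemma dim2_eq U x y : \dim U = 2 -> x \in U -> y \in U -> x != 0 ->
  y \notin <[x]>%VS -> U = (<[x]> + <[y]>)%VS.
Proof.
by move=> dU xU yU x0 h; apply/esym/eqP; rewrite eqEdim sub2 // dim2 ?dU.
Qed.

Lemma line_basis L x : is_line L -> x \in L -> x != 0 ->
  exists y, [/\ sv y, y \notin <[x]>%VS, Bf x y = 0 & L = (<[x]> + <[y]>)%VS].
Proof.
move=> [tL dL] xL x0; have : ~~ (L <= <[x]>)%VS.
  by apply/negP => /dimvS; rewrite dL dim_vline; case: (x != 0).
case/subvPn' => y yL yx; exists y; split=> //; last exact: dim2_eq.
  by apply: (svP tL yL); apply: contraNneq yx => ->; exact: mem0v.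
exact: (ts_orth tL).
Qed.

Lemma line_pick L : is_line L -> exists2 x, sv x & x \in L.
Proof.
move=> [tL dL]; exists (vpick L); last exact: memv_pick.
by apply: (svP tL (memv_pick _)); rewrite vpick0 -dimv_eq0 dL.
Qed.

End Points.

(** * The action of a collineation on singular subspaces *)

Section Image.
Variables (K : fieldType) (n : nat).
Notation V := 'rV[K]_(n + n).
Notation sub := {vspace V}.
Implicit Types (x y z : V) (U W M N L : sub).
Variable th : sub -> sub.
Hypothesis hth : collineation th.

(** An arbitrary vector spanning the image point; it is neither additive nor homogeneous in [x]. *)
Definition tau x : V := vpick (th <[x]>).

Lemma tau_line x : sv x -> th <[x]> = <[tau x]>%VS /\ sv (tau x).
Proof.
move=> sx; have [h _] := hth; have hp := h _ (sv_point sx).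
have [t1 d1] := hp.
have p0 : tau x != 0 by rewrite vpick0 -dimv_eq0 d1.
split; first by apply/eqP; rewrite eq_sym eqEdim -memvE memv_pick dim_vline p0 d1.
exact: svP t1 (memv_pick _) p0.
Qed.

Lemma tau_sv x : sv x -> sv (tau x). Proof. by case/tau_line. Qed.
Lemma tau_neq0 x : sv x -> tau x != 0. Proof. by case/tau_line => _ []. Qed.

Lemma tau_inj x y : sv x -> sv y -> tau y \in <[tau x]>%VS -> y \in <[x]>%VS.
Proof.
move=> sx sy h; have [e1 s1] := tau_line sx; have [e2 s2] := tau_line sy.
have [_ [inj _]] := hth.
rewrite -(inj _ _ (sv_point sy) (sv_point sx)) ?memv_line //.
by rewrite e1 e2; apply: line_eqP => //; case: s2.
Qed.

Lemma tau_prop x y : sv x -> sv y -> y \in <[x]>%VS -> tau y \in <[tau x]>%VS.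
Proof.
move=> sx sy h; have [e1 s1] := tau_line sx; have [e2 s2] := tau_line sy.
by rewrite -e1 -(line_eqP _ h) ?e2 ?memv_line //; case: sy.
Qed.

Lemma tau_surj y : sv y -> exists2 x, sv x & y \in <[tau x]>%VS.
Proof.
move=> sy; have [_ [_ [surj _]]] := hth.
have [p [/pointP[x sx ->] e]] := surj _ (sv_point sy).
by exists x => //; rewrite -(tau_line sx).1 e memv_line.
Qed.

Lemma imgSP U W : ts U ->
  imgS th U W <-> ts W /\ forall x, sv x -> (x \in U <-> tau x \in W).
Proof.
move=> tU; split=> [[tW h]|[tW h]]; split=> //.
  move=> x sx; have [e s] := tau_line sx; split=> [xU|].
    have /(h _ (sv_point s)) : exists q, pts U q /\ th q = <[tau x]>%VS.
      by exists <[x]>%VS; split=> //; split; [exact: sv_point|rewrite -memvE].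
    by rewrite -memvE.
  rewrite memvE; case/(h _ (sv_point s)) => q [[/pointP[y sy ->]]].
  rewrite -memvE => yU ey; apply: (subvP (_ : <[y]> <= U)%VS).
    by rewrite -memvE.
  apply: tau_inj => //; rewrite -(tau_line sy).1 ey memv_line //.
move=> p /pointP[y sy ->]; have [x sx yx] := tau_surj sy.
have y0 : y != 0 by case: sy.
have e := line_eqP y0 yx; split=> [|[q [[/pointP[z sz ->]]]]].
  rewrite e -memvE => /(h _ sx) xU; exists <[x]>%VS; split.
    by split; [exact: sv_point|rewrite -memvE].
  by rewrite (tau_line sx).1.
rewrite -memvE => zU; rewrite (tau_line sz).1 => <-; rewrite -memvE.
exact/(h _ sz).
Qed.

Lemma imgS_line x y : sv x -> sv y -> Bf x y = 0 -> y \notin <[x]>%VS ->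
  is_line (<[tau x]> + <[tau y]>) /\
  imgS th (<[x]> + <[y]>) (<[tau x]> + <[tau y]>).
Proof.
move=> sx sy oxy ni; have hL := line2 sx sy oxy ni.
have [_ [_ [_ [hl _]]]] := hth; have [L' [hL' im]] := hl _ hL.
have [tL' h] := (imgSP L' hL.1).1 im.
suff e : L' = (<[tau x]> + <[tau y]>)%VS by rewrite -e.
apply: dim2_eq; first by case: hL'.
- by apply/(h _ sx); exact: mem2l.
- by apply/(h _ sy); exact: mem2r.
- exact: tau_neq0.
- by apply: contra ni; exact: tau_inj.
Qed.

Lemma tau_orth x y : sv x -> sv y -> Bf x y = 0 -> Bf (tau x) (tau y) = 0.
Proof.
move=> sx sy h; have [hin|ni] := boolP (y \in <[x]>%VS).
  have /vlineP[k ->] := tau_prop sx sy hin.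
  by rewrite BfZr Bfxx0 ?mulr0 //; case: (tau_sv sx).
have [[t d] _] := imgS_line sx sy h ni.
by apply: (ts_orth t); [exact: mem2l|exact: mem2r].
Qed.

(** [collineation] provides images of lines only. The nonzero vectors on images of points of [U] are
    pairwise orthogonal and closed under joining by lines ([XD]), so a singular subspace made of
    such vectors can be enlarged until it contains them all; the bound [n] on dimensions stops the
    process. *)
Lemma img_exists U : ts U -> exists W, imgS th U W.
Proof.
move=> tU.
pose X y := y != 0 /\ exists x, [/\ sv x, x \in U & y \in <[tau x]>%VS].
have Xsv y : X y -> sv y.
  by move=> [y0 [x [sx _ h]]]; apply: (sv_line (tau_sv sx)).
have Xorth y1 y2 : X y1 -> X y2 -> Bf y1 y2 = 0.
  move=> [_ [x1 [s1 u1 /vlineP[a1 ->]]]] [_ [x2 [s2 u2 /vlineP[a2 ->]]]].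
  by rewrite BfZl BfZr tau_orth ?mulr0 // (ts_orth tU).
have XD y1 y2 z : X y1 -> X y2 -> z != 0 -> z \in (<[y1]> + <[y2]>)%VS -> X z.
  move=> h1 h2 z0 hz; have [y10 [x1 [s1 u1 m1]]] := h1.
  have [y20 [x2 [s2 u2 m2]]] := h2.
  have sz : sv z.
    by apply: (svP (ts2 (Xsv _ h1).1 (Xsv _ h2).1 (Xorth _ _ h1 h2)) hz).
  rewrite (line_eqP y10 m1) (line_eqP y20 m2) in hz; split=> //.
  have [hin|ni] := boolP (x2 \in <[x1]>%VS).
    exists x1; split=> //; apply: (subvP _ _ hz).
    by rewrite subv_add subvv -memvE tau_prop.
  have [hl im] := imgS_line s1 s2 (ts_orth tU u1 u2) ni.
  have [[t _] [_ im2]] := (hl, im).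
  have [p [[/pointP[x sx ->] hx] e]] : exists q, pts (<[x1]> + <[x2]>) q /\ th q = <[z]>%VS.
    by apply/(im2 _ (sv_point sz)); rewrite -memvE.
  exists x; split=> //; last by rewrite -(tau_line sx).1 e memv_line.
  by rewrite memvE; apply: subv_trans hx _; apply: sub2.
have [W [tW hW max]] : exists W, [/\ ts W, forall y, y \in W -> y != 0 -> X y
    & forall y, X y -> y \in W].
  have : exists W, ts W /\ forall y, y \in W -> y != 0 -> X y.
    exists 0%VS; split; first exact: ts0.
    by move=> y; rewrite memv0 => ->.
  case=> W; have [k] := ubnP (n - \dim W); elim: k W => // k IH W hk [tW hW].
  case: (classic (forall y, X y -> y \in W)) => [h|/not_all_ex_not[y ny]].
    by exists W.
  have [Xy yW] : X y /\ y \notin W.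
    by have [Xy h] := imply_to_and _ _ ny; split=> //; exact/negP.
  have yperp : y \in perp W.
    apply/perpP => w wW; have [->|w0] := eqVneq w 0; first exact: Bf0l.
    by apply: Xorth => //; exact: hW.
  apply: (IH (W + <[y]>)%VS).
    have := ts_dim (ts_addl tW (Xsv _ Xy).1 yperp); rewrite dim_add_line //; lia.
  split; first exact: ts_addl (Xsv _ Xy).1 yperp.
  move=> z /memv_addP[w wW [v /vlineP[a ->] ->]] z0.
  have [w0|w0] := eqVneq w 0.
    apply: (XD y y) => //; rewrite w0 add0r memvZ //; exact: mem2l.
  by apply: (XD w y) => //; [exact: hW|apply/mem2P; exists 1, a; rewrite scale1r].
exists W; apply/(imgSP _ tU); split=> // x sx; split=> [xU|xW].
  by apply: max; split; [exact: tau_neq0|exists x; rewrite memv_line].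
have [_ [z [sz zU h]]] := hW _ xW (tau_neq0 sx).
apply: (subvP (_ : <[z]> <= U)%VS); first by rewrite -memvE.
exact: tau_inj.
Qed.

Definition im U : sub := epsilon (inhabits 0%VS) (fun W => imgS th U W).

Lemma imP U : ts U -> imgS th U (im U).
Proof. by move=> tU; apply: epsilon_spec; exact: img_exists. Qed.

Lemma im_ts U : ts U -> ts (im U).
Proof. by move=> tU; case: (imP tU). Qed.

Lemma mem_im U x : ts U -> sv x -> (tau x \in im U) = (x \in U).
Proof.
move=> tU sx; have [_ h] := (imgSP _ tU).1 (imP tU).
by apply/idP/idP => /(h _ sx).
Qed.

Lemma mem_im' U y : ts U -> sv y -> y \in im U ->
  exists x, [/\ sv x, x \in U & y \in <[tau x]>%VS].
Proof.
move=> tU sy yU; have [x sx h] := tau_surj sy; exists x; split=> //.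
rewrite -mem_im //; have [_ y0] := sy.
by rewrite memvE -(line_eqP y0 h) -memvE.
Qed.

Lemma im_uniq U W : ts U -> imgS th U W -> W = im U.
Proof.
move=> tU /(imgSP _ tU)[tW h].
apply/eqP; rewrite eqEsubv; apply/andP; split; apply: subv_sv => //.
- move=> y sy yW; have [x sx hx] := tau_surj sy.
  have [_ y0] := sy.
  rewrite memvE (line_eqP y0 hx) -memvE mem_im //; apply/(h _ sx).
  by rewrite memvE -(line_eqP y0 hx) -memvE.
- exact: im_ts.
- move=> y sy /(mem_im' tU sy)[x [sx xU hx]].
  by apply: (subvP (_ : <[tau x]> <= W)%VS) => //; rewrite -memvE; apply/(h _ sx).
Qed.

Lemma imS U W : ts U -> ts W -> (im U <= im W)%VS = (U <= W)%VS.
Proof.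
move=> tU tW; apply/idP/idP => /subvP h.
  apply: subv_sv => // x sx; rewrite -mem_im // -[x \in W]mem_im //; exact: h.
apply: subv_sv; first exact: im_ts.
move=> y sy /(mem_im' tU sy)[x [sx /h xU hx]].
by apply: (subvP (_ : <[tau x]> <= im W)%VS) => //; rewrite -memvE mem_im.
Qed.

Lemma im_inj U W : ts U -> ts W -> im U = im W -> U = W.
Proof.
by move=> tU tW e; apply/eqP; rewrite eqEsubv -(imS tU tW) -(imS tW tU) e subvv.
Qed.

Lemma im_cap U W : ts U -> ts W -> im (U :&: W) = (im U :&: im W)%VS.
Proof.
move=> tU tW; have tC : ts (U :&: W) := ts_cap tU; apply/esym/im_uniq => //; apply/imgSP => //.
split; first exact: ts_cap (im_ts tU).
by move=> x sx; rewrite !memv_cap !mem_im.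
Qed.

Lemma im2 x y : sv x -> sv y -> Bf x y = 0 -> y \notin <[x]>%VS ->
  im (<[x]> + <[y]>) = (<[tau x]> + <[tau y]>)%VS.
Proof.
move=> sx sy o ni; apply/esym/im_uniq; first by case: (line2 sx sy o ni).
by case: (imgS_line sx sy o ni).
Qed.

Lemma im1 x : sv x -> im <[x]> = <[tau x]>%VS.
Proof.
move=> sx; have t := ts_line sx.1; apply/esym/im_uniq => //; apply/imgSP => //.
split; first exact: ts_line (tau_sv sx).1.
by move=> y sy; split; [exact: tau_prop|exact: tau_inj].
Qed.

Lemma im0 : im 0 = 0%VS.
Proof.
apply/esym/im_uniq; first exact: ts0.
apply/imgSP; first exact: ts0.
split; first exact: ts0.
move=> x sx; rewrite !memv0 (negPf (tau_neq0 sx)).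
by case: sx => _ /negPf ->.
Qed.

(** A strictly increasing chain of subspaces of [U] has a strictly increasing image. Equality
    ([dim_im]) comes from the same bound for the inverse. *)
Lemma dim_im_le U : ts U -> (\dim U <= \dim (im U))%N.
Proof.
have [k] := ubnP (\dim U); elim: k U => // k IH U hk tU.
have [->|U0] := eqVneq U 0%VS; first by rewrite dimv0.
pose x := vpick U; have x0 : x != 0 by rewrite vpick0.
pose U1 := (U :\: <[x]>)%VS.
have dU : \dim U = (\dim U1).+1.
  have xU : (<[x]> <= U)%VS by rewrite -memvE memv_pick.
  by rewrite -(dimv_cap_compl U <[x]>) (capv_idPr xU) dim_vline x0.
have U1U : (U1 <= U)%VS by exact: diffvSl.
have t1 : ts U1 by apply: ts_sub U1U.
have h := IH U1 ltac:(lia) t1.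
rewrite dU; apply: leq_ltn_trans h _.
rewrite ltn_neqAle dimvS ?imS // andbT; apply/eqP => e.
have : im U1 = im U by apply/eqP; rewrite eqEdim imS // U1U e leqnn.
by move/(im_inj t1 tU) => e2; move: dU; rewrite {1}e2; lia.
Qed.
End Image.

(** * The inverse collineation *)

Section Inverse.
Variables (K : fieldType) (n : nat).
Notation V := 'rV[K]_(n + n).
Notation sub := {vspace V}.
Implicit Types (x y z : V) (U W M N L : sub).
Variable th : sub -> sub.
Hypothesis hth : collineation th.

Definition thi (p : sub) : sub :=
  epsilon (inhabits 0%VS) (fun q => is_point q /\ th q = p).

Lemma thiP p : is_point p -> is_point (thi p) /\ th (thi p) = p.
Proof.
move=> hp; apply: (epsilon_spec _ (fun q => is_point q /\ th q = p)).
by have [_ [_ [h _]]] := hth; exact: h.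
Qed.

Lemma thiK p : is_point p -> thi (th p) = p.
Proof.
move=> hp; have [h1 [inj _]] := hth; have [hp' e] := thiP (h1 _ hp).
exact: inj.
Qed.

Lemma imgS_thi U W : ts U -> imgS th U W -> imgS thi W U.
Proof.
move=> tU [tW h]; split=> // p hp; have [h1 _] := hth; split=> [pU|].
  exists (th p); split; last exact: thiK.
  split; first exact: h1.
  by apply/(h _ (h1 _ hp)); exists p.
move=> [q [[hq qW] e]].
have [p2 [[hp2 p2U] e2]] := (h _ hq).1 qW.
by rewrite -e -e2 thiK.
Qed.

Lemma collineation_thi : collineation thi.
Proof.
have [h1 [h2 [h3 [h4 h5]]]] := hth; split; [|split; [|split; [|split]]].
- by move=> p /thiP[].
- by move=> p q hp hq e; rewrite -(thiP hp).2 e (thiP hq).2.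
- by move=> p hp; exists (th p); split; [exact: h1|exact: thiK].
- move=> L hL; have [L' [hL' i]] := h5 _ hL; exists L'; split=> //.
  by apply: imgS_thi i; case: hL'.
- move=> L hL; have [L' [hL' i]] := h4 _ hL; exists L'; split=> //.
  by apply: imgS_thi i; case: hL.
Qed.

Lemma im_thiK U : ts U -> im thi (im th U) = U.
Proof.
move=> tU; apply/esym; apply: (im_uniq collineation_thi); first exact: im_ts.
by apply: imgS_thi => //; exact: imP.
Qed.

Lemma dim_im U : ts U -> \dim (im th U) = \dim U.
Proof.
move=> tU; apply/eqP; rewrite eqn_leq dim_im_le // andbT.
by rewrite -{2}(im_thiK tU); apply: dim_im_le; [exact: collineation_thi|exact: im_ts].
Qed.

Lemma im_surj W : ts W -> exists2 U, ts U & im th U = W.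
Proof.
move=> tW; have tU := im_ts collineation_thi tW; exists (im thi W) => //.
apply/esym/im_uniq => //; have [_ h] := imP collineation_thi tW.
split=> // p hp; split=> [pW|[q [[hq hqU] <-]]].
  exists (thi p); split; last by case: (thiP hp).
  by split; [case: (thiP hp)|apply/(h _ (thiP hp).1); exists p].
have [p2 [[hp2 p2W] e]] := (h _ hq).1 hqU.
by rewrite -e (thiP hp2).2.
Qed.

Lemma tau_orthE x y : sv x -> sv y ->
  (Bf (tau th x) (tau th y) = 0) <-> (Bf x y = 0).
Proof.
move=> sx sy; split; last exact: tau_orth.
move=> h; have := tau_orth collineation_thi (tau_sv hth sx) (tau_sv hth sy) h.
have aux z : sv z -> z \in <[tau thi (tau th z)]>%VS.
  move=> sz; rewrite -(tau_line collineation_thi (tau_sv hth sz)).1.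
  by rewrite -(tau_line hth sz).1 thiK ?memv_line //; exact: sv_point.
have /vlineP[a ea] := aux _ sx; have /vlineP[b eb] := aux _ sy.
by move=> h2; rewrite ea eb BfZl BfZr h2 !mulr0.
Qed.

(** Dimensions of intersections are preserved, and by [cls_dim] they decide whether two maximal
    subspaces have the same class; so it is enough to record whether [M0] changes class. *)
Lemma im_cls : exists sw, forall M, ts M -> \dim M = n ->
  cls_low (im th M) = cls_low M (+) sw.
Proof.
exists (cls_low (im th (M0 K n)) (+) cls_low (M0 K n)) => M tM dM.
have t0 := @M0_ts K n; have d0 := M0_dim K n.
have := cls_dim (im_ts hth tM) (im_ts hth t0) (etrans (dim_im tM) dM)
  (etrans (dim_im t0) d0).
rewrite -im_cap // (dim_im (ts_cap tM)) -(cls_dim tM t0 dM d0).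
by do 4! case: (cls_low _).
Qed.

End Inverse.

(** * Kangaroos *)

Section Kangaroo.
Variables (K : fieldType) (n : nat).
Notation V := 'rV[K]_(n + n).
Notation sub := {vspace V}.
Implicit Types (x y z : V) (U W M N L : sub).

(** For two lines this is the symmetry of position [2']: one has a point collinear to all of the
    other if and only if the other does. *)
Lemma dim_cross U W :
  (\dim (U :&: perp W) + \dim W = \dim (W :&: perp U) + \dim U)%N.
Proof.
have := dimv_sum_cap U (perp W).
rewrite -{1}(perpK U) -perp_cap !dim_perp [(perp U :&: W)%VS]capvC.
have := dim_le W; have := dim_le (W :&: perp U)%VS; lia.
Qed.

Lemma cross_neq0 L M : is_line L -> is_line M ->
  (L :&: perp M != 0)%VS -> (M :&: perp L != 0)%VS.
Proof.
move=> [_ dL] [_ dM]; rewrite -!dimv_eq0; have := dim_cross L M.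
rewrite dL dM; lia.
Qed.

Lemma cap_pick U W : (U :&: W != 0)%VS -> exists x, [/\ x \in U, x \in W & x != 0].
Proof.
move=> h; exists (vpick (U :&: W)%VS).
by have /memv_capP[-> ->] := memv_pick (U :&: W)%VS; rewrite vpick0.
Qed.

Lemma cap_neq0 U W x : x \in U -> x \in W -> x != 0 -> (U :&: W != 0)%VS.
Proof.
move=> h1 h2; apply: contra => /eqP e.
by rewrite -memv0 -e memv_cap h1.
Qed.

Lemma cap_dim U W P : (U <= P)%VS -> (W <= P)%VS -> (\dim P < \dim U + \dim W)%N ->
  (U :&: W != 0)%VS.
Proof.
move=> UP WP h; rewrite -dimv_eq0; apply: contraL h => /eqP e.
by rewrite -dimv_sum_cap e addn0 -leqNgt dimvS // subv_add UP.
Qed.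

Lemma coll_allP x M : sv x -> ts M -> coll_all <[x]> M <-> x \in perp M.
Proof.
move=> [qx x0] tM; split=> [h|/perpP h q [/pointP[y [qy _] ->]]].
  apply/perpP => y yM; have [->|y0] := eqVneq y 0; first exact: Bf0l.
  have sy := svP tM yM y0.
  have t := h <[y]>%VS (conj (sv_point sy) yM).
  by apply: (ts_orth t); [exact: mem2r|exact: mem2l].
by rewrite -memvE => yM; apply: ts2 => //; rewrite BfC h.
Qed.

Lemma uniq_coll L M : is_line L -> is_line M -> ~~ (L <= perp M)%VS ->
  (L :&: perp M != 0)%VS -> exists! p, pts L p /\ coll_all p M.
Proof.
move=> hL hM nLM /cap_pick[x [xL xM x0]]; have [tL dL] := hL; have [tM _] := hM.
have sx := svP tL xL x0; exists <[x]>%VS; split.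
  split; first by split; [exact: sv_point|rewrite -memvE].
  exact/coll_allP.
move=> p [[/pointP[y sy ->]]]; rewrite -memvE => yL /(coll_allP sy tM) yM.
apply/eqP; rewrite eq_sym; apply/eqP; apply: line_eqP; first by case: sy.
apply/negPn/negP => ni; case/negP: nLM.
by rewrite (dim2_eq dL xL yL x0 ni) sub2.
Qed.

Lemma exch x z t : t \in (<[x]> + <[z]>)%VS -> t \notin <[x]>%VS ->
  z \in (<[x]> + <[t]>)%VS.
Proof.
case/mem2P => a [b ->] h; have b0 : b != 0.
  by apply: contraNneq h => ->; rewrite scale0r addr0 memvZ // memv_line.
apply/mem2P; exists (- (b^-1 * a)), b^-1.
by rewrite scalerDr !scalerA mulVf // scale1r addrA scaleNr addNr add0r.
Qed.

Variable th : sub -> sub.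
Hypothesis hth : collineation th.
Notation tau := (tau th).
Notation im := (im th).

(* The mutual position of L and its image is read off the dimensions of
   [L :&: im L] and [L :&: perp (im L)]: the positions 1 and 2' are those where
   the difference of the two is 1. *)
Definition kang := forall L, is_line L ->
  ((L <= perp (im L) -> L :&: im L != 0 -> L = im L)%VS /\
   (~~ (L <= perp (im L)) -> L :&: perp (im L) != 0 -> L :&: im L != 0)%VS).

Lemma im_line L : is_line L -> is_line (im L).
Proof. by move=> [tL dL]; split; [exact: im_ts|rewrite dim_im]. Qed.

(** Distinct lines lie in a common singular plane exactly when they are orthogonal and meet. In
    position [2'] it is the uniqueness of the collinear point that excludes orthogonal lines. *)
Lemma kangarooP : kangaroo12' th <-> kang.
Proof.
split=> [h L hL|h L L' hL i].
  have [tL dL] := hL; have hM := im_line hL; have [tM dM] := hM.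
  have [n1 n2] := h L _ hL (imP hth tL); split.
    move=> LM LM0; apply: NNPP => ne; apply: n1; split=> //.
    exists (L + im L)%VS; split; first exact: ts_add.
    split; last by rewrite addvSl addvSr.
    have := dimv_sum_cap L (im L); rewrite dL dM; move: LM0; rewrite -dimv_eq0.
    have := dimvS (capvSl L (im L)); rewrite dL => h2 h0.
    suff : \dim (L :&: im L) <> 2 by lia.
    move=> e; apply: ne; apply/eqP; rewrite eqEdim dM dL andbT.
    apply: (subv_trans _ (capvSr L (im L))).
    by have /eqP -> : (L :&: im L == L)%VS by rewrite eqEdim capvSl e dL.
  move=> LM /[dup] h0 /(cross_neq0 hL hM) h1; apply/negP => /eqP e; apply: n2.
  have common S : ts S -> (L <= S)%VS -> (im L <= S)%VS -> False.
    move=> tS LS MS; case/negP: LM; apply: subv_trans LS _.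
    by apply: subv_trans (tsP tS) (perpS MS).
  have np1 : ~ pos1 L (im L) by move=> [_ [P [tP [_ [h2 h3]]]]]; apply: common h2 h3.
  split.
    by move=> e2; move: e; rewrite -e2 capvv => e3; move: dL; rewrite e3 dimv0.
  split=> //; split.
    move=> [_ [_ [[p [[hp p1] [_ p2]]]|[S [tS [h2 h3]]]]]]; last exact: common h3.
    case: hp => _ dp; have : (p <= L :&: im L)%VS by rewrite subv_cap p1.
    by rewrite e subv0 -dimv_eq0 dp.
  split; apply: uniq_coll => //.
  by apply: contra LM => /perp_sym.
have [tL dL] := hL; rewrite (im_uniq hth tL i).
have hM := im_line hL; have [tM dM] := hM; have [k1 k2] := h _ hL.
split.
  move=> [ne [P [tP [dP [LP MP]]]]]; apply: ne; apply: k1.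
    by apply: subv_trans LP _; apply: subv_trans (tsP tP) (perpS MP).
  rewrite -dimv_eq0; have := dimv_sum_cap L (im L); rewrite dL dM.
  have : (\dim (L + im L) <= 3)%N by rewrite -dP dimvS // subv_add LP.
  lia.
move=> [ne [np1 [np2 [[p [[[hp pL] cp] up]] _]]]].
have [x sx px] := (pointP p).1 hp; rewrite px -memvE in pL.
move: cp; rewrite px => /(coll_allP sx tM) xM.
apply: np2; split=> //; split=> //; left.
have /cap_pick[m [mL mM m0]] : (L :&: im L != 0)%VS.
  apply: k2; last by apply: cap_neq0 xM _; case: sx.
  apply/negP => LM; have x0 : x != 0 by case: sx.
  have [y [sy yx _ Le]] := line_basis hL pL x0.
  case/negP: yx; rewrite -px (up <[y]>%VS) ?memv_line //; split.
    by split; [exact: sv_point|rewrite Le addvSr].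
  by apply/coll_allP => //; apply: (subvP LM); rewrite Le mem2r.
by exists <[m]>%VS; rewrite /pts -!memvE; have := sv_point (svP tL mL m0).
Qed.

Definition fixv x := tau x \in <[x]>%VS.
Definition fix_or_opp := forall x, sv x -> fixv x \/ Bf x (tau x) != 0.
Definition spread_like := forall x, sv x ->
  [/\ Bf x (tau x) = 0, ~~ fixv x & im (<[x]> + <[tau x]>) = (<[x]> + <[tau x]>)%VS].

Lemma fixv_sym x : sv x -> fixv x -> x \in <[tau x]>%VS.
Proof. by move=> sx h; apply: line_sym => //; exact: tau_neq0. Qed.

Lemma fixv_prop x y : sv x -> sv y -> y \in <[x]>%VS -> fixv y -> fixv x.
Proof.
move=> sx sy h fy; rewrite /fixv.
have y0 : y != 0 by case: sy.
rewrite -(line_eqP y0 h) memvE -(line_eqP _ (tau_prop hth sx sy h)); last exact: tau_neq0.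
by rewrite -memvE.
Qed.

Lemma fixv_orth x y : sv x -> fixv x -> Bf x y = 0 -> Bf (tau x) y = 0.
Proof. by move=> sx /vlineP[k ->] h; rewrite BfZl h mulr0. Qed.

Lemma fixv_orth' x y : sv x -> sv y -> fixv x -> Bf x y = 0 -> Bf x (tau y) = 0.
Proof.
move=> sx sy fx h; have /vlineP[k ->] := fixv_sym sx fx.
by rewrite BfZl (tau_orth hth) ?mulr0.
Qed.

Lemma fix_im x U : ts U -> sv x -> fixv x -> (x \in im U) = (x \in U).
Proof.
move=> tU sx fx; rewrite -(mem_im hth tU sx) [RHS]memvE.
by rewrite (line_eqP (tau_neq0 hth sx) fx) -memvE.
Qed.

(** In both clauses of [kang] the relevant points of [L] are orthogonal to their images, hence
    fixed, hence on [im L]. *)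
Lemma fix_or_opp_kang : fix_or_opp -> kang.
Proof.
move=> h L hL; have [tL dL] := hL; split=> [LM _|_ /cap_pick[x [xL xM x0]]].
  apply/eqP; rewrite eqEdim (dim_im hth tL) leqnn andbT.
  apply: subv_sv => // x sx xL; have txM : tau x \in im L by rewrite mem_im.
  case: (h _ sx) => [fx|]; first by rewrite fix_im.
  by rewrite (perp_mem' (subvP LM _ xL) txM) eqxx.
have sx := svP tL xL x0; apply: (cap_neq0 xL _ x0).
case: (h _ sx) => [fx|]; first by rewrite fix_im.
by rewrite (perp_mem' xM) ?eqxx // mem_im.
Qed.

Lemma spread_kang : fixes_line_spread th -> kang.
Proof.
move=> [Sp [hl [cov inv]]].
have SpP x : sv x -> exists S, [/\ Sp S, is_line S, x \in S, tau x \in S & im S = S].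
  move=> sx; have [S [[hS xS] _]] := cov _ (sv_point sx); have hSl := hl _ hS.
  have tS := hSl.1; have e := im_uniq hth tS (inv _ hS).
  by exists S; rewrite [in tau x \in S]e mem_im // memvE -e.
have orth x : sv x -> Bf x (tau x) = 0.
  by move=> /SpP[S [_ [tS _] h1 h2 _]]; apply: (ts_orth tS).
have Sp_eq S T x : Sp S -> Sp T -> x \in S -> x \in T -> x != 0 -> S = T.
  move=> hS hT xS xT x0; have sx := svP (hl _ hS).1 xS x0.
  have [R [_ u]] := cov _ (sv_point sx).
  by rewrite -(u S) ?(u T) // -memvE.
move=> L hL; have [tL dL] := hL; have hM := im_line hL; have [tM dM] := hM.
split=> [LM /cap_pick[m [mL mM m0]]|LM /[dup] h0 /cap_pick[v [vL vM v0]]].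
  apply: NNPP => ne; have [y [sy ym oy Le]] := line_basis hL mL m0.
  have yL : y \in L by rewrite Le mem2r.
  have out p : p \in L -> p \notin <[m]>%VS -> p \notin im L.
    move=> pL pm; apply/negP => pM; apply: ne.
    exact: etrans (dim2_eq dL mL pL m0 pm) (esym (dim2_eq dM mM pM m0 pm)).
  (* The spread line of [p] is [<p, tau p>], inside the plane [L + im L]. The spread lines of two
     such points meet there, so they coincide, and then equal [L]. *)
  have key p : p \in L -> p \notin <[m]>%VS ->
      exists S, [/\ Sp S, p \in S, (S <= L + im L)%VS & is_line S].
    move=> pL pm; have p0 : p != 0 by apply: contraNneq pm => ->; exact: mem0v.
    have sp := svP tL pL p0; have [S [hS Sl pS tpS iS]] := SpP p sp.
    exists S; split=> //; have tpM : tau p \in im L by rewrite mem_im.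
    have nt : tau p \notin <[p]>%VS.
      apply: contra (out p pL pm) => h.
      by apply: (subvP (_ : <[tau p]> <= im L)%VS); [rewrite -memvE|exact: fixv_sym].
    rewrite (dim2_eq Sl.2 pS tpS p0 nt) sub2 //.
      exact: (subvP (addvSl _ _)).
    exact: (subvP (addvSr _ _)).
  have ymL : y + m \in L by rewrite memvD.
  have ymm : y + m \notin <[m]>%VS.
    by apply: contra ym => h; rewrite -(addrK m y) memvB // memv_line.
  have [S [hS yS SL Sl]] := key _ yL ym.
  have [T [hT yT TL Tl]] := key _ ymL ymm.
  have d3 : (\dim (L + im L) <= 3)%N.
    have := dimv_sum_cap L (im L); rewrite dL dM.
    have : (\dim (L :&: im L) != 0)%N by rewrite dimv_eq0; apply: cap_neq0 mL mM m0.
    move: (\dim (L + im L)) (\dim (L :&: im L)) => a b; clear; lia.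
  have /cap_pick[s [sS sT s0]] : (S :&: T != 0)%VS.
    by apply: (cap_dim SL TL); rewrite Sl.2 Tl.2.
  have e := Sp_eq _ _ _ hS hT sS sT s0; rewrite -e in yT.
  have SeL : S = L.
    apply/esym/eqP; rewrite eqEdim dL Sl.2 /= andbT Le sub2 //.
    by rewrite -(addrK y m) [m + y]addrC memvB.
  by apply: ne; rewrite -SeL; apply: (im_uniq hth Sl.1 (inv _ hS)).
have [y [sy yv oy Le]] := line_basis hL vL v0.
have yL : y \in L by rewrite Le mem2r.
have [w [wM wL w0]] := cap_pick (cross_neq0 hL hM h0).
(* All points of [L] other than [<v>] would be mapped to [<w>]; there are at least two of them, so
   this contradicts injectivity and the case never occurs. *)
have key p : p \in L -> p \notin <[v]>%VS -> tau p \in <[w]>%VS.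
  move=> pL pv; have p0 : p != 0 by apply: contraNneq pv => ->; exact: mem0v.
  have sp := svP tL pL p0; have tpM : tau p \in im L by rewrite mem_im.
  apply/negPn/negP => nw; case/negP: LM.
  rewrite [X in (X <= _)%VS](dim2_eq dL vL pL v0 pv) sub2 //.
  rewrite (dim2_eq dM wM tpM w0 nw); apply: perp2; last by rewrite BfC orth.
  by rewrite BfC (perp_mem wL).
have yvL : y + v \in L by rewrite memvD.
have yvv : y + v \notin <[v]>%VS.
  by apply: contra yv => h; rewrite -(addrK v y) memvB // memv_line.
have yv0 : y + v != 0 by apply: contraNneq yvv => ->; exact: mem0v.
have h1 := key _ yL yv; have h2 := key _ yvL yvv.
have h3 := line_eqP (tau_neq0 hth sy) h1; rewrite -h3 in h2.
have := tau_inj hth sy (svP tL yvL yv0) h2.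
case/vlineP => k e; case/negP: yv; apply: (line_sym v0).
by rewrite -(addKr y v) e -scaleN1r -scalerDl memvZ // memv_line.
Qed.

(** * Consequences of the kangaroo condition *)

Section Analysis.
Hypothesis hK : kang.
Hypothesis hn : (4 <= n)%N.

Lemma kang_eq x y m : sv x -> sv y -> Bf x y = 0 -> y \notin <[x]>%VS ->
  Bf x (tau x) = 0 -> Bf x (tau y) = 0 -> Bf y (tau x) = 0 -> Bf y (tau y) = 0 ->
  m != 0 -> m \in (<[x]> + <[y]>)%VS -> m \in (<[tau x]> + <[tau y]>)%VS ->
  (<[x]> + <[y]> = <[tau x]> + <[tau y]>)%VS.
Proof.
move=> sx sy o ni xx xy yx yy m0 m1 m2; have hL := line2 sx sy o ni.
have [h _] := hK hL; rewrite (im2 hth) // in h; apply: h.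
  by apply: sub2; apply: perp2; rewrite BfC.
exact: cap_neq0 m1 m2 m0.
Qed.

(** [v] is a point of the image collinear to the whole line, while [u] and [w] show that the two
    lines are not orthogonal; with [2'] excluded they must meet. *)
Lemma kang_meet x y v u w : sv x -> sv y -> Bf x y = 0 -> y \notin <[x]>%VS ->
  v \in (<[tau x]> + <[tau y]>)%VS -> v != 0 -> Bf x v = 0 -> Bf y v = 0 ->
  u \in (<[x]> + <[y]>)%VS -> w \in (<[tau x]> + <[tau y]>)%VS -> Bf u w != 0 ->
  exists m, [/\ m \in (<[x]> + <[y]>)%VS, m \in (<[tau x]> + <[tau y]>)%VS & m != 0].
Proof.
move=> sx sy o ni v1 v0 xv yv u1 w1 uw; have hL := line2 sx sy o ni.
have hM := im_line hL.
have [_ h] := hK hL; rewrite (im2 hth) // in h hM; apply: cap_pick; apply: h.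
  by apply/negP => /subvP/(_ _ u1) hu; rewrite (perp_mem' hu w1) eqxx in uw.
apply: (cross_neq0 hM hL); apply: (cap_neq0 v1 _ v0).
exact: perp2.
Qed.

Lemma moved_tau x : sv x -> ~~ fixv x -> tau (tau x) \notin <[tau x]>%VS.
Proof. by move=> sx; apply: contra; apply: tau_inj => //; exact: tau_sv. Qed.

(** The separating vector of [sing_sep_out] is presented as an image, so that [tau_orthE] transfers
    its orthogonality relations to [z]. *)
Lemma sing_out_tau U q : ts U -> (\dim U < n)%N -> q \notin U ->
  exists z, [/\ sv z, tau z \in perp U, tau z \notin U & Bf (tau z) q != 0].
Proof.
move=> tU dU qU; have [y [qy yP yU yq]] := sing_sep_out tU dU qU.
have y0 : y != 0 by apply: contraNneq yU => ->; exact: mem0v.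
have [z sz /vlineP[k yz]] := tau_surj hth (conj qy y0).
have k0 : k != 0 by apply: contraNneq y0 => k0; rewrite yz k0 scale0r.
have e : tau z = k^-1 *: y by rewrite yz scalerA mulVf // scale1r.
exists z; split=> //; rewrite e.
- exact: memvZ.
- by apply: contra yU => h; rewrite -(scale1r y) -(mulfV k0) -scalerA memvZ.
- by rewrite BfZl mulf_neq0 // invr_eq0.
Qed.

Lemma kang_line x : sv x -> Bf x (tau x) = 0 -> ~~ fixv x ->
  im (<[x]> + <[tau x]>) = (<[x]> + <[tau x]>)%VS.
Proof.
move=> sx o nf; have st := tau_sv hth sx; have ss := tau_sv hth st.
have os := tau_orth hth sx st o; have ns := moved_tau sx nf.
have eU := im2 hth sx st o nf.
have [xs|xs] := eqVneq (Bf x (tau (tau x))) 0.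
  rewrite eU; apply/esym; apply: (@kang_eq _ _ (tau x)) => //; rewrite ?mem2l ?mem2r //.
    exact: Bfxx0 st.1.
  by case: st.
have [tL' dL'] := line2 st ss os ns.
have xU : x \notin (<[tau x]> + <[tau (tau x)]>)%VS.
  by apply/negP => h; rewrite (ts_orth tL' h) ?mem2r ?eqxx in xs.
(* Here [x] is not orthogonal to [tau (tau x)]. The choice of [z] makes [<x, z>] meet its image, and
   orthogonality to [x] shows that the meeting point is [tau x]. This puts [z] on [<x, tau x>],
   against [zU]. *)
have [|z [sz zP zU zx]] := sing_out_tau tL' _ xU; first by rewrite dL'; lia.
have tz : Bf (tau x) z = 0.
  apply/(tau_orthE hth st sz); exact: (perp_mem zP (mem2r _ _)).
have xz : Bf x z = 0.
  apply/(tau_orthE hth sx sz); exact: (perp_mem zP (mem2l _ _)).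
have zin : z \notin <[x]>%VS.
  apply: contra zU => /(tau_prop hth sx sz) h.
  by apply: (subvP (addvSl _ _)).
have [| | | | | | |m [/mem2P[a [b m1]] /mem2P[c [d m2]] m0]] :=
  @kang_meet x z (tau x) x (tau z) sx sz xz zin; rewrite ?mem2l ?mem2r //.
- by case: st.
- by rewrite BfC.
- by rewrite BfC.
have d0 : d = 0.
  have : Bf m x = 0 by rewrite m1 !BfE (BfC z) xz Bfxx0 ?mulr0 ?addr0 //; case: sx.
  rewrite m2 !BfE (BfC _ x) o mulr0 add0r => /eqP.
  by rewrite mulf_eq0 (negPf zx) orbF => /eqP.
have c0 : c != 0 by apply: contraNneq m0 => c0; rewrite m2 c0 d0 !scale0r addr0.
have : tau x \in (<[x]> + <[z]>)%VS.
  apply/mem2P; exists (c^-1 * a), (c^-1 * b).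
  by rewrite -!scalerA -scalerDr -m1 m2 d0 scale0r addr0 scalerA mulVf // scale1r.
move/exch => /(_ nf); have [t2 _] := line2 sx st o nf.
by rewrite -(mem_im hth t2 sz) eU => h; case/negP: zU.
Qed.

(** The line [<x, y>] is orthogonal to its image and shares the fixed point [y] with it, so it is
    invariant and contains [tau x]. *)
Lemma fix_on_line x y : sv x -> sv y -> fixv y -> Bf x (tau x) = 0 -> ~~ fixv x ->
  Bf x y = 0 -> y \in (<[x]> + <[tau x]>)%VS.
Proof.
move=> sx sy fy o nf xy.
have ni : y \notin <[x]>%VS by apply: contra nf => h; exact: (fixv_prop sx sy h).
have yt : y \in <[tau y]>%VS by exact: fixv_sym.
have e : (<[x]> + <[y]> = <[tau x]> + <[tau y]>)%VS.
  apply: (@kang_eq _ _ y) => //; rewrite ?mem2r //.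
  - by rewrite BfC (fixv_orth sy) // BfC.
  - by rewrite (fixv_orth' sy) // BfC.
  - by rewrite BfC (fixv_orth sy) // Bfxx0 //; case: sy.
  - by case: sy.
  - exact: (subvP (addvSr _ _)).
by apply: exch nf; rewrite e mem2l.
Qed.

Lemma out_perp U : ts U -> (\dim U < n)%N ->
  exists q, [/\ sv q, q \in perp U & q \notin U].
Proof.
move=> tU dU; have [M [tM dM UM]] := ext_max tU.
have : ~~ (M <= U)%VS by apply/negP => /dimvS; lia.
case/subvPn' => q qM qU; exists q; split=> //.
  by apply: (svP tM qM); apply: contraNneq qU => ->; exact: mem0v.
by apply: (subvP (perpS UM)); rewrite perp_max.
Qed.

Lemma all_orth_fix_free x y : (forall z, sv z -> Bf z (tau z) = 0) ->
  sv x -> ~~ fixv x -> sv y -> fixv y -> False.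
Proof.
move=> all sx nf sy fy; have o := all _ sx; have st := tau_sv hth sx.
have [tL dL] := line2 sx st o nf; have iL := kang_line sx o nf.
(* A fixed point is found on the line [<x, tau x>] itself: if a point [m] of it orthogonal to [y]
   were moved, the line would be [<m, tau m>] and hence orthogonal to [y]. *)
have [y1 [sy1 fy1 y1L]] : exists y1, [/\ sv y1, fixv y1 &
    y1 \in (<[x]> + <[tau x]>)%VS].
  have [xy|xy] := eqVneq (Bf x y) 0; first by exists y; split=> //; exact: fix_on_line.
  have /cap_pick[m [mL /perp1P my m0]] :
      ((<[x]> + <[tau x]>) :&: perp <[y]> != 0)%VS.
    rewrite -dimv_eq0; have := dim_cap_perp1 (<[x]> + <[tau x]>)%VS y.
    by rewrite dL; case: (\dim _).
  have sm := svP tL mL m0; exists m; split=> //.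
  apply/negPn/negP => nm; case/negP: xy; rewrite BfC; apply/eqP/perp1P.
  have tmL : tau m \in (<[x]> + <[tau x]>)%VS by rewrite -iL mem_im.
  suff : (<[x]> + <[tau x]> <= perp <[y]>)%VS by move/subvP; apply; exact: mem2l.
  rewrite (dim2_eq dL mL tmL m0 nm) sub2 //; first exact/perp1P.
  by apply/perp1P; apply: (fixv_orth' sy).
have [|q [sq qP qL]] := out_perp tL; first by rewrite dL; lia.
have xq : Bf x q = 0 by rewrite (perp_mem qP) // mem2l.
have y1q : Bf q y1 = 0 by rewrite (perp_mem' qP).
have nq : ~~ fixv q.
  by apply/negP => fq; case/negP: qL; apply: fix_on_line.
have oq := all _ sq.
have ny1q : y1 \notin <[q]>%VS by apply: contra nq => h; exact: (fixv_prop sq sy1 h).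
have ny1x : y1 \notin <[x]>%VS by apply: contra nf => h; exact: (fixv_prop sx sy1 h).
have [c [d tq]] := mem2P _ _ _ (exch (fix_on_line sq sy1 fy1 oq nq y1q) ny1q).
have x0 : x != 0 by case: sx.
have [a [b tx]] : exists a b, tau x = a *: x + b *: y1.
  by apply/mem2P; rewrite -(dim2_eq dL (mem2l _ _) y1L x0 ny1x) mem2r.
have qx : q \notin <[x]>%VS.
  by apply: contra qL => h; apply: (subvP (addvSl _ _)).
have d0 : d != 0.
  by apply: contraNneq nq => d0; rewrite /fixv tq d0 scale0r addr0 memvZ ?memv_line.
have xy1 : Bf x y1 = 0 by rewrite (ts_orth tL) ?mem2l.
(* The common vector comes from eliminating [y1] between [tau x = a *: x + b *: y1] and
   [tau q = c *: q + d *: y1]. *)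
have e : (<[x]> + <[q]> = <[tau x]> + <[tau q]>)%VS.
  apply: (@kang_eq _ _ (d *: tau x - b *: tau q)) => //.
  - by rewrite tq !BfE xq xy1 !mulr0 addr0.
  - by rewrite (perp_mem' qP) ?mem2r.
  - apply/negP; rewrite subr_eq0 => /eqP h.
    have : tau x \in <[tau q]>%VS.
      apply/vlineP; exists (d^-1 * b).
      by rewrite -scalerA -h scalerA mulVf // scale1r.
    by move/(tau_inj hth sq sx) => h2; case/negP: qx; apply: line_sym.
  - apply/mem2P; exists (d * a), (- (b * c)).
    rewrite tx tq !scalerDr !scalerA opprD [d * b]mulrC scaleNr.
    by rewrite addrACA subrr addr0.
  - by apply/mem2P; exists d, (- b); rewrite scaleNr.
have : y1 \in (<[x]> + <[q]>)%VS.
  have : tau q \in (<[x]> + <[q]>)%VS by rewrite e mem2r.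
  rewrite tq => h; rewrite -(scale1r y1) -(mulVf d0) -scalerA memvZ //.
  by rewrite -(addKr (c *: q) (d *: y1)) memvD // memvN memvZ // mem2r.
move=> /exch /(_ ny1x) h; case/negP: qL.
by apply: (subvP _ _ h); rewrite sub2 ?mem2l.
Qed.

(** Otherwise [<q, x>] is not orthogonal to its image, while [tau x] is collinear to all of it, so
    the two lines meet. The meeting point is orthogonal to [q], hence is [tau x], which puts [q] on
    [<x, tau x>]. *)
Lemma moved_line_perp x q : sv x -> Bf x (tau x) = 0 -> ~~ fixv x ->
  sv q -> q \in perp (<[x]> + <[tau x]>) -> Bf q (tau q) = 0.
Proof.
move=> sx o nf sq qP; apply/eqP/negPn/negP => nq.
have st := tau_sv hth sx; have [tL dL] := line2 sx st o nf.
have iL := kang_line sx o nf.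
have qL : q \notin (<[x]> + <[tau x]>)%VS.
  apply: contra nq => qL; apply/eqP/(ts_orth tL qL).
  by rewrite -iL mem_im.
have xq : Bf q x = 0 by rewrite (perp_mem' qP) // mem2l.
have tq : Bf q (tau x) = 0 by rewrite (perp_mem' qP) // mem2r.
have nx : x \notin <[q]>%VS.
  apply: contra qL => /(line_sym (proj2 sx)); apply: (subvP (addvSl _ _)).
have [| | | | | | |m [/mem2P[a [b m1]] /mem2P[c [d m2]] m0]] :=
  @kang_meet q x (tau x) q (tau q) sq sx xq nx; rewrite ?mem2l ?mem2r //.
  by case: st.
have c0 : c = 0.
  have : Bf q m = 0 by rewrite m1 !BfE xq Bfxx0 ?mulr0 ?addr0 //; case: sq.
  rewrite m2 !BfE tq mulr0 addr0 => /eqP.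
  by rewrite mulf_eq0 (negPf nq) orbF => /eqP.
have d0 : d != 0 by apply: contraNneq m0 => d0; rewrite m2 c0 d0 !scale0r addr0.
case/negP: qL; apply: exch nf.
apply/mem2P; exists (d^-1 * b), (d^-1 * a).
rewrite -!scalerA -scalerDr addrC -m1 m2 c0 scale0r add0r scalerA mulVf //.
by rewrite scale1r.
Qed.

Lemma moved_orth_all x z : sv x -> Bf x (tau x) = 0 -> ~~ fixv x -> sv z ->
  Bf z (tau z) = 0.
Proof.
move=> sx o nf sz; have st := tau_sv hth sx; have [tL dL] := line2 sx st o nf.
have [M [tM dM LM]] := ext_max tL; have [z0 sz0 hz0] := tau_surj hth sz.
(* [z0] is the preimage of [z], so a vector [r] of [W] has both [r] and [tau r] orthogonal to [z].
   From [4 <= n], [W] has dimension at least 2 and contains a moved [r] to which [moved_line_perp]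
   applies. *)
pose W := (M :&: perp <[z]> :&: perp <[z0]>)%VS.
have dW : (2 <= \dim W)%N.
  have h1 := dim_cap_perp1 M z; have h2 := dim_cap_perp1 (M :&: perp <[z]>)%VS z0.
  by rewrite -/W in h2; lia.
have MP : (M <= perp (<[x]> + <[tau x]>))%VS.
  by apply: subv_trans (tsP tM) (perpS LM).
have [r [rW sr or nr]] : exists r, [/\ r \in W, sv r, Bf r (tau r) = 0 & ~~ fixv r].
  have [WL|/subvPn'[r rW rL]] := boolP (W <= <[x]> + <[tau x]>)%VS.
    exists x; split=> //.
    have -> : W = (<[x]> + <[tau x]>)%VS by apply/eqP; rewrite eqEdim WL dL.
    exact: mem2l.
  have rM : r \in M by case/memv_capP: rW => /memv_capP[].
  have r0 : r != 0 by apply: contraNneq rL => ->; exact: mem0v.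
  have sr := svP tM rM r0; have rP := subvP MP _ rM.
  exists r; split=> //; first exact: (moved_line_perp sx).
  apply/negP => fr; case/negP: rL; apply: fix_on_line => //.
  by rewrite (perp_mem rP) // mem2l.
case/memv_capP: rW => /memv_capP[_ /perp1P rz] /perp1P rz0.
apply: (moved_line_perp sr or nr sz); apply: perp2; first by rewrite BfC.
have /vlineP[k ->] := hz0; rewrite BfZr (tau_orth hth) ?mulr0 //.
by rewrite BfC.
Qed.

Lemma kang_trichotomy : fix_or_opp \/ spread_like.
Proof.
case: (classic (exists x, [/\ sv x, Bf x (tau x) = 0 & ~~ fixv x])) => [|h].
  move=> [x [sx o nf]]; right => y sy.
  have all z (sz : sv z) := moved_orth_all sx o nf sz.
  have ny : ~~ fixv y by apply/negP; exact: all_orth_fix_free all sx nf sy.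
  by split; [exact: all|exact: ny|apply: kang_line => //; exact: all].
left => x sx; have [f|nf] := boolP (fixv x); first by left.
by right; apply/negP => /eqP o; apply: h; exists x.
Qed.

End Analysis.

Lemma spread_like_fixes : spread_like -> fixes_line_spread th.
Proof.
move=> h; exists (fun L => exists2 x, sv x & L = (<[x]> + <[tau x]>)%VS).
have hL x : sv x -> is_line (<[x]> + <[tau x]>).
  by move=> sx; have [o nf _] := h _ sx; apply: line2 => //; exact: tau_sv.
split; [|split].
- by move=> _ [x sx ->]; exact: hL.
- move=> p /pointP[x sx ->]; exists (<[x]> + <[tau x]>)%VS; split.
    by split; [exists x|rewrite addvSl].
  move=> L [[y sy ->]]; rewrite -memvE => xL.
  have [tL dL] := hL _ sy; have [_ _ iL] := h _ sy; have [_ nf _] := h _ sx.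
  apply/esym/dim2_eq => //; last by case: sx.
  by rewrite -iL mem_im.
- move=> _ [x sx ->]; have [_ _ iL] := h _ sx; have [tL _] := hL _ sx.
  by have := imP hth tL; rewrite iL.
Qed.

End Kangaroo.

(** * Ideal subspaces of fixed points *)

Section Ideal.
Variables (K : fieldType) (n : nat).
Notation V := 'rV[K]_(n + n).
Notation sub := {vspace V}.
Implicit Types (x y z : V) (S T U W M N L : sub).
Variable th : sub -> sub.
Hypothesis hth : collineation th.
Notation tau := (tau th).
Notation im := (im th).
Notation fixv := (fixv th).
Notation F := (fixed_points th).

Lemma fixed_pointP x : sv x -> F <[x]>%VS <-> fixv x.
Proof.
move=> sx; split=> [[_ e]|f].
  by rewrite /(fixv _) -e (tau_line hth sx).1 memv_line.
split; first exact: sv_point.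
by rewrite (tau_line hth sx).1 (line_eqP (tau_neq0 hth sx) f).
Qed.

Definition fixS S := ts S /\ forall x, sv x -> x \in S -> fixv x.

Lemma inU_fixS S : inU F S <-> fixS S.
Proof.
split=> [[tS h]|[tS h]]; split=> //.
  move=> x sx xS; apply/(fixed_pointP sx); apply: h.
  by split; [exact: sv_point|rewrite -memvE].
move=> p [/pointP[x sx ->]]; rewrite -memvE => xS; apply/(fixed_pointP sx).
exact: h.
Qed.

Definition fix_closed := forall x y z, sv x -> sv y -> Bf x y = 0 -> fixv x ->
  fixv y -> z != 0 -> z \in (<[x]> + <[y]>)%VS -> fixv z.

Lemma gsubspace_fix_closed : gsubspace F <-> fix_closed.
Proof.
split=> [[_ h] x y z sx sy o fx fy z0 zL|h].
  have sz := svP (ts2 sx.1 sy.1 o) zL z0.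
  have [yx|ni] := boolP (y \in <[x]>%VS).
    have zx : z \in <[x]>%VS.
      by apply: (subvP _ _ zL); rewrite subv_add subvv -memvE.
    exact: (fixv_prop hth sz sx (line_sym z0 zx) fx).
  apply/(fixed_pointP sz); apply: (h _ <[x]>%VS <[y]>%VS (line2 sx sy o ni)).
  - by split; [exact: sv_point|rewrite addvSl].
  - by split; [exact: sv_point|rewrite addvSr].
  - by move=> e; case/negP: ni; rewrite e memv_line.
  - exact/fixed_pointP.
  - exact/fixed_pointP.
  - by split; [exact: sv_point|rewrite -memvE].
split=> [p []|L p q [tL dL]] //.
move=> [/pointP[x sx ->]]; rewrite -memvE => xL.
move=> [/pointP[y sy ->]]; rewrite -memvE => yL.
move=> ne /(fixed_pointP sx) fx /(fixed_pointP sy) fy r.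
move=> [/pointP[z sz ->]]; rewrite -memvE => zL.
apply/(fixed_pointP sz).
have ni : y \notin <[x]>%VS.
  by apply/negP => h2; apply: ne; apply/esym/line_eqP => //; case: sy.
apply: (h x y) => //; [exact: (ts_orth tL)|by case: sz|].
by rewrite -(dim2_eq dL xL yL _ ni) //; case: sx.
Qed.

Lemma fixS_sub S T : fixS T -> (S <= T)%VS -> fixS S.
Proof.
move=> [tT h] ST; split; first exact: ts_sub ST.
by move=> x sx xS; apply: h => //; apply: (subvP ST).
Qed.

Lemma fixS_add S T M : fix_closed -> fixS S -> fixS T -> ts M ->
  (S <= M)%VS -> (T <= M)%VS -> fixS (S + T).
Proof.
move=> cl [tS hS] [tT hT] tM SM TM; split.
  by apply: ts_sub tM _; rewrite subv_add SM.
move=> z sz /memv_addP[s sS [t tT' ez]].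
have z0 : z != 0 by case: sz.
have [s0|s0] := eqVneq s 0; first by apply: hT => //; rewrite ez s0 add0r.
have [t0|t0] := eqVneq t 0; first by apply: hS => //; rewrite ez t0 addr0.
have ss := svP tS sS s0; have st := svP tT tT' t0.
apply: (cl s t) => //; [|exact: hS|exact: hT|].
  exact: (ts_orth tM (subvP SM _ sS) (subvP TM _ tT')).
by apply/mem2P; exists 1, 1; rewrite !scale1r.
Qed.

Lemma fixS_line x : sv x -> fixv x -> fixS <[x]>.
Proof.
move=> sx fx; split=> [|y sy yx]; first exact: ts_line sx.1.
by apply: (fixv_prop hth sy sx (line_sym _ yx) fx); case: sy.
Qed.

Lemma fixS_addl S x : fix_closed -> fixS S -> sv x -> fixv x -> x \in perp S ->
  fixS (S + <[x]>).
Proof.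
move=> cl fS sx fx xS; apply: fixS_add (addvSl _ _) (addvSr _ _) => //.
  exact: fixS_line.
by apply: ts_addl => //; case: fS; case: sx.
Qed.

Lemma maxP T : maxInU F T <-> fixS T /\ forall T', fixS T' -> (T <= T')%VS -> T' = T.
Proof.
split=> [[/inU_fixS fT h]|[fT h]]; split=> //.
- by move=> T' /inU_fixS; exact: h.
- exact/inU_fixS.
- by move=> T' /inU_fixS; exact: h.
Qed.

Lemma max_ext S : fixS S -> exists2 T, maxInU F T & (S <= T)%VS.
Proof.
have [k] := ubnP (n - \dim S); elim: k S => // k IH S hk fS.
case: (classic (maxInU F S)) => [m|nm]; first by exists S.
have [T [fT ST ne]] : exists T, [/\ fixS T, (S <= T)%VS & T <> S].
  apply: NNPP => h; apply: nm; apply/maxP; split=> // T fT ST.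
  by apply: NNPP => ne; apply: h; exists T.
have lt : (\dim S < \dim T)%N.
  rewrite ltnNge; apply/negP => le; apply: ne.
  by apply/esym/eqP; rewrite eqEdim ST.
have dT := ts_dim fT.1; have [|T' m TT'] := IH T _ fT; first by lia.
by exists T' => //; exact: subv_trans TT'.
Qed.

(** If [T2] were larger, [dim_cross] would give a point of [T2] collinear to all of [T1] but outside
    it, and adjoining that point would enlarge [T1]. *)
Lemma max_dim_le T1 T2 : fix_closed -> maxInU F T1 -> maxInU F T2 ->
  (\dim T2 <= \dim T1)%N.
Proof.
move=> cl /maxP[f1 m1] /maxP[f2 _]; rewrite leqNgt; apply/negP => lt.
have : ~~ (T2 :&: perp T1 <= T1)%VS.
  apply/negP => h; have := dim_cross T2 T1.
  suff : (\dim (T2 :&: perp T1) <= \dim (T1 :&: perp T2))%N by lia.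
  apply: dimvS; rewrite subv_cap h /=.
  exact: subv_trans (capvSl _ _) (tsP f2.1).
case/subvPn' => p /memv_capP[pT2 pP] pT1.
have sp : sv p by apply: (svP f2.1 pT2); apply: contraNneq pT1 => ->; exact: mem0v.
have fp := f2.2 _ sp pT2.
have /m1 e := fixS_addl cl f1 sp fp pP.
by case/negP: pT1; rewrite -(e (addvSl _ _)) (subvP (addvSr _ _)) ?memv_line.
Qed.

Lemma im_parity M N : ts M -> ts N -> \dim M = n -> \dim N = n ->
  odd (\dim (M :&: im M)) = odd (\dim (N :&: im N)).
Proof.
move=> tM tN dM dN; have [sw h] := im_cls hth.
have key W : ts W -> \dim W = n -> odd (\dim (W :&: im W)) = odd n (+) sw.
  move=> tW dW; have := cls_dim tW (im_ts hth tW) dW (etrans (dim_im hth tW) dW).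
  rewrite h //; case: (odd _); case: (odd n); case: sw {h}; by case: (cls_low W).
by rewrite !key.
Qed.

(** A line with two fixed points is invariant, so each of its points is orthogonal to its image and
    cannot be opposite to it. *)
Lemma fix_or_opp_closed : fix_or_opp th -> fix_closed.
Proof.
move=> h x y z sx sy o fx fy z0 zL.
have [yx|ni] := boolP (y \in <[x]>%VS).
  have zx : z \in <[x]>%VS.
    by apply: (subvP _ _ zL); rewrite subv_add subvv -memvE.
  have sz := sv_line sx z0 zx.
  exact: (fixv_prop hth sz sx (line_sym z0 zx) fx).
have [tL dL] := line2 sx sy o ni.
have sz := svP tL zL z0.
have iL : im (<[x]> + <[y]>) = (<[x]> + <[y]>)%VS.
  apply/eqP; rewrite eqEdim dim_im // leqnn andbT (im2 hth) // sub2 //.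
    exact: (subvP (addvSl _ _)).
  exact: (subvP (addvSr _ _)).
case: (h z sz) => // /negP[]; apply/eqP/(ts_orth tL zL).
by rewrite -iL mem_im.
Qed.

Lemma fix_or_opp_cap M : fix_or_opp th -> ts M -> fixS (M :&: im M).
Proof.
move=> h tM; split; first exact: ts_cap.
move=> x sx /memv_capP[xM xI]; case: (h x sx) => // /negP[].
by apply/eqP/(ts_orth (im_ts hth tM) xI); rewrite mem_im.
Qed.

Lemma fixS_cap S M : fixS S -> ts M -> (S <= M)%VS -> (S <= M :&: im M)%VS.
Proof.
move=> [tS h] tM SM; apply: subv_sv => // x sx xS.
by rewrite memv_cap (fix_im hth) ?h // (subvP SM).
Qed.

(** For a maximal [N] above a proper fixed extension of [S], the fixed subspace [N :&: im N] has
    dimension [\dim S + 1]. By [im_parity] the one of [M] cannot be [S], so [M] contains a further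
    fixed point. *)
Lemma fix_or_opp_ideal : fix_or_opp th -> (exists2 x, sv x & fixv x) -> ideal F.
Proof.
move=> h [x sx fx]; have cl := fix_or_opp_closed h; split; [|split].
- exact/gsubspace_fix_closed.
- by exists <[x]>%VS; apply/fixed_pointP.
move=> S [/inU_fixS fS [nm sm]] M /maxsingP[tM dM] SM.
have [T0 [fT0 ST0 ne]] : exists T, [/\ fixS T, (S <= T)%VS & T <> S].
  apply: NNPP => h2; apply: nm; apply/maxP; split=> // T fT ST.
  by apply: NNPP => ne; apply: h2; exists T.
have : ~~ (T0 <= S)%VS.
  by apply/negP => h2; apply: ne; apply/eqP; rewrite eqEsubv h2.
case/subvPn' => y yT0 yS.
have sy : sv y by apply: (svP fT0.1 yT0); apply: contraNneq yS => ->; exact: mem0v.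
have big T : fixS T -> (S <= T)%VS -> (exists2 y, y \in T & y \notin S) ->
    forall T', fixS T' -> (T <= T')%VS -> T' = T.
  move=> fT ST [z zT zS].
  have /maxP[_] // : maxInU F T.
  by apply: sm => //; [exact/inU_fixS|move=> e; rewrite -e zT in zS].
have fT1 : fixS (S + <[y]>).
  by apply: fixS_sub fT0 _; rewrite subv_add ST0 -memvE.
have mT1 := big _ fT1 (addvSl _ _) (ex_intro2 _ _ y (subvP (addvSr _ _) _ (memv_line y)) yS).
have [N [tN dN TN]] := ext_max fT1.1.
have eN := mT1 _ (fix_or_opp_cap h tN) (fixS_cap fT1 tN TN).
have fM := fix_or_opp_cap h tM; have SM' := fixS_cap fS tM SM.
have par := im_parity tM tN dM dN; rewrite eN dim_add_line // in par.
have : ~~ (M :&: im M <= S)%VS.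
  apply/negP => h2; have e : (M :&: im M = S)%VS.
    by apply/eqP; rewrite eqEsubv h2.
  by move: par; rewrite e /=; case: (odd _).
case/subvPn' => z zM zS.
have sz : sv z by apply: (svP fM.1 zM); apply: contraNneq zS => ->; exact: mem0v.
have fT : fixS (S + <[z]>) by apply: fixS_sub fM _; rewrite subv_add SM' -memvE.
have zMM : z \in M by case/memv_capP: zM.
have SzM : (S + <[z]> <= M)%VS by rewrite subv_add SM -memvE.
exists (S + <[z]>)%VS; split.
  split; first exact/inU_fixS.
  by rewrite dim_add_line // addvSl.
move=> T [/inU_fixS fT' [dT [ST TM]]].
have mz := big _ fT (addvSl _ _) (ex_intro2 _ _ z (subvP (addvSr _ _) _ (memv_line z)) zS).
have e := mz _ (fixS_add cl fT fT' tM SzM TM) (addvSl _ _).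
apply/esym/eqP; rewrite eqEdim dim_add_line // dT leqnn andbT.
by rewrite -e addvSr.
Qed.

(** [main] extends a fixed subspace [S0] of [M] by induction on the missing dimension. If [M] has no
    fixed point outside [S0], the projection of [M] to a fixed point [q] shows that [S0] is already
    submaximal, and there the ovoid condition applies. *)
Lemma ideal_rank : ideal F -> fix_closed /\ exists r, [/\ (0 < r)%N,
  forall T, fixS T -> (\dim T <= r)%N &
  forall M, ts M -> \dim M = n -> exists T, [/\ fixS T, (T <= M)%VS & \dim T = r]].
Proof.
move=> [/gsubspace_fix_closed cl [[p fp] hI]]; split=> //.
have /pointP[x sx px] := fp.1; rewrite px in fp; have fx := (fixed_pointP sx).1 fp.
have [T0 mT0 xT0] := max_ext (fixS_line sx fx).
exists (\dim T0).
have hmax T : fixS T -> (\dim T <= \dim T0)%N.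
  move=> fT; have [T' mT' TT'] := max_ext fT.
  exact: leq_trans (dimvS TT') (max_dim_le cl mT0 mT').
split=> //; first by apply: leq_trans (dimvS xT0); rewrite dim_vline; case: sx => _ ->.
set r := \dim T0 in hmax *.
have main k : forall M S0, ts M -> \dim M = n -> fixS S0 -> (S0 <= M)%VS ->
    (\dim S0 + k)%N = r -> exists T, [/\ fixS T, (T <= M)%VS & \dim T = r].
  elim: k => [|k IH] M S0 tM dM fS SM dS; first by exists S0; rewrite -dS addn0.
  case: (classic (exists y, [/\ sv y, fixv y, y \in M & y \notin S0])).
    move=> [y [sy fy yM yS]]; apply: (IH M (S0 + <[y]>)%VS) => //.
    - apply: fixS_addl => //; apply/perpP => u uS.
      by rewrite (ts_orth tM) // (subvP SM).
    - by rewrite subv_add SM -memvE.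
    - by rewrite dim_add_line // -dS addSnnS.
  move=> hno; have [T mT ST] := max_ext fS.
  have dT : \dim T = r.
    by apply/eqP; rewrite eqn_leq hmax ?(max_dim_le cl mT mT0) //; case/maxP: mT.
  have fT : fixS T by case/maxP: mT.
  have : ~~ (T <= S0)%VS by apply/negP => /dimvS; lia.
  case/subvPn' => q qT qS.
  have sq : sv q by apply: (svP fT.1 qT); apply: contraNneq qS => ->; exact: mem0v.
  have fq := fT.2 _ sq qT.
  have tM2 := projM_ts tM (ts_line sq.1).
  have dM2 := projM_dim tM dM (ts_line sq.1).
  have SM2 : (S0 + <[q]> <= projM M <[q]>)%VS.
    rewrite /projM subv_add addvSl andbT.
    apply: subv_trans (addvSr _ _); rewrite subv_cap SM /=.
    by apply/subvP => u uS; apply/perp1P; rewrite (ts_orth fT.1) // (subvP ST).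
  have fSq : fixS (S0 + <[q]>) by apply: fixS_sub fT _; rewrite subv_add ST -memvE.
  have [|T2 [fT2 T2M dT2]] := IH _ _ tM2 dM2 fSq SM2.
    by rewrite dim_add_line // -dS addSnnS.
  have T2S : (T2 :&: M <= S0)%VS.
    apply: subv_sv; first exact: ts_cap fT2.1.
    move=> y sy /memv_capP[yT2 yM]; apply/negPn/negP => yS.
    by apply: hno; exists y; split=> //; exact: fT2.2.
  (* [T2] meets [M :&: perp <q>] in codimension at most 1, and this intersection lies in [S0]; so
     only one dimension is missing. *)
  have k0 : k = 0%N.
    have h1 := dim_cap_perp1 M q; rewrite dM in h1.
    have h2 := dimv_sum_cap T2 (M :&: perp <[q]>)%VS.
    have h3 : (\dim (T2 + (M :&: perp <[q]>)) <= n)%N.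
      by rewrite -[X in (_ <= X)%N]dM2 dimvS // subv_add T2M /projM addvSr.
    have h4 : (\dim (T2 :&: (M :&: perp <[q]>)) <= \dim S0)%N.
      by apply: dimvS; apply: subv_trans T2S; rewrite capvS ?capvSl.
    rewrite dT2 in h2; move: (\dim (T2 + _)%VS) (\dim (T2 :&: (M :&: _))) h2 h3 h4 => a b.
    clearbody r; move: (\dim (M :&: _)) (\dim S0) h1 dS; clear; lia.
  rewrite k0 in dS.
  have [||T' [[/inU_fixS fT' [dT' [ST' TM']]] _]] := hI S0 _ M _ SM.
  - split; first exact/inU_fixS.
    split=> [/maxP[_ /(_ T fT ST) e]|T' /inU_fixS fT' ST' ne].
      by move: dS; rewrite -e dT; clear; lia.
    apply/maxP; split=> // T'' fT'' TT''.
    apply/esym/eqP; rewrite eqEdim TT''.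
    apply: leq_trans (hmax _ fT'') _; rewrite -dS addn1 ltnNge.
    by apply/negP => le; apply: ne; apply/esym/eqP; rewrite eqEdim ST'.
  - exact/maxsingP.
  by exists T'; split=> //; rewrite dT' -dS addn1.
move=> M tM dM; apply: (main r M 0%VS) => //; rewrite ?dimv0 ?sub0v //.
split; first exact: ts0.
by move=> y [_ y0]; rewrite memv0 (negPf y0).
Qed.

(** A vector space is never the union of two proper subspaces: if neither [h1] nor [h2] works, their
    sum does. *)
Lemma sep2_perp x y t : y \notin <[x]>%VS -> t \notin <[x]>%VS ->
  exists h, [/\ Bf h x = 0, Bf h y != 0 & Bf h t != 0].
Proof.
move=> /sep_perp[h1 /perp1P x1 y1] /sep_perp[h2 /perp1P x2 t2].
rewrite !(BfC x) in x1 x2.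
have [e1|e1] := eqVneq (Bf h1 t) 0; last by exists h1.
have [e2|e2] := eqVneq (Bf h2 y) 0; last by exists h2.
by exists (h1 + h2); rewrite !BfDl x1 x2 e1 e2 !addr0 add0r.
Qed.

(** If a moved [p] is orthogonal to [tau p], some maximal [M] contains both. Choose a hyperplane [H]
    of [M] through [p] that avoids [tau p] and a fixed [t]. The other maximal subspace [M2] through
    [H] has a fixed point [y] outside [H]; it is orthogonal to [p], hence to [tau p] and to [M], so
    it lies in [M :&: M2 = H]. *)
Lemma ideal_fix_or_opp : ideal F -> fix_or_opp th.
Proof.
move=> /ideal_rank[cl [r [r0 hmax hM]]] p sp.
have [fp|nf] := boolP (fixv p); [by left|right].
apply/negP => /eqP o; have st := tau_sv hth sp.
have [tL dL] := line2 sp st o nf; have [M [tM dM LM]] := ext_max tL.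
have [T [fT TM dT]] := hM _ tM dM.
have pM : p \in M by apply: (subvP LM); exact: mem2l.
have tpM : tau p \in M by apply: (subvP LM); exact: mem2r.
have T0 : vpick T != 0 by rewrite vpick0 -dimv_eq0; lia.
have tT := memv_pick T; set t := vpick T in T0 tT.
have stt := svP fT.1 tT T0.
have nt : t \notin <[p]>%VS.
  apply: contra nf => h; exact: (fixv_prop hth sp stt h (fT.2 _ stt tT)).
have [h [hp htp ht]] := sep2_perp nf nt.
pose H := (M :&: perp <[h]>)%VS.
have pH : p \in H by rewrite memv_cap pM; apply/perp1P.
have tpH : tau p \notin H.
  by rewrite memv_cap tpM; apply/negP => /perp1P e; rewrite e eqxx in htp.
have tH : t \notin H.
  by rewrite memv_cap (subvP TM) //; apply/negP => /perp1P e; rewrite e eqxx in ht.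
have HM : (H <= M)%VS by exact: capvSl.
have dH : (\dim H).+1 = n.
  have h1 := dim_cap_perp1 M h; rewrite dM -/H in h1.
  apply/eqP; rewrite eqn_leq h1 andbT -(dim_add_line tpH) -[X in (_ <= X)%N]dM.
  by rewrite dimvS // subv_add HM -memvE.
have [M2 [tM2 dM2 HM2 ne]] := other_max tM dM dH HM.
have [T2 [fT2 TM2 dT2]] := hM _ tM2 dM2.
have : ~~ (T2 <= H)%VS.
  apply/negP => TH; have fS := fixS_add cl fT fT2 tM TM (subv_trans TH HM).
  have le := hmax _ fS.
  have e : (T + T2 = T)%VS.
    by apply/esym/eqP; rewrite eqEdim addvSl dT.
  have e2 : T2 = T by apply/eqP; rewrite eqEdim dT2 dT leqnn andbT -e addvSr.
  by case/negP: tH; apply: (subvP TH); rewrite e2.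
case/subvPn' => y yT2 yH.
have y0 : y != 0 by apply: contraNneq yH => ->; exact: mem0v.
have sy := svP fT2.1 yT2 y0; have fy := fT2.2 _ sy yT2.
have yM2 : y \in M2 by apply: (subvP TM2).
have yp : Bf y p = 0 by rewrite (ts_orth tM2) // (subvP HM2).
have yM : y \in M.
  rewrite -(perp_max tM dM); have <- : (H + <[tau p]> = M)%VS.
    by apply/eqP; rewrite eqEdim subv_add HM -memvE tpM dim_add_line // dH dM /=.
  rewrite perpD memv_cap; apply/andP; split.
    by apply/perpP => u uH; rewrite (ts_orth tM2) // (subvP HM2).
  by apply/perp1P; rewrite BfC (fixv_orth' hth).
case/negP: yH; have d2 : \dim (M :&: M2) = \dim H.
  apply/eqP; rewrite eqn_leq (dimvS (_ : H <= M :&: M2)%VS) ?subv_cap ?HM // andbT.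
  have le := dimvS (capvSl M M2); rewrite dM in le.
  rewrite -ltnS dH ltn_neqAle le andbT.
  apply/eqP => e; apply: ne; apply/esym/eqP; rewrite eqEdim dM dM2 leqnn andbT.
  apply: subv_trans (capvSr M M2).
  suff /eqP -> : (M :&: M2 == M)%VS by [].
  by rewrite eqEdim capvSl e dM /=.
have -> : H = (M :&: M2)%VS by apply/eqP; rewrite eqEdim subv_cap HM HM2 d2 /=.
by rewrite memv_cap yM.
Qed.

End Ideal.

(** * The Weyl group *)

Section Weyl.
Variable n : nat.
Hypothesis hn : (4 <= n)%N.
Implicit Types (x y z : nat * bool) (u v w : seq nat) (i j k : nat).
Notation sgen := (sgen n).
Notation weval := (weval n).
Notation wordW := (wordW n).

Definition flip x := (x.1, ~~ x.2).

Lemma flipK : involutive flip.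
Proof. by move=> [k b]; rewrite /flip /= negbK. Qed.

Lemma flip_neq x : flip x != x.
Proof. by case: x => k []; rewrite /flip xpair_eqE /= andbF. Qed.

Lemma sgenE i k b : (i < n)%N -> sgen i (k, b) =
  if (i.+1 < n)%N then
    (if k == i then (i.+1, b) else if k == i.+1 then (i, b) else (k, b))
  else
    (if k == (n - 2)%N then ((n - 1)%N, ~~ b)
     else if k == (n - 1)%N then ((n - 2)%N, ~~ b) else (k, b)).
Proof. by []. Qed.

Lemma sgenK i : involutive (sgen i).
Proof.
move=> [k b]; rewrite /Pilot.Defs.sgen; case: ltnP => hi /=.
  have [->|ki] := eqVneq k i; first by rewrite eqn_leq ltnn /= eqxx.
  have [->|ki1] := eqVneq k i.+1; first by rewrite eqxx.
  by rewrite (negPf ki) (negPf ki1).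
have [->|ki] := eqVneq k (n - 2)%N.
  by rewrite eqxx negbK; case: eqP => // h; lia.
have [->|ki1] := eqVneq k (n - 1)%N; first by rewrite eqxx negbK.
by rewrite (negPf ki) (negPf ki1).
Qed.

Lemma sgen_flip i x : sgen i (flip x) = flip (sgen i x).
Proof.
by case: x => k b; rewrite /Pilot.Defs.sgen /flip /=; do ! case: ifP => _ //=.
Qed.

Lemma sgen_lt i x : ((sgen i x).1 < n)%N = (x.1 < n)%N.
Proof.
suff h y : (y.1 < n)%N -> ((sgen i y).1 < n)%N.
  by apply/idP/idP => [/h|]; [rewrite sgenK|exact: h].
case: y => k b; rewrite /Pilot.Defs.sgen /=.
move=> hk; case: (ltnP i.+1 n) => hi; case: ifP => h1 /=; try lia; case: ifP => h2 /=; lia.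
Qed.

Lemma weval_cat u v x : weval (u ++ v) x = weval u (weval v x).
Proof. by rewrite /Pilot.Defs.weval foldr_cat. Qed.

Lemma weval_rcons u i x : weval (rcons u i) x = weval u (sgen i x).
Proof. by rewrite -cats1 weval_cat. Qed.

Lemma weval_flip u x : weval u (flip x) = flip (weval u x).
Proof. by elim: u => //= i u ->; exact: sgen_flip. Qed.

Lemma weval_lt u x : ((weval u x).1 < n)%N = (x.1 < n)%N.
Proof. by elim: u => //= i u <-; exact: sgen_lt. Qed.

Lemma weval_revK u : cancel (weval u) (weval (rev u)).
Proof.
elim: u => [|i u IH] x //=; rewrite rev_cons weval_rcons.
by rewrite sgenK IH.
Qed.

Lemma weval_Krev u : cancel (weval (rev u)) (weval u).
Proof. by move=> x; rewrite -{1}(revK u) weval_revK. Qed.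

Lemma weval_inj u : injective (weval u).
Proof. exact: can_inj (weval_revK u). Qed.

(* The rank of x in the order (0,+) < ... < (n-1,+) < (n-1,-) < ... < (0,-). *)
Definition rho x := if x.2 then (n + n - x.1.+1)%N else x.1.

Lemma rho_flip x : (x.1 < n)%N -> rho (flip x) = (n + n - (rho x).+1)%N.
Proof. by case: x => k []; rewrite /rho /flip /= => h; lia. Qed.

Lemma rho_lt x : (x.1 < n)%N -> (rho x < n + n)%N.
Proof. by case: x => k []; rewrite /rho /= => h; lia. Qed.

Lemma rho_inj x y : (x.1 < n)%N -> (y.1 < n)%N -> rho x = rho y -> x = y.
Proof.
by case: x => k b; case: y => l c; rewrite /rho /=; case: b; case: c => h1 h2 h3;
  congr (_, _); lia.
Qed.

(* The indices of the basis vectors spanning the i-th vertex of the chamber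
   attached to a frame. *)
Definition Jset i x : bool :=
  if (i < n - 2)%N then ~~ x.2 && (x.1 <= i)%N
  else if i == (n - 2)%N then
    (~~ x.2 && (x.1 < n - 1)%N) || (x.2 && (x.1 == n - 1)%N)
  else ~~ x.2.

(** Unlike [Jset], this also covers dimension [n - 1], which is no vertex of the chamber but the
    intersection of the last two ([Aset_cap]). *)
Definition Aset m x : bool := ~~ x.2 && (x.1 < m)%N.

Lemma Jset_small i : (i < n - 2)%N -> Jset i =1 Aset i.+1.
Proof. by move=> hi x; rewrite /Jset hi. Qed.

Lemma Jset_low x : Jset (n - 2) x =
  (~~ x.2 && (x.1 < n - 1)%N) || (x.2 && (x.1 == n - 1)%N).
Proof. by rewrite /Jset ltnn eqxx. Qed.

Lemma Jset_top x : (x.1 < n)%N -> Jset (n - 1) x = ~~ x.2.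
Proof. by move=> h; rewrite /Jset !ifF //; lia. Qed.

Lemma idx_cases i : (i < n)%N -> (i < n - 2)%N \/ i = (n - 2)%N \/ i = (n - 1)%N.
Proof. lia. Qed.

(** Vertices are initial segments for [rho], except that vertex [n - 2] contains [(n - 1, true)]
    without the preceding [(n - 1, false)]; the condition [y != flip x] removes this failure. *)
Lemma Jset_mono i x y : (x.1 < n)%N -> (y.1 < n)%N -> (i < n)%N ->
  (rho x < rho y)%N -> y != flip x -> Jset i y -> Jset i x.
Proof.
case: x => k b; case: y => l c /= hk hl.
case/idx_cases => [hi|[->|->]]; rewrite ?Jset_low ?Jset_top // /Jset ?hi /rho /=
  xpair_eqE /=; case: b; case: c => /=; lia.
Qed.

Lemma Jset_iso i x : (x.1 < n)%N -> (i < n)%N -> Jset i x -> ~~ Jset i (flip x).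
Proof.
case: x => k b /= hk.
case/idx_cases => [hi|[->|->]]; rewrite ?Jset_low ?Jset_top // /Jset ?hi /=;
  case: b => /=; lia.
Qed.

Lemma Jset_sgen i j x : (x.1 < n)%N -> (i < n)%N -> (j < n)%N -> i <> j ->
  Jset j (sgen i x) = Jset j x.
Proof.
case: x => k b hk hi hj ij; rewrite sgenE //; rewrite /= in hk.
case/idx_cases: hj ij => [hj|[->|->]] ij; rewrite ?Jset_low ?Jset_top // /Jset ?hj;
case: (ltnP i.+1 n) => hi1; case: ifP => h1; try (case: ifP => h2);
  case: b => /=; try lia.
all: try (by apply/idP/idP; lia).
Qed.

(** [sgen i] exchanges [alp i] with [bet i], and their flips; the simple root of node [i] is the
    difference of these two signed coordinates. *)
Definition alp i : nat * bool := if (i.+1 < n)%N then (i, false) else ((n - 2)%N, false).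
Definition bet i := sgen i (alp i).

Lemma alp_lt i : (i < n)%N -> ((alp i).1 < n)%N.
Proof. by rewrite /alp; case: ifP => /=; lia. Qed.

Lemma bet_lt i : (i < n)%N -> ((bet i).1 < n)%N.
Proof. by move=> h; rewrite sgen_lt alp_lt. Qed.

Lemma betE i : (i < n)%N ->
  bet i = if (i.+1 < n)%N then (i.+1, false) else ((n - 1)%N, true).
Proof.
move=> hi; rewrite /bet /alp; case: ifP => h; rewrite sgenE // h ?eqxx //.
Qed.

Lemma rho_alp_bet i : (i < n)%N -> (rho (alp i) < rho (bet i))%N.
Proof. by move=> hi; rewrite betE // /alp /rho; case: (ltnP i.+1 n) => h /=; lia. Qed.

Lemma bet_neq i : (i < n)%N -> bet i != flip (alp i).
Proof.
by move=> hi; rewrite betE // /alp /flip; case: ifP => _; rewrite xpair_eqE /= ?andbF ?andbT //; lia.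
Qed.

Lemma alp_neq_bet i : (i < n)%N -> alp i != bet i.
Proof.
by move=> hi; apply/eqP => e; have := rho_alp_bet hi; rewrite -e ltnn.
Qed.

Lemma Jset_alp i : (i < n)%N -> Jset i (alp i).
Proof.
move=> hi; case/idx_cases: (hi) => [h|[h|h]]; rewrite /alp.
- by rewrite /Jset h ifT /=; lia.
- by rewrite {1}h Jset_low ifT /=; lia.
- by rewrite {1}h Jset_top ifF /=; lia.
Qed.

Lemma Jset_bet i : (i < n)%N -> ~~ Jset i (bet i).
Proof.
move=> hi; rewrite betE //; case/idx_cases: (hi) => [h|[h|h]].
- by rewrite /Jset h ifT /=; lia.
- by rewrite {1}h Jset_low ifT /=; lia.
- by rewrite {1}h Jset_top ifF /=; lia.
Qed.

Lemma Jset_flip_alp i : (i < n)%N -> ~~ Jset i (flip (alp i)).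
Proof. by move=> hi; rewrite Jset_iso ?alp_lt ?Jset_alp. Qed.

Lemma sgen_fix i x : (i < n)%N -> x != alp i -> x != bet i -> x != flip (alp i) ->
  x != flip (bet i) -> sgen i x = x.
Proof.
case: x => k b hi; rewrite betE // /alp sgenE //.
case: ltnP => h; rewrite /flip !xpair_eqE /=; case: b => /=;
  rewrite ?andbT ?andbF => h1 h2 h3 h4; by rewrite !ifF //; lia.
Qed.

Lemma sgen_alp i : sgen i (alp i) = bet i. Proof. by []. Qed.
Lemma sgen_bet i : sgen i (bet i) = alp i. Proof. exact: sgenK. Qed.

Lemma Jset_flip_bet i x : (i < n)%N -> (x.1 < n)%N -> Jset i x -> x != alp i ->
  x != flip (bet i) -> sgen i x = x.
Proof.
move=> hi hx Jx xa xb; apply: sgen_fix => //.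
- by apply: contraTneq Jx => ->; exact: Jset_bet.
- by apply: contraTneq Jx => ->; exact: Jset_flip_alp.
Qed.

Section LastNodes.
Variable i : nat.
Hypotheses (h1 : (n - 2 <= i)%N) (hi : (i < n)%N).

Lemma last_cases : i = (n - 2)%N \/ i = (n - 1)%N.
Proof. lia. Qed.

(** [2 * n - 3 - i] is the other one of the last two nodes [n - 2] and [n - 1]. *)
Lemma other_lt : (2 * n - 3 - i < n)%N.
Proof. lia. Qed.

Lemma alp_last : alp i = ((n - 2)%N, false).
Proof. by rewrite /alp; case: ifP => // h; congr (_, _); lia. Qed.

Lemma Aset_last x : Aset (n - 2) x -> Jset i x.
Proof.
move=> /andP[x2 x1]; case: last_cases => ->.
  by rewrite Jset_low x2 /=; apply/orP; left; lia.
by rewrite Jset_top // (ltn_trans x1) //; lia.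
Qed.

Lemma Aset_other x : Aset (n - 2) x -> Jset (2 * n - 3 - i) x.
Proof.
move=> /andP[x2 x1]; case: last_cases => ->.
  rewrite (_ : 2 * n - 3 - (n - 2) = n - 1)%N; last lia.
  by rewrite Jset_top // (ltn_trans x1) //; lia.
rewrite (_ : 2 * n - 3 - (n - 1) = n - 2)%N; last lia.
by rewrite Jset_low x2 /=; apply/orP; left; lia.
Qed.

Lemma Aset_alp_last : ~~ Aset (n - 2) (alp i).
Proof. by rewrite alp_last /Aset /= ltnn. Qed.

Lemma Aset_bet_last : ~~ Aset (n - 2) (bet i).
Proof. by rewrite betE // /Aset; case: ifP => //= _; lia. Qed.

Lemma Aset_flip_bet_last : ~~ Aset (n - 2) (flip (bet i)).
Proof. by rewrite betE // /Aset; case: ifP => //= _; lia. Qed.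

Lemma Aset_flip_alp_last : ~~ Aset (n - 2) (flip (alp i)).
Proof. by rewrite alp_last. Qed.

Lemma Jset_flip_bet_last : Jset i (flip (bet i)).
Proof.
rewrite betE //; case: last_cases => e.
  rewrite ifT; last lia.
  by rewrite {1}e Jset_low /=; lia.
rewrite ifF; last lia.
by rewrite {1}e Jset_top /=; lia.
Qed.

Lemma Jset_other x : (x.1 < n)%N ->
  Jset (2 * n - 3 - i) x = [|| Aset (n - 2) x, x == alp i | x == bet i].
Proof.
move=> hx; rewrite alp_last betE //; case: last_cases => e.
  rewrite (_ : 2 * n - 3 - i = n - 1)%N; last lia.
  rewrite Jset_top // ifT; last lia.
  by case: x hx => k [] /= hk; rewrite /Aset !xpair_eqE /= ?andbF ?andbT //; lia.
rewrite (_ : 2 * n - 3 - i = n - 2)%N; last lia.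
rewrite Jset_low // ifF; last lia.
by case: x hx => k [] /= hk; rewrite /Aset !xpair_eqE /= ?andbF ?andbT ?orbF //; lia.
Qed.

Lemma other_neq : (2 * n - 3 - i)%N <> i.
Proof. lia. Qed.
End LastNodes.

Section FirstNodes.
Variable i : nat.
Hypothesis h1 : (i < n - 2)%N.

Lemma alp_first : alp i = (i, false).
Proof. by rewrite /alp ifT //; lia. Qed.

Lemma bet_first : bet i = (i.+1, false).
Proof. by rewrite betE ?ifT //; lia. Qed.

Lemma Aset_first x : Aset i.+2 x = [|| Aset i x, x == alp i | x == bet i].
Proof.
rewrite alp_first bet_first /Aset.
by case: x => k [] /=; rewrite !xpair_eqE /= ?andbF ?andbT //; lia.
Qed.

Lemma Jset_first x : Jset i x -> x != alp i -> Aset i x.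
Proof.
rewrite Jset_small // alp_first /Aset.
by case: x => k [] //=; rewrite xpair_eqE andbT ltnS leq_eqVlt => /orP[/eqP ->|]; rewrite ?eqxx.
Qed.

Lemma Aset_alp_first : ~~ Aset i (alp i).
Proof. by rewrite alp_first /Aset /= ltnn. Qed.

Lemma Aset_bet_first : ~~ Aset i (bet i).
Proof. by rewrite bet_first /Aset /= ltnNge leqnSn. Qed.

Lemma flip_bet_first x : Jset i x -> x != flip (bet i).
Proof.
move=> Jx; apply: contraTneq Jx => ->; rewrite bet_first Jset_small //.
Qed.
End FirstNodes.

(* The path (m,+), ..., (n-2,+), (n-1,-), (n-2,-), ..., (m,-) in the Schreier
   graph, together with its detour through (n-1,+). *)
Lemma word_reach m k b : (m < n - 1)%N -> (m <= k < n)%N -> exists v,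
  [/\ wordW v, weval v (m, false) = (k, b) &
      forall j c, (j < m)%N -> weval v (j, c) = (j, c)].
Proof.
move=> hm.
have step i v (x y : nat * bool) : (i < n)%N -> (m <= i)%N ->
    (wordW v /\ forall j c, (j < m)%N -> weval v (j, c) = (j, c)) ->
    weval v x = y ->
    (wordW (i :: v) /\ forall j c, (j < m)%N -> weval (i :: v) (j, c) = (j, c)) /\
    weval (i :: v) x = sgen i y.
  move=> hi mi [wv fv] <-; split=> //; split; first by rewrite /= hi.
  move=> j c jm; rewrite /= fv // sgenE //; case: ltnP => h1; rewrite !ifF //; lia.
have pos k' : (m <= k' < n)%N -> exists v, (wordW v /\
    forall j c, (j < m)%N -> weval v (j, c) = (j, c)) /\ weval v (m, false) = (k', false).
  elim: k' => [|k' IH] hk; first by exists [::]; split=> //=; congr (_, _); lia.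
  have [->|ne] := eqVneq k'.+1 m; first by exists [::].
  have [|v [hv e]] := IH; first lia.
  have [||hv' e'] := step k' v _ _ _ _ hv e; [lia|lia|].
  exists (k' :: v); split=> //; rewrite e' sgenE; last lia.
  by rewrite ifT ?eqxx //; lia.
have neg d : (d < n - m)%N -> exists v, (wordW v /\
    forall j c, (j < m)%N -> weval v (j, c) = (j, c)) /\
    weval v (m, false) = ((n - d.+1)%N, true).
  elim: d => [|d IH] hd.
    have [|v [hv e]] := pos (n - 2)%N; first lia.
    have [||hv' e'] := step (n - 1)%N v _ _ _ _ hv e; [lia|lia|].
    exists ((n - 1)%N :: v); split=> //; rewrite e' sgenE; last lia.
    by rewrite ifF ?eqxx //; lia.
  have [|v [hv e]] := IH; first lia.
  have [||hv' e'] := step (n - d.+2)%N v _ _ _ _ hv e; [lia|lia|].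
  exists ((n - d.+2)%N :: v); split=> //; rewrite e' sgenE; last lia.
  rewrite ifT; last lia.
  by rewrite ifF ?ifT //; lia.
move=> hk; case: b.
  have [|v [[h1 h2] e]] := neg (n - k.+1)%N; first lia.
  exists v; split=> //; rewrite e; congr (_, _); lia.
by have [v [[h1 h2] e]] := pos k hk; exists v.
Qed.

End Weyl.

(** * Frames *)

Section Frames.
Variables (K : fieldType) (n : nat).
Hypothesis hn : (4 <= n)%N.
Notation V := 'rV[K]_(n + n).
Notation sub := {vspace V}.
Notation sgen := (sgen n).
Notation weval := (weval n).
Notation Jset := (Jset n).
Implicit Types (x y z : nat * bool) (p q v : V) (U W M N : sub).
Implicit Types (a c : nat * bool -> V) (J : pred (nat * bool)) (u : seq nat).

Definition isframe a := forall x y, (x.1 < n)%N -> (y.1 < n)%N ->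
  Qf (a x) = 0 /\ Bf (a x) (a y) = (y == flip x)%:R.

Definition idx : seq (nat * bool) :=
  [seq (k, false) | k <- iota 0 n] ++ [seq (k, true) | k <- iota 0 n].

Lemma mem_idx x : (x \in idx) = (x.1 < n)%N.
Proof.
case: x => k b; rewrite mem_cat; apply/orP/idP => /= [[]|h].
- by case/mapP => l; rewrite mem_iota => /andP[_ h] [-> _].
- by case/mapP => l; rewrite mem_iota => /andP[_ h] [-> _].
by case: b; [right|left]; apply/mapP; exists k; rewrite ?mem_iota.
Qed.

Lemma uniq_idx : uniq idx.
Proof.
rewrite cat_uniq !map_inj_uniq ?iota_uniq /= ?andbT; try by move=> ? ? [].
by apply/hasPn => x /mapP[l _ ->]; apply/mapP => -[m _].
Qed.

Lemma size_idx : size idx = (n + n)%N.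
Proof. by rewrite size_cat !size_map !size_iota. Qed.

Lemma count_idx J : count J idx =
  (count (fun k => J (k, false)) (iota 0 n) + count (fun k => J (k, true)) (iota 0 n))%N.
Proof. by rewrite count_cat !count_map. Qed.

Lemma count_iota_lt m : (m <= n)%N -> count (fun k => k < m)%N (iota 0 n) = m.
Proof.
move=> h; rewrite -(subnKC h) iotaD count_cat add0n.
rewrite (eq_in_count (a2 := predT)) ?count_predT ?size_iota; last first.
  by move=> k; rewrite mem_iota add0n => /andP[_ ->].
rewrite (eq_in_count (a2 := pred0)) ?count_pred0 ?addn0 //.
by move=> k; rewrite mem_iota => /andP[mk _] /=; rewrite ltnNge mk.
Qed.

Definition Sp a J : sub := <<[seq a x | x <- idx & J x]>>%VS.

Lemma mem_Sp a J x : (x.1 < n)%N -> J x -> a x \in Sp a J.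
Proof.
move=> hx Jx; apply: memv_span; apply/mapP; exists x => //.
by rewrite mem_filter Jx mem_idx.
Qed.

Lemma Sp_sub a J U : (forall x, (x.1 < n)%N -> J x -> a x \in U) -> (Sp a J <= U)%VS.
Proof.
move=> h; apply/span_subvP => w /mapP[x]; rewrite mem_filter mem_idx.
by case/andP => Jx hx ->; exact: h.
Qed.

Lemma eq_Sp a J J' : (forall x, (x.1 < n)%N -> J x = J' x) -> Sp a J = Sp a J'.
Proof.
move=> h; congr (span (map _ _)); apply: eq_in_filter => x.
by rewrite mem_idx => /h.
Qed.

Lemma ts_span (s : seq V) : {in s, forall v, Qf v = 0} ->
  {in s &, forall v w, Bf v w = 0} -> ts <<s>>.
Proof.
elim: s => [|v s IH] h1 h2; first by rewrite span_nil; exact: ts0.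
have tv : ts <[v]> by exact (ts_line (h1 _ (mem_head _ _))).
have ts' : ts <<s>>.
  apply: IH => [w hw|w w' hw hw']; first by rewrite h1 // in_cons hw orbT.
  by rewrite h2 // in_cons ?hw ?hw' orbT.
rewrite span_cons; apply: ts_add => //.
rewrite -memvE; apply/perpP => w hw.
  have : (<<s>> <= perp <[v]>)%VS.
    apply/span_subvP => t ht; apply/perp1P; apply: h2; rewrite in_cons ?eqxx //.
    by rewrite ht orbT.
  by move=> /subvP /(_ _ hw) /perp1P; rewrite BfC.
Qed.

Section OneFrame.
Variable a : nat * bool -> V.
Hypothesis fa : isframe a.

Lemma frame_sv x : (x.1 < n)%N -> sv (a x).
Proof.
move=> hx; have hf : ((flip x).1 < n)%N by [].
have [q _] := fa hx hf; split=> //; apply/eqP => a0.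
have [_] := fa hx hf; rewrite a0 Bf0l eqxx => /eqP.
by rewrite eq_sym oner_eq0.
Qed.

Lemma frame_B x y : (x.1 < n)%N -> (y.1 < n)%N ->
  Bf (a x) (a y) = (y == flip x)%:R.
Proof. by move=> hx hy; case: (fa hx hy). Qed.

Lemma frame_Bflip x y : (x.1 < n)%N -> (y.1 < n)%N ->
  Bf (a x) (a (flip y)) = (x == y)%:R.
Proof.
move=> hx hy; rewrite frame_B //; congr (nat_of_bool _)%:R.
by rewrite (inj_eq (inv_inj flipK)) eq_sym.
Qed.

Lemma frame_free (s : seq (nat * bool)) : uniq s -> {in s, forall x, x.1 < n}%N ->
  free (map a s).
Proof.
elim: s => [|x s IH]; first by rewrite nil_free.
rewrite cons_uniq map_cons => /andP[xs us] h; rewrite free_cons IH ?andbT //; last first.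
  by move=> y ys; rewrite h // in_cons ys orbT.
have hx : (x.1 < n)%N by exact: h (mem_head x s).
apply/negP => hin; have : (<<map a s>> <= perp <[a (flip x)]>)%VS.
  apply/span_subvP => _ /mapP[y ys ->]; apply/perp1P.
  have hy : (y.1 < n)%N by apply: h; rewrite in_cons ys orbT.
  rewrite BfC frame_Bflip //.
  by case: eqP => // e; rewrite -e ys in xs.
move=> /subvP /(_ _ hin) /perp1P; rewrite BfC frame_Bflip // eqxx => /eqP.
by rewrite oner_eq0.
Qed.

Lemma dim_Sp J : \dim (Sp a J) = count J idx.
Proof.
have f : free [seq a x | x <- idx & J x].
  apply: frame_free; first by rewrite filter_uniq ?uniq_idx.
  by move=> x; rewrite mem_filter mem_idx => /andP[].
by rewrite /Sp (eqP f) size_map size_filter.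
Qed.

Lemma Sp_full : Sp a predT = fullv.
Proof. by apply/eqP; rewrite eqEdim subvf dim_full dim_Sp count_predT size_idx /=. Qed.

Lemma frame_nondeg v : (forall x, (x.1 < n)%N -> Bf v (a x) = 0) -> v = 0.
Proof.
move=> h; apply/eqP; rewrite -memv0 -perpf -Sp_full; apply/perpP => u.
have : (Sp a predT <= perp <[v]>)%VS by apply: Sp_sub => x hx _; apply/perp1P; exact: h.
by move=> /subvP hs /hs /perp1P; rewrite BfC.
Qed.

(** A frame is its own dual basis, read through [flip]; coordinates are therefore always written
    [Bf v (a (flip x))]. *)
Lemma frame_expand v : v = \sum_(x <- idx) Bf v (a (flip x)) *: a x.
Proof.
apply/eqP; rewrite -subr_eq0; apply/eqP; apply: frame_nondeg => y hy.
rewrite BfBl; apply/eqP; rewrite subr_eq0; apply/eqP.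
rewrite BfC [RHS]BfC raddf_sum /= (bigD1_seq (flip y)) ?uniq_idx ?mem_idx //=.
rewrite big1_seq ?addr0; first by rewrite BfZr flipK frame_B // eqxx mulr1 BfC.
move=> x /andP[xy]; rewrite mem_idx => hx.
rewrite BfZr frame_B // (negPf xy) mulr0 //.
Qed.

Lemma SpP J v : reflect (forall x, (x.1 < n)%N -> ~~ J x -> Bf v (a (flip x)) = 0)
  (v \in Sp a J).
Proof.
apply: (iffP idP) => [vS x hx Jx|h].
  have : (Sp a J <= perp <[a (flip x)]>)%VS.
    apply: Sp_sub => y hy Jy; apply/perp1P; rewrite BfC frame_Bflip //.
    by case: eqP => // e; rewrite e (negPf Jx) in Jy.
  by move=> /subvP/(_ _ vS)/perp1P; rewrite BfC.
rewrite (frame_expand v) big_seq; apply: memv_suml => x; rewrite mem_idx => hx.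
have [Jx|Jx] := boolP (J x); first by rewrite memvZ // mem_Sp.
by rewrite h // scale0r mem0v.
Qed.

Lemma mem_SpE J x : (x.1 < n)%N -> (a x \in Sp a J) = J x.
Proof.
move=> hx; apply/idP/idP => [/SpP h|]; last exact: mem_Sp.
apply/negPn/negP => /(h _ hx); rewrite frame_Bflip // eqxx => /eqP.
by rewrite oner_eq0.
Qed.

Lemma Sp_cap J J' : (Sp a J :&: Sp a J')%VS = Sp a [pred x | J x && J' x].
Proof.
apply/vspaceP => v; rewrite memv_cap; apply/andP/idP => [[/SpP h1 /SpP h2]|/SpP h].
  apply/SpP => x hx; rewrite /= negb_and => /orP[]; [exact: h1|exact: h2].
by split; apply/SpP => x hx Jx; apply: h; rewrite //= (negPf Jx) ?andbF.
Qed.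

Lemma perp_Sp J : perp (Sp a J) = Sp a [pred x | ~~ J (flip x)].
Proof.
apply/vspaceP => v; apply/perpP/SpP => [h x hx /= Jx|h w wS].
  by rewrite BfC h // mem_Sp // -[J _]negbK.
have : (Sp a J <= perp <[v]>)%VS.
  by apply: Sp_sub => x hx Jx; apply/perp1P; rewrite -[x]flipK h //= flipK Jx.
by move=> /subvP/(_ _ wS)/perp1P; rewrite BfC.
Qed.

Lemma ts_Sp J : (forall x, (x.1 < n)%N -> J x -> ~~ J (flip x)) -> ts (Sp a J).
Proof.
move=> h; apply: ts_span => v.
  by case/mapP => x; rewrite mem_filter mem_idx => /andP[_ hx] ->; case: (frame_sv hx).
move=> w /mapP[x]; rewrite mem_filter mem_idx => /andP[Jx hx] -> /mapP[y].
rewrite mem_filter mem_idx => /andP[Jy hy] ->; rewrite frame_B //.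
by case: eqP => // e; have := h _ hx Jx; rewrite -e Jy.
Qed.

Lemma frame_weval u : isframe (fun x => a (weval u x)).
Proof.
move=> x y hx hy; rewrite frame_B ?weval_lt //; split.
  by case: (frame_sv (x := weval u x)) => //; rewrite weval_lt.
by rewrite -weval_flip (inj_eq (@weval_inj n hn u)).
Qed.

Lemma frame_sgen i : isframe (fun x => a (sgen i x)).
Proof. exact: (frame_weval [:: i]). Qed.

Lemma dim_Aset m : (m <= n)%N -> \dim (Sp a (Aset m)) = m.
Proof.
move=> h; rewrite dim_Sp count_idx /Aset /= (count_iota_lt h).
by rewrite count_pred0 addn0.
Qed.

Lemma dim_Jset (i : nat) : (i < n)%N ->
  \dim (Sp a (Jset i)) = if (i < n - 2)%N then i.+1 else n.
Proof.
case/(idx_cases hn) => [hi|[->|->]].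
- rewrite hi (eq_Sp _ (J' := Aset i.+1)) ?dim_Aset //; first lia.
  by move=> x _; rewrite Jset_small.
- rewrite ltnn dim_Sp (eq_count (Jset_low n)) count_idx /=.
  rewrite (eq_count (a2 := fun k => k < n - 1)%N) ?count_iota_lt; last first.
  + by move=> k; rewrite /= orbF.
  + lia.
  rewrite (eq_count (a2 := pred1 (n - 1)%N)) // count_uniq_mem ?iota_uniq //.
  rewrite mem_iota; lia.
- rewrite ifF; last lia.
  rewrite (eq_Sp _ (J' := Aset n)) ?dim_Aset // => x hx.
  by rewrite Jset_top // /Aset hx andbT.
Qed.

Lemma ts_Jset (i : nat) : (i < n)%N -> ts (Sp a (Jset i)).
Proof. by move=> hi; apply: ts_Sp => x hx; exact: Jset_iso. Qed.

Lemma ts_Aset m : ts (Sp a (Aset m)).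
Proof. by apply: ts_Sp => -[k b] hx /andP[/= /negPf -> _]. Qed.

Lemma Aset_max : Sp a (Aset n) = Sp a (Jset (n - 1)).
Proof. by apply: eq_Sp => x hx; rewrite Jset_top // /Aset hx andbT. Qed.

Lemma Aset_cap : Sp a (Aset (n - 1)) = (Sp a (Jset (n - 2)) :&: Sp a (Jset (n - 1)))%VS.
Proof.
rewrite Sp_cap; apply: eq_Sp => x hx /=; rewrite Jset_top // Jset_low // /Aset.
by case: (x.2); rewrite /= ?andbF ?orbF ?andbT.
Qed.

Lemma AsetS m : (m < n)%N -> Sp a (Aset m.+1) = (Sp a (Aset m) + <[a (m, false)]>)%VS.
Proof.
move=> hm; apply/esym/eqP; rewrite eqEdim; apply/andP; split.
  rewrite subv_add -memvE mem_Sp //; last by rewrite /Aset /= ltnS.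
  rewrite andbT; apply: Sp_sub => x hx; rewrite /Aset => /andP[h1 h2].
  by apply: mem_Sp => //; rewrite /Aset h1 ltnW.
rewrite dim_Aset // dim_add_line ?dim_Aset ?(ltnW hm) //.
by rewrite mem_SpE // /Aset /= ltnn.
Qed.

Lemma Aset_mono l m : (l <= m)%N -> (Sp a (Aset l) <= Sp a (Aset m))%VS.
Proof.
move=> lm; apply: Sp_sub => x hx /andP[h1 h2]; apply: mem_Sp => //.
by rewrite /Aset h1 /=; apply: leq_trans lm.
Qed.

(* The root group element moving a y along a x. *)
Definition rootE x y (t : K) z : V :=
  if z == y then a y + t *: a x
  else if z == flip x then a (flip x) - t *: a (flip y) else a z.

(** The change at [flip x] is forced by the change at [y]: in the pairing of the two new vectors the
    contributions [t] and [- t] cancel. *)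
Lemma rootE_frame x y t : (x.1 < n)%N -> (y.1 < n)%N -> x != y -> y != flip x ->
  isframe (rootE x y t).
Proof.
move=> hx hy xy yfx.
have hfx : ((flip x).1 < n)%N by [].
have hfy : ((flip y).1 < n)%N by [].
have ff z w : (flip z == flip w) = (z == w) by rewrite (inj_eq (inv_inj flipK)).
have nfl z : (z == flip z) = false by rewrite eq_sym (negPf (flip_neq z)).
have Q z : (z.1 < n)%N -> Qf (a z) = 0 by move=> hz; case: (frame_sv hz).
have self z : (z.1 < n)%N -> Bf (a z) (a z) = 0 by move=> hz; rewrite Bfxx0 ?Q.
have one z : (z.1 < n)%N -> Bf (a z) (a (flip z)) = 1.
  by move=> hz; rewrite frame_B // eqxx.
have one' z : (z.1 < n)%N -> Bf (a (flip z)) (a z) = 1 by move=> hz; rewrite BfC one.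
have Bxy : Bf (a x) (a y) = 0 by rewrite frame_B // (negPf yfx).
have Byx : Bf (a y) (a x) = 0 by rewrite BfC.
have Bxfy : Bf (a x) (a (flip y)) = 0 by rewrite frame_Bflip // (negPf xy).
have Bfyx : Bf (a (flip y)) (a x) = 0 by rewrite BfC.
have Byfx : Bf (a y) (a (flip x)) = 0 by rewrite frame_Bflip // eq_sym (negPf xy).
have Bfxy : Bf (a (flip x)) (a y) = 0 by rewrite BfC.
have Bff : Bf (a (flip x)) (a (flip y)) = 0.
  by rewrite frame_B // ff (negPf yfx).
have Bff' : Bf (a (flip y)) (a (flip x)) = 0 by rewrite BfC.
have gx w : (w.1 < n)%N -> w != flip x -> Bf (a x) (a w) = 0.
  by move=> hw h; rewrite frame_B // (negPf h).
have gfy w : (w.1 < n)%N -> w != y -> Bf (a (flip y)) (a w) = 0.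
  by move=> hw h; rewrite frame_B // flipK (negPf h).
have half z w : (z.1 < n)%N -> (w.1 < n)%N -> w != y -> w != flip x ->
    Bf (rootE x y t z) (a w) = (w == flip z)%:R.
  move=> hz hw wy wfx; rewrite /rootE.
  have [->|zy] := eqVneq z y; first by rewrite !BfE gx // mulr0 addr0 frame_B.
  have [->|zfx] := eqVneq z (flip x); last by rewrite frame_B.
  by rewrite !BfE gfy // mulr0 subr0 frame_B.
move=> z w hz hw; split.
  rewrite /rootE; case: eqP => _; first by rewrite QfD QfZ !Q // BfZr Byx; ring.
  case: eqP => _; last exact: Q.
  by rewrite QfD QfN QfZ !Q // BfNr BfZr Bff; ring.
have diag w' : w' = y \/ w' = flip x -> forall z', z' = y \/ z' = flip x ->
    Bf (rootE x y t z') (rootE x y t w') = (w' == flip z')%:R.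
  rewrite /rootE => -[->|->] z' [->|->]; rewrite ?eqxx ?(eq_sym (flip x) y) ?(negPf yfx);
    rewrite !BfE ?self ?one ?one' ?Bxy ?Byx ?Bxfy ?Bfyx ?Byfx ?Bfxy ?Bff ?Bff' //;
    rewrite ?ff ?flipK ?nfl ?(eq_sym (flip x) x) ?nfl ?(eq_sym (flip x) (flip y)) ?ff
      ?(eq_sym y x) ?(negPf xy) /=; ring.
have [e1|wy] := eqVneq w y.
  have [e2|zy] := eqVneq z y; first by apply: diag; left.
  have [e2|zfx] := eqVneq z (flip x); first by apply: diag; [left|right].
  rewrite BfC {2}/rootE (negPf zy) (negPf zfx) half // e1.
  by rewrite -ff flipK eq_sym.
have [e1|wfx] := eqVneq w (flip x); last first.
  by rewrite [X in Bf _ X]/rootE (negPf wy) (negPf wfx) half.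
have [e2|zy] := eqVneq z y; first by apply: diag; [right|left].
have [e2|zfx] := eqVneq z (flip x); first by apply: diag; right.
rewrite BfC {2}/rootE (negPf zy) (negPf zfx) half // e1.
by rewrite -ff flipK eq_sym.
Qed.

End OneFrame.
End Frames.

(** * Chambers of frames and their neighbours *)

Section Apartments.
Variables (K : fieldType) (n : nat).
Hypothesis hn : (4 <= n)%N.
Notation V := 'rV[K]_(n + n).
Notation sub := {vspace V}.
Notation sgen := (sgen n).
Notation weval := (weval n).
Notation wordW := (wordW n).
Notation rho := (rho n).
Notation Jset := (Jset n).
Notation alp := (alp n).
Notation bet := (bet n).
Notation isframe := (@isframe K n).
Notation Sp := (@Sp K n).
Implicit Types (x y z : nat * bool) (p q v : V) (U W M N : sub).
Implicit Types (a b c : nat * bool -> V) (J : pred (nat * bool)) (u : seq nat).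
Implicit Types (C D : 'I_n -> sub).

Lemma rootE_Sp a x y t J : isframe a -> (x.1 < n)%N -> (y.1 < n)%N -> x != y ->
  y != flip x -> (J y -> J x) -> (J (flip x) -> J (flip y)) ->
  Sp (rootE a x y t) J = Sp a J.
Proof.
move=> fa hx hy xy yfx h1 h2; apply/eqP; rewrite eqEdim; apply/andP; split.
  apply: Sp_sub => z hz Jz; rewrite /rootE; case: eqP => [e|_].
    by rewrite e in Jz; rewrite memvD ?memvZ // mem_Sp ?h1.
  case: eqP => [e|_]; last exact: mem_Sp.
  by rewrite e in Jz; rewrite memvB ?memvZ // mem_Sp ?h2.
have fr := rootE_frame fa t hx hy xy yfx.
by rewrite (dim_Sp fr) (dim_Sp fa).
Qed.

Definition fl a : 'I_n -> sub := fun i => Sp a (Jset i).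

(** A positive root element fixes the chamber: [y] moves along the earlier [x], and since [flip]
    reverses [rho], [flip x] moves along the earlier [flip y]. *)
Lemma rootE_fl a x y t : isframe a -> (x.1 < n)%N -> (y.1 < n)%N ->
  (rho x < rho y)%N -> y != flip x -> fl (rootE a x y t) = fl a.
Proof.
move=> fa hx hy r yfx; apply: functional_extensionality => i.
have xy : x != y by apply/eqP => e; rewrite e ltnn in r.
apply: rootE_Sp => //; first exact: Jset_mono.
apply: Jset_mono => //; last by apply: contra yfx; rewrite flipK => /eqP ->.
by rewrite !rho_flip //; have := rho_lt hn hx; have := rho_lt hn hy; lia.
Qed.

Lemma Sp_weval a u J : isframe a -> (forall x, (x.1 < n)%N -> J (weval u x) = J x) ->
  Sp (fun x => a (weval u x)) J = Sp a J.
Proof.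
move=> fa h; apply/eqP; rewrite eqEdim; apply/andP; split.
  by apply: Sp_sub => x hx Jx; apply: mem_Sp; rewrite ?weval_lt ?h.
by rewrite !dim_Sp //; exact: frame_weval.
Qed.

Lemma Sp_sgen a (i j : nat) : isframe a -> (i < n)%N -> (j < n)%N -> i <> j ->
  Sp (fun x => a (sgen i x)) (Jset j) = Sp a (Jset j).
Proof.
move=> fa hi hj ij; apply: (@Sp_weval a [:: i]) => //= x hx.
exact: Jset_sgen.
Qed.

Lemma Sp_sgen_neq a (i : nat) : isframe a -> (i < n)%N ->
  Sp (fun x => a (sgen i x)) (Jset i) <> Sp a (Jset i).
Proof.
move=> fa hi e; have h : a (alp i) \in Sp a (Jset i).
  by apply: mem_Sp; [exact: alp_lt|exact: Jset_alp].
move: h; rewrite -e; have fs := frame_sgen hn fa i.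
have -> : a (alp i) = (fun x => a (sgen i x)) (bet i) by rewrite sgen_bet.
by rewrite (mem_SpE fs) ?bet_lt // (negPf (Jset_bet hn hi)).
Qed.

(** The one condition that a frame must satisfy for its flag to carry the types prescribed by
    [chamber] ([fl_chamber]). *)
Definition low a := cls_low (Sp a (Jset (n - 2))).

Lemma frame_cls a : isframe a -> cls_low (Sp a (Jset (n - 1))) = ~~ low a.
Proof.
move=> fa; have h2 : (n - 2 < n)%N by lia.
have h1 : (n - 1 < n)%N by lia.
have d2 : \dim (Sp a (Jset (n - 2))) = n by rewrite dim_Jset // ltnn.
have d1 : \dim (Sp a (Jset (n - 1))) = n by rewrite dim_Jset // ifF //; lia.
have := cls_dim (ts_Jset hn fa h2) (ts_Jset hn fa h1) d2 d1.
rewrite -Aset_cap // dim_Aset //; last lia.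
rewrite /low oddB //; last lia.
by case: (odd n); case: (cls_low _); case: (cls_low _).
Qed.

Lemma fl_chamber a : isframe a -> low a -> chamber (fl a).
Proof.
move=> fa la; have h2 : (n - 2 < n)%N by lia.
have h1 : (n - 1 < n)%N by lia.
split; [|split; [|split; [|split]]].
- move=> i hi; split; first exact: ts_Jset.
  by rewrite /fl dim_Jset // hi.
- move=> i j ij hi; apply: Sp_sub => x hx; rewrite Jset_small // => /andP[h3 h4].
  apply: mem_Sp => //; case/(idx_cases hn): (ltn_ord j) => [h|[h|h]].
  + by rewrite Jset_small // /Aset h3 (leq_trans h4) // ltnW.
  + by rewrite h Jset_low // h3 /=; apply/orP; left; lia.
  + by rewrite h Jset_top.
- move=> i hi; rewrite /fl hi; split=> //; apply/maxsingP; split; first exact: ts_Jset.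
  by rewrite dim_Jset // ltnn.
- move=> i hi; rewrite /fl hi frame_cls // negbK; split=> //; apply/maxsingP.
  by split; [exact: ts_Jset|rewrite dim_Jset // ifF //; lia].
- by move=> i j hi hj; rewrite /fl hi hj -Aset_cap // dim_Aset //; lia.
Qed.

Lemma low_sgen a (i : nat) : isframe a -> (i < n)%N ->
  low (fun x => a (sgen i x)) = low a.
Proof.
move=> fa hi; have h2 : (n - 2 < n)%N by lia.
have h1 : (n - 1 < n)%N by lia.
rewrite /low; have [e|ne] := eqVneq i (n - 2)%N; last first.
  by rewrite Sp_sgen //; apply/eqP.
have fs := frame_sgen hn fa i.
have := frame_cls fs; rewrite Sp_sgen //; last by rewrite e; lia.
by rewrite frame_cls // /low => /negb_inj ->.
Qed.

Lemma low_weval a u : isframe a -> wordW u -> low (fun x => a (weval u x)) = low a.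
Proof.
elim: u a => //= i u IH a fa /andP[hi hu].
have fs := frame_sgen hn fa i.
by rewrite (IH (fun x => a (sgen i x)) fs hu) low_sgen.
Qed.

Lemma fl_low a : chamber (fl a) -> low a.
Proof.
move=> [_ [_ [h _]]]; have h2 : (n - 2 < n)%N by lia.
by have [_] := h (Ordinal h2) erefl.
Qed.

Lemma fl_weval_chamber a u : isframe a -> chamber (fl a) -> wordW u ->
  chamber (fl (fun x => a (weval u x))).
Proof.
move=> fa ca hu; apply: fl_chamber; first exact: frame_weval.
by rewrite low_weval //; exact: fl_low.
Qed.

Lemma fl_adj a (i : nat) : isframe a -> (i < n)%N -> adj i (fl a) (fl (fun x => a (sgen i x))).
Proof.
move=> fa hi; split=> //; split.
  by move=> j ji; rewrite /fl Sp_sgen // => e; apply: ji.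
exists (Ordinal hi); split=> //; apply: nesym; exact: Sp_sgen_neq.
Qed.

Definition Rel C D u := wordW u /\ exists a,
  [/\ isframe a, C = fl a & D = fl (fun x => a (weval u x))].

Lemma frame_gallery a u : isframe a -> chamber (fl a) -> wordW u ->
  exists cs, galleryP (fl a) cs u /\ last (fl a) cs = fl (fun x => a (weval u x)).
Proof.
elim: u a => [|i u IH] a fa ca /=; first by exists [::].
move=> /andP[hi hu]; have fs := frame_sgen hn fa i.
have cs : chamber (fl (fun x => a (sgen i x))).
  by apply: (fl_weval_chamber (u := [:: i])) => //=; rewrite hi.
have [l [h1 h2]] := IH _ fs cs hu.
exists (fl (fun x => a (sgen i x)) :: l); split=> //.
by split; [exact: fl_adj|].
Qed.

Lemma Rel_gallery C D u : chamber C -> Rel C D u -> gallery C D u.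
Proof. by move=> cC [hu [a [fa eC eD]]]; subst C D; split=> //; exact: frame_gallery. Qed.

Lemma chamber_two C : chamber C -> forall i j : 'I_n, val i = (n - 2)%N ->
  val j = (n - 1)%N -> [/\ ts (C i), ts (C j), \dim (C i) = n, \dim (C j) = n & C i <> C j].
Proof.
move=> [_ [_ [h2 [h1 _]]]] i j hi hj.
have [/maxsingP[t2 d2] c2] := h2 i hi; have [/maxsingP[t1 d1] c1] := h1 j hj.
by split=> // e; rewrite -e c2 in c1.
Qed.

Lemma Sp_coord c J J' z v : isframe c -> (z.1 < n)%N -> v \in Sp c J ->
  (forall x, (x.1 < n)%N -> J x -> J' x || (x == z)) ->
  v \notin Sp c J' -> Bf v (c (flip z)) != 0.
Proof.
move=> fc hz /(SpP fc) h hJ; apply: contra => /eqP e.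
apply/(SpP fc) => x hx J'x; have [Jx|Jx] := boolP (J x); last exact: h.
by have := hJ x hx Jx; rewrite (negPf J'x) => /eqP ->.
Qed.

(* Up to the common part A, the vector v is a multiple of c y + t * c x. *)
Lemma Sp_reduce c J x y v U : isframe c -> (x.1 < n)%N -> (y.1 < n)%N -> x != y ->
  v \in Sp c [pred z | [|| J z, z == x | z == y]] -> ~~ J x -> ~~ J y ->
  Bf v (c (flip y)) != 0 -> v \in U -> (Sp c J <= U)%VS ->
  c y + (Bf v (c (flip x)) / Bf v (c (flip y))) *: c x \in U.
Proof.
move=> fc hx hy xy vS Jx Jy v0 vU /subvP SU.
set m := Bf v (c (flip y)) in v0 *; set l := Bf v (c (flip x)).
have h : v - m *: c y - l *: c x \in U.
  apply: SU; apply/(SpP fc) => z hz Jz.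
  rewrite !BfBl !BfZl !frame_Bflip //.
  have [->|zx] := eqVneq z x.
    by rewrite ?eqxx ?(eq_sym y x) (negPf xy) /l /=; ring.
  have [->|zy] := eqVneq z y; first by rewrite ?eqxx ?(negPf xy) /m /=; ring.
  move/(SpP fc): vS => ->; rewrite //= ?(negPf zx) ?(negPf zy) ?orbF //.
  by rewrite ?(eq_sym y z) ?(negPf zy) /=; ring.
have : m *: c y + l *: c x \in U.
  have -> : m *: c y + l *: c x = v - (v - m *: c y - l *: c x).
    by rewrite -(addrA v) -opprD subKr.
  by rewrite memvB.
move=> /(memvZ m^-1); rewrite scalerDr !scalerA mulVf // scale1r.
by rewrite [m^-1 * l]mulrC.
Qed.

Section AdjFrame.
Variables (c : nat * bool -> V) (D' : 'I_n -> sub) (i : nat) (i0 : 'I_n).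
Hypotheses (fc : isframe c) (cc : chamber (fl c)) (cD : chamber D').
Hypotheses (hi : (i < n)%N) (ei : val i0 = i).
Hypothesis hj : forall j : 'I_n, val j <> i -> fl c j = D' j.
Hypothesis ne : fl c i0 <> D' i0.
Let ct t x := rootE c (alp i) (bet i) t (sgen i x).

Lemma adj_reduce t : (forall x, (x.1 < n)%N -> Jset i x -> ct t x \in D' i0) ->
  \dim (D' i0) = \dim (fl c i0) -> D' = fl (ct t).
Proof.
have i0i : nat_of_ord i0 = i by [].
have fr : isframe (rootE c (alp i) (bet i) t).
  by apply: rootE_frame; rewrite ?bet_lt ?alp_lt ?alp_neq_bet ?bet_neq.
have frs : isframe (ct t) by exact: frame_sgen.
move=> hx dd; apply: functional_extensionality => j.
have [ji|ji] := eqVneq (val j) i.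
  have -> : j = i0 by apply: val_inj; rewrite ji ei.
  apply/esym/eqP; rewrite eqEdim /fl i0i; apply/andP; split; first exact: Sp_sub.
  by rewrite dd /fl i0i (dim_Sp fc) (dim_Sp frs).
rewrite -hj; last exact/eqP.
have <- : fl (rootE c (alp i) (bet i) t) j = fl c j.
  by rewrite rootE_fl // ?rho_alp_bet ?bet_lt ?alp_lt ?bet_neq.
by rewrite /fl Sp_sgen //; apply/eqP; rewrite eq_sym.
Qed.

(** [D' i0] lies between [Aset i] and [Aset i.+2], so it is a point of a projective line; [t] is its
    affine coordinate, with the vertex of [fl c] at infinity. *)
Lemma adj_first : (i < n - 2)%N -> exists t, D' = fl (ct t).
Proof.
move=> hs; have [h1 [h2 _]] := cD.
have hi0 : (i0 < n - 2)%N by rewrite ei.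
have i0i : nat_of_ord i0 = i by [].
have [tD dD] := h1 i0 hi0; rewrite ei in dD.
have ha := alp_lt hn hi; have hb := bet_lt hn hi.
have dc : \dim (fl c i0) = i.+1 by rewrite /fl i0i dim_Jset // hs.
have AD : (Sp c (Aset i) <= D' i0)%VS.
  case: (posnP i) => [->|ipos].
    by apply: Sp_sub => x hx; rewrite /Aset ltn0 andbF.
  have hi1 : (i.-1 < n)%N by rewrite prednK // ltnW.
  have e : D' (Ordinal hi1) = Sp c (Aset i).
    rewrite -hj /=; last by clear -ipos; lia.
    rewrite /fl /=; apply: eq_Sp => x hx; rewrite Jset_small ?prednK //.
    by rewrite (leq_trans _ (ltnW hs)).
  by rewrite -e; apply: h2; rewrite /= ?ei ?prednK // (leq_trans _ (ltnW hs)) ?prednK.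
have DA : (D' i0 <= Sp c (Aset i.+2))%VS.
  have [hs1|hs1] := ltnP i.+1 (n - 2).
    have hi1 : (i.+1 < n)%N by clear -hs; lia.
    have e : D' (Ordinal hi1) = Sp c (Aset i.+2).
      rewrite -hj /=; last by clear; lia.
      by rewrite /fl /=; apply: eq_Sp => x hx; rewrite Jset_small.
    by rewrite -e; apply: h2; rewrite /= ?ei.
  have -> : i.+2 = (n - 1)%N by clear -hs hs1; lia.
  have o1 : (n - 1 < n)%N by clear -hn; lia.
  have o2 : (n - 2 < n)%N by clear -hn; lia.
  have v1 : val (Ordinal o1) <> i by rewrite /=; clear -hs hn; lia.
  have v2 : val (Ordinal o2) <> i by rewrite /=; clear -hs; lia.
  have l1 : (i < n - 1)%N by clear -hs; lia.
  rewrite Aset_cap // subv_cap.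
  have e1 := hj v1; rewrite /fl /= in e1.
  have e2 := hj v2; rewrite /fl /= in e2.
  by rewrite e1 e2; apply/andP; split; apply: h2; rewrite /= ?ei.
have : ~~ (D' i0 <= fl c i0)%VS.
  by apply/negP => h; apply: ne; apply/esym/eqP; rewrite eqEdim h dD dc /=.
case/subvPn' => v vD vc.
have vA := subvP DA _ vD.
have vb : Bf v (c (flip (bet i))) != 0.
  apply: (Sp_coord fc hb vA _ vc) => x hx.
  rewrite i0i (Aset_first hn) // => /or3P[h|/eqP ->|->].
  - by rewrite Jset_small // /Aset; case/andP: h => -> h; rewrite ltnW.
  - by rewrite Jset_alp.
  - by rewrite orbT.
exists (Bf v (c (flip (alp i))) / Bf v (c (flip (bet i)))).
apply: adj_reduce => [x hx Jx|]; last by rewrite dD dc.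
have [->|xa] := eqVneq x (alp i).
  rewrite /ct sgen_alp /rootE eqxx.
  apply: (Sp_reduce (J := Aset i)) => //; rewrite ?alp_neq_bet //.
  - rewrite (_ : Sp c _ = Sp c (Aset i.+2)) //; apply: eq_Sp => y hy.
    by rewrite (Aset_first hn).
  - exact: Aset_alp_first.
  - exact: Aset_bet_first.
have xfb := flip_bet_first hn hs Jx.
rewrite /ct (Jset_flip_bet hn hi hx Jx xa xfb) /rootE ifF; last first.
  by apply/negP => /eqP e; have := Jset_bet hn hi; rewrite -e Jx.
rewrite ifF; last by apply/negP => /eqP e; have := Jset_flip_alp hn hi; rewrite -e Jx.
by apply: (subvP AD); apply: mem_Sp => //; apply: (Jset_first hn hs).
Qed.

Lemma last_two C : chamber C -> (n - 2 <= i)%N -> forall io : 'I_n,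
  val io = (2 * n - 3 - i)%N ->
  [/\ [/\ ts (C i0), ts (C io), \dim (C i0) = n & \dim (C io) = n], C i0 <> C io &
    (\dim (C i0 :&: C io)).+1 = n].
Proof.
move=> cC h1 io vo; have [_ [_ [_ [_ h5]]]] := cC.
have n1 : (n - 1).+1 = n by clear -hn; lia.
case: (last_cases hn h1 hi) => e.
  have v1 : val i0 = (n - 2)%N by rewrite ei.
  have v2 : val io = (n - 1)%N by rewrite vo e; clear -hn; lia.
  by have [] := chamber_two cC v1 v2; rewrite h5.
have v1 : val i0 = (n - 1)%N by rewrite ei.
have v2 : val io = (n - 2)%N by rewrite vo e; clear -hn; lia.
have [t1 t2 d1 d2 nn] := chamber_two cC v2 v1; rewrite capvC h5 //.
by split=> //; exact: nesym.
Qed.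

(** [D'] and [fl c] share the other maximal vertex [D' io]. A vector [v] of [D' i0 :&: D' io]
    outside [fl c i0] determines [t], and the candidate vertex [N] shares with [D' i0] and [D' io] a
    subspace [H] of dimension [n - 1]; as [N] is not [D' io], [two_max] gives [N = D' i0]. *)
Lemma adj_last : (n - 2 <= i)%N -> exists t, D' = fl (ct t).
Proof.
move=> hl; have [_ [h2 _]] := cD.
have i0i : nat_of_ord i0 = i by [].
have ha := alp_lt hn hi; have hb := bet_lt hn hi.
have ab := alp_neq_bet hn hi; have bfa := bet_neq hn hi.
pose io := Ordinal (other_lt hn hl hi).
have eo : fl c io = D' io by apply: hj; exact: (other_neq hn hl hi).
have [[tDi tDo dDi dDo] neD dH] := last_two cD hl (erefl : val io = _).
have [[tci tco dci dco] nec _] := last_two cc hl (erefl : val io = _).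
have AD : (Sp c (Aset (n - 2)) <= D' i0)%VS.
  have hi3 : (n - 3 < n)%N by clear -hn; lia.
  have l3 : (n - 3 < n - 2)%N by clear -hn; lia.
  have e : D' (Ordinal hi3) = Sp c (Aset (n - 2)).
    rewrite -hj /=; last by clear -hl hn; lia.
    rewrite /fl /=; apply: eq_Sp => x hx; rewrite Jset_small //.
    by rewrite (_ : (n - 3).+1 = (n - 2)%N) //; clear -hn; lia.
  by rewrite -e; apply: h2; rewrite //= ei (leq_trans l3).
have Aio : (Sp c (Aset (n - 2)) <= D' io)%VS.
  rewrite -eo; apply: Sp_sub => x hx hA; apply: mem_Sp => //.
  exact: (Aset_other hn hl hi).
have : ~~ (D' i0 :&: D' io <= fl c i0)%VS.
  apply/negP => h.
  have [] := two_max tci tco tDi dci dco dDi dH h _ (capvSl _ _) nec.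
  - by rewrite eo capvSr.
  - by move=> e; apply: ne; rewrite e.
  - by move=> e; apply: neD; rewrite e.
case/subvPn' => v /memv_capP[vi vo] vc.
have vo' : v \in Sp c (Jset io) by rewrite -/(fl c io) eo.
have vb : Bf v (c (flip (bet i))) != 0.
  apply: (Sp_coord fc hb vo' _ vc) => x hx; rewrite (Jset_other hn hl hi) // i0i.
  case/or3P => [hA|/eqP ->|->]; rewrite ?orbT ?Jset_alp //.
  by rewrite (Aset_last hn hl hi).
set t := Bf v (c (flip (alp i))) / Bf v (c (flip (bet i))).
have red U : (Sp c (Aset (n - 2)) <= U)%VS -> v \in U -> c (bet i) + t *: c (alp i) \in U.
  move=> AU vU; apply: (Sp_reduce (J := Aset (n - 2))) => //.
  - apply: (subvP _ _ vo'); apply: Sp_sub => y hy; rewrite (Jset_other hn hl hi) // => Jy.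
    exact: mem_Sp.
  - exact: (Aset_alp_last hn hl hi).
  - exact: (Aset_bet_last hn hl hi).
have fr : isframe (rootE c (alp i) (bet i) t) by exact: rootE_frame.
have frs : isframe (ct t) by exact: frame_sgen.
exists t; pose N := Sp (ct t) (Jset i).
have tN : ts N by exact: ts_Jset.
have dN : \dim N = n by rewrite dim_Jset // ltnNge hl.
pose H := (Sp c (Aset (n - 2)) + <[c (bet i) + t *: c (alp i)]>)%VS.
have dHH : (\dim H).+1 = n.
  rewrite dim_add_line ?(dim_Aset fc) //; [by clear -hn; lia|by clear; lia|].
  apply/negP => /(SpP fc)/(_ (bet i) hb (Aset_bet_last hn hl hi)).
  rewrite BfDl BfZl !(frame_Bflip fc) // eqxx (negPf ab) mulr0 addr0 => /eqP.
  by rewrite oner_eq0.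
have memN x : (x.1 < n)%N -> Jset i x -> ct t x \in N by exact: mem_Sp.
have HN : (H <= N)%VS.
  rewrite subv_add -memvE; apply/andP; split.
    apply: Sp_sub => x hx hA; have Jx := Aset_last hn hl hi hA.
    have xa : x != alp i by apply: contraTneq hA => ->; exact: (Aset_alp_last hn hl hi).
    have xfb : x != flip (bet i).
      by apply: contraTneq hA => ->; exact: (Aset_flip_bet_last hn hl hi).
    have xb : x != bet i by apply: contraTneq Jx => ->; exact: Jset_bet.
    have xfa : x != flip (alp i) by apply: contraTneq Jx => ->; exact: Jset_flip_alp.
    have -> : c x = ct t x.
      by rewrite /ct (Jset_flip_bet hn hi hx Jx xa xfb) /rootE (negPf xb) (negPf xfa).
    exact: memN.
  have -> : c (bet i) + t *: c (alp i) = ct t (alp i).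
    by rewrite /ct sgen_alp /rootE eqxx.
  by apply: memN => //; exact: Jset_alp.
have HDi : (H <= D' i0)%VS by rewrite subv_add AD -memvE red.
have HDo : (H <= D' io)%VS by rewrite subv_add Aio -memvE red.
have NDo : N <> D' io.
  move=> e; have := memN (flip (bet i)) hb (Jset_flip_bet_last hn hl hi).
  rewrite e -eo => /(SpP fc)/(_ (flip (alp i)) ha).
  rewrite (Jset_other hn hl hi) // (negPf (Aset_flip_alp_last hn hl hi)).
  rewrite (negPf (flip_neq _)) eq_sym (negPf bfa) => /(_ isT).
  rewrite /ct sgen_flip // sgen_bet // /rootE ifF; last by apply/negbTE; rewrite eq_sym.
  rewrite eqxx BfBl BfZl !(frame_Bflip fc) // eqxx (inj_eq (inv_inj flipK)).
  rewrite eq_sym (negPf ab) mulr0 subr0 => /eqP.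
  by rewrite oner_eq0.
have [e|e] := two_max tN tDo tDi dN dDo dDi dHH HN HDo HDi NDo; last by case: neD.
by apply: adj_reduce; [move=> x hx Jx; rewrite e; exact: memN|rewrite dDi dci].
Qed.

End AdjFrame.

Lemma adj_frame c D' (i : nat) : isframe c -> chamber (fl c) -> chamber D' ->
  adj i (fl c) D' ->
  exists t, D' = fl (fun x => rootE c (alp i) (bet i) t (sgen i x)).
Proof.
move=> fc cc cD [hi [hj [i0 [ei ne]]]]; have [h|h] := ltnP i (n - 2).
  exact: (adj_first fc cD hi ei).
exact: (adj_last fc cc cD hi ei).
Qed.

End Apartments.

(** * The Weyl distance: existence, uniqueness, minimal galleries *)

Section Weyldistance.
Variables (K : fieldType) (n : nat).
Hypothesis hn : (4 <= n)%N.
Notation V := 'rV[K]_(n + n).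
Notation sub := {vspace V}.
Notation sgen := (sgen n).
Notation weval := (weval n).
Notation wordW := (wordW n).
Notation rho := (rho n).
Notation Jset := (Jset n).
Notation alp := (alp n).
Notation bet := (bet n).
Notation isframe := (@isframe K n).
Notation Sp := (@Sp K n).
Notation fl := (@fl K n).
Notation Rel := (@Rel K n).
Implicit Types (x y z : nat * bool) (p q v : V) (U W M N : sub).
Implicit Types (a b c : nat * bool -> V) (J : pred (nat * bool)) (u : seq nat).
Implicit Types (C D : 'I_n -> sub).

(** The rank one identity behind the exchange of letters: [c (bet i) + t *: c (alp i)] and
    [c (alp i) + t^-1 *: c (bet i)] are proportional, so the opposite root element with the inverse
    parameter leads to the same chamber. *)
Lemma rootE_swap c (i : nat) t : isframe c -> (i < n)%N -> t != 0 ->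
  fl (rootE c (bet i) (alp i) t^-1) = fl (fun x => rootE c (alp i) (bet i) t (sgen i x)).
Proof.
move=> fc hi t0; have ha := alp_lt hn hi; have hb := bet_lt hn hi.
have ab := alp_neq_bet hn hi; have bfa := bet_neq hn hi.
have ba : bet i != alp i by rewrite eq_sym.
have afb : alp i != flip (bet i).
  by apply: contra bfa => /eqP ->; rewrite flipK.
have f1 := rootE_frame fc t^-1 hb ha ba afb.
have f2 := rootE_frame fc t ha hb ab bfa.
have f3 := frame_sgen hn f2 i.
apply: functional_extensionality => j; rewrite /fl.
have [e|ji] := eqVneq (nat_of_ord j) i; last first.
  have ij : i <> j by apply/eqP; rewrite eq_sym.
  rewrite [RHS]Sp_sgen // [RHS](_ : _ = fl (rootE c (alp i) (bet i) t) j) //.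
  rewrite rootE_fl ?rho_alp_bet //; apply: rootE_Sp => //.
    by rewrite -sgen_alp Jset_sgen.
  by rewrite -sgen_alp -sgen_flip Jset_sgen.
rewrite e; apply/eqP; rewrite eqEdim; apply/andP; split; last first.
  by rewrite (dim_Sp f1) (dim_Sp f3).
have inS y : (y.1 < n)%N -> Jset i y ->
    rootE c (alp i) (bet i) t (sgen i y) \in
    Sp (fun x => rootE c (alp i) (bet i) t (sgen i x)) (Jset i).
  exact: (@mem_Sp K n (fun x => rootE c (alp i) (bet i) t (sgen i x))).
apply: Sp_sub => x hx Jx.
have xb : x != bet i by apply: contraTneq Jx => ->; exact: Jset_bet.
have xfa : x != flip (alp i) by apply: contraTneq Jx => ->; exact: Jset_flip_alp.
rewrite {1}/rootE; have [ex|xa] := eqVneq x (alp i).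
  have := inS _ hx Jx; rewrite ex sgen_alp /rootE eqxx => h.
  have -> : c (alp i) + t^-1 *: c (bet i) = t^-1 *: (c (bet i) + t *: c (alp i)).
    by rewrite scalerDr scalerA mulVf // scale1r addrC.
  exact: memvZ.
have [ex|xfb] := eqVneq x (flip (bet i)).
  have := inS _ hx Jx; rewrite ex sgen_flip sgen_bet // /rootE ifF; last first.
    by apply/negbTE; rewrite eq_sym.
  rewrite eqxx => h.
  have -> : c (flip (bet i)) - t^-1 *: c (flip (alp i)) =
      (- t^-1) *: (c (flip (alp i)) - t *: c (flip (bet i))).
    by rewrite scalerBr scalerA mulNr mulVf // !scaleNr scale1r opprK addrC.
  exact: memvZ.
have := inS _ hx Jx; rewrite (Jset_flip_bet hn hi hx Jx xa xfb) /rootE.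
by rewrite (negPf xb) (negPf xfa).
Qed.

Lemma rootE_weval a u x y t : rootE (fun z => a (weval u z)) x y t =
  (fun z => rootE a (weval u x) (weval u y) t (weval u z)).
Proof.
apply: functional_extensionality => z; rewrite /rootE (inj_eq (@weval_inj n hn u)).
by rewrite -!weval_flip (inj_eq (@weval_inj n hn u)).
Qed.

(* The frame can be corrected by a root element fixing C, on one side of D or
   on the other according to the order of the two indices swapped. *)
Lemma Rel_step C D D' u (i : nat) : chamber D -> chamber D' -> adj i D D' ->
  Rel C D u -> Rel C D' u \/ Rel C D' (rcons u i).
Proof.
move=> cD cD' hadj [hu [a [fa eC eD]]]; have hi : (i < n)%N by case: hadj.
have fc := frame_weval hn fa u.
rewrite eD in cD hadj; have [t et] := adj_frame hn fc cD cD' hadj.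
have ha := alp_lt hn hi; have hb := bet_lt hn hi.
have ab := alp_neq_bet hn hi; have bfa := bet_neq hn hi.
have ba : bet i != alp i by rewrite eq_sym.
have afb : alp i != flip (bet i) by apply: contra bfa => /eqP ->; rewrite flipK.
have hwa : ((weval u (alp i)).1 < n)%N by rewrite weval_lt.
have hwb : ((weval u (bet i)).1 < n)%N by rewrite weval_lt.
have wab : weval u (alp i) != weval u (bet i) by rewrite (inj_eq (@weval_inj n hn u)).
have wbfa : weval u (bet i) != flip (weval u (alp i)).
  by rewrite -weval_flip (inj_eq (@weval_inj n hn u)).
have wafb : weval u (alp i) != flip (weval u (bet i)).
  by rewrite -weval_flip (inj_eq (@weval_inj n hn u)).
have hui : wordW (rcons u i) by rewrite /Pilot.Defs.wordW all_rcons hi.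
have rc b : (fun x => b (weval (rcons u i) x)) = (fun x => b (weval u (sgen i x))) :> (_ -> V).
  by apply: functional_extensionality => x; rewrite weval_rcons.
have [lt|le] := ltnP (rho (weval u (alp i))) (rho (weval u (bet i))).
  right; split=> //; exists (rootE a (weval u (alp i)) (weval u (bet i)) t); split.
  - exact: rootE_frame.
  - by rewrite rootE_fl.
  - by rewrite rc et rootE_weval.
have lt : (rho (weval u (bet i)) < rho (weval u (alp i)))%N.
  rewrite ltn_neqAle le andbT; apply: contra wab => /eqP e.
  by apply/eqP; apply/esym; apply: (rho_inj hn).
have [t0|t0] := eqVneq t 0; last first.
  left; split=> //; exists (rootE a (weval u (bet i)) (weval u (alp i)) t^-1); split.
  - by apply: rootE_frame => //; rewrite eq_sym.
  - by rewrite rootE_fl.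
  - by rewrite et -rootE_swap // rootE_weval.
right; split=> //; exists a; split=> //; rewrite et rc.
apply: functional_extensionality => j; rewrite /fl; congr (span (map _ _)).
apply: functional_extensionality => z; rewrite rootE_weval /rootE t0 !scale0r addr0 subr0.
by case: eqP => [->|_] //; case: eqP => [->|].
Qed.

(** By [Rel_step], each letter of the gallery is either appended or absorbed, so [u'] is a subword;
    in a minimal gallery no letter can be absorbed. *)
Lemma gallery_Rel_sub C D u : gallery C D u -> (exists a, isframe a /\ C = fl a) ->
  exists u', [/\ Rel C D u', (size u' <= size u)%N & size u' = size u -> u' = u].
Proof.
move=> [cC [cs [g e]]] [a [fa eC]].
suff main : forall cs u C1 u1, chamber C1 -> Rel C C1 u1 -> galleryP C1 cs u ->
    exists u', [/\ Rel C (last C1 cs) (u1 ++ u'), (size u' <= size u)%N &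
      size u' = size u -> u' = u].
  have [|u' [h1 h2 h3]] := main cs u C [::] cC _ g.
    by split=> //; exists a; split.
  by exists u'; split=> //; rewrite -e.
clear cs u g e; move=> cs; elim: cs => [|C2 cs IH] [|i u] //= C1 u1 cC1 h1.
  by move=> _; exists [::]; rewrite cats0.
move=> [ad [cC2 g]].
have [h2|h2] := Rel_step cC1 cC2 ad h1.
  have [u' [h3 h4 h5]] := IH _ _ _ cC2 h2 g; exists u'; split=> //; first exact: leqW.
  by move=> h; move: h4; rewrite h ltnn.
have [u' [h3 h4 h5]] := IH _ _ _ cC2 h2 g; exists (i :: u'); split=> //.
  by rewrite -cat_rcons.
by move=> [/h5 ->].
Qed.

(** The initial segments for [rho] span a full flag: [Aset r] up to dimension [n], and the perps of
    these above. *)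
Definition Fset (r : nat) x : bool := (rho x < r)%N.

Lemma Fset_flip (r : nat) x : (x.1 < n)%N -> (r <= n + n)%N ->
  ~~ Fset r (flip x) = Fset (n + n - r) x.
Proof. by move=> hx hr; rewrite /Fset rho_flip //; have := rho_lt hn hx; lia. Qed.

Lemma fl_Fset a b (r : nat) : isframe a -> isframe b -> fl a = fl b -> (r <= n + n)%N ->
  Sp a (Fset r) = Sp b (Fset r).
Proof.
move=> fa fb e; have h2 : (n - 2 < n)%N by lia.
have h1 : (n - 1 < n)%N by lia.
have J j : (j < n)%N -> Sp a (Jset j) = Sp b (Jset j).
  by move=> hj; have := congr1 (fun f => f (Ordinal hj)) e.
have FA c r' : (r' <= n)%N -> Sp c (Fset r') = Sp c (Aset r').
  move=> hr; apply: eq_Sp => -[k d] /= hk; rewrite /Fset /Aset /rho /=.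
  by case: d => //=; lia.
have low r' : (r' <= n)%N -> Sp a (Fset r') = Sp b (Fset r').
  move=> hr; rewrite !FA //.
  have [->|r0] := posnP r'.
    have z c : Sp c (Aset 0) = Sp c pred0.
      by apply: eq_Sp => x _; rewrite /Aset ltn0 andbF.
    by rewrite !z !/(Sp _ _) !filter_pred0.
  have [h|h] := ltnP r'.-1 (n - 2).
    have z c : Sp c (Aset r') = Sp c (Jset r'.-1).
      by apply: eq_Sp => x _; rewrite Jset_small // prednK.
    by rewrite !z J //; lia.
  have [->|->] : r' = (n - 1)%N \/ r' = n by lia.
    by rewrite !Aset_cap // !J.
  by rewrite !Aset_max // J.
move=> hr; have [h|h] := leqP r n; first exact: low.
have dual c : isframe c -> Sp c (Fset r) = perp (Sp c (Fset (n + n - r))).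
  move=> fc; rewrite perp_Sp //; apply: eq_Sp => x hx /=.
  rewrite Fset_flip ?leq_subr // subKn //.
by rewrite !dual // low //; lia.
Qed.

Lemma fl_Aset a b m : isframe a -> isframe b -> fl a = fl b -> (m <= n)%N ->
  Sp a (Aset m) = Sp b (Aset m).
Proof.
move=> fa fb e hm; have := fl_Fset fa fb e (leq_trans hm (leq_addr n n)).
have FA c : Sp c (Fset m) = Sp c (Aset m).
  apply: eq_Sp => -[k d] /= hk; rewrite /Fset /Aset /rho /=.
  by case: d => //=; lia.
by rewrite !FA.
Qed.

(** A Jordan-Hoelder argument on the flags of [C] and [D]. If [v = a (weval u (k, false))] came
    earlier in the flag of [C] than [b (weval u' (k, false))], its coordinate there would vanish,
    and [v] would drop from step [k.+1] to step [k] of the flag of [D]. *)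
Lemma Rel_uniq C D u u' : Rel C D u -> Rel C D u' -> weq n u u'.
Proof.
move=> [hu [a [fa eC eD]]] [hu' [b [fb eC' eD']]].
have key : forall a b u u', isframe a -> isframe b -> fl a = fl b ->
    fl (fun x => a (weval u x)) = fl (fun x => b (weval u' x)) ->
    forall k, (k < n)%N -> (rho (weval u' (k, false)) <= rho (weval u (k, false)))%N.
  clear -hn => a b u u' fa fb e e' k hk; rewrite leqNgt; apply/negP => lt.
  have fau := frame_weval hn fa u; have fbu := frame_weval hn fb u'.
  pose v := a (weval u (k, false)).
  have hw : ((weval u (k, false)).1 < n)%N by rewrite weval_lt.
  have v1 : v \in Sp b (Fset (rho (weval u (k, false))).+1).
    rewrite -(fl_Fset fa fb e); last exact: rho_lt.
    by apply: mem_Sp => //; rewrite /Fset ltnSn.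
  have v2 : v \in Sp (fun x => b (weval u' x)) (Aset k.+1).
    rewrite -(fl_Aset fau fbu e' hk).
    by apply: (@mem_Sp K n (fun x => a (weval u x))); rewrite //= /Aset /= ltnSn.
  have : v \in Sp (fun x => a (weval u x)) (Aset k).
    rewrite (fl_Aset fau fbu e' (ltnW hk)); apply/(SpP fbu) => x hx Ax.
    have [Ax'|Ax'] := boolP (Aset k.+1 x); last by move/(SpP fbu): v2 => ->.
    have -> : x = (k, false).
      move: Ax Ax'; rewrite /Aset; case: x hx => l [] //= hl h1 h2; congr (_, _); lia.
    rewrite weval_flip; move/(SpP fb): v1 => -> //; first by rewrite weval_lt.
    by rewrite /Fset ltnS -ltnNge.
  rewrite -[v]/((fun x => a (weval u x)) (k, false)) (mem_SpE fau) //.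
  by rewrite /Aset /= ltnn.
rewrite eC in eC'; rewrite eD in eD'.
have same k : (k < n)%N -> weval u (k, false) = weval u' (k, false).
  move=> hk; apply: (rho_inj hn); rewrite ?weval_lt //.
  by apply/eqP; rewrite eqn_leq (key b a u' u) ?(key a b u u').
move=> k [] hk; last exact: same.
by rewrite -[(k, true)]/(flip (k, false)) !weval_flip same.
Qed.

Lemma max_rho (s : seq (nat * bool)) : s <> [::] ->
  exists2 y, y \in s & forall z, z \in s -> (rho z <= rho y)%N.
Proof.
elim: s => // x s IH _; case: s IH => [|x' s] IH.
  by exists x; rewrite ?mem_head // => z; rewrite inE => /eqP ->.
have [//|y ys hy] := IH.
have [le|lt] := leqP (rho x) (rho y).
  by exists y => [|z]; rewrite in_cons ?ys ?orbT // => /orP[/eqP ->|/hy].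
exists x; rewrite ?mem_head // => z; rewrite in_cons => /orP[/eqP ->|/hy] //.
by move=> h; apply: leq_trans h (ltnW lt).
Qed.

Lemma eq_Sp_frame a b J : (forall x, (x.1 < n)%N -> J x -> a x = b x) ->
  Sp a J = Sp b J.
Proof.
move=> h; congr span; apply/eq_in_map => x.
by rewrite mem_filter mem_idx => /andP[Jx hx]; exact: h.
Qed.

Section Siegel.
Variables (a : nat * bool -> V) (y : nat * bool) (v : V).
Hypotheses (fa : isframe a) (hy : (y.1 < n)%N) (qv : Qf v = 0).
Hypothesis vy : Bf v (a (flip y)) = 1.

(* The Siegel transformation moving the hyperbolic pair (a y, a (flip y)) to
   (v, a (flip y)). *)
Definition siegel x : V :=
  if x == y then v else if x == flip y then a x
  else a x - Bf (a x) v *: a (flip y).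

Lemma siegel_y : siegel y = v. Proof. by rewrite /siegel eqxx. Qed.
Lemma siegel_fy : siegel (flip y) = a (flip y).
Proof. by rewrite /siegel (negPf (flip_neq y)) eqxx. Qed.
Lemma siegel_gen x : x != y -> x != flip y ->
  siegel x = a x - Bf (a x) v *: a (flip y).
Proof. by rewrite /siegel => /negPf -> /negPf ->. Qed.

Lemma siegel_frame : isframe siegel.
Proof.
have qf : Qf (a (flip y)) = 0 by case: (frame_sv fa (x := flip y)).
have Bff : Bf (a (flip y)) (a (flip y)) = 0 by rewrite Bfxx0.
have fv : Bf (a (flip y)) v = 1 by rewrite BfC.
have azf z : (z.1 < n)%N -> z != y -> Bf (a z) (a (flip y)) = 0.
  by move=> hz zy; rewrite (frame_Bflip fa) // (negPf zy).
have ff z w : (flip z == flip w) = (z == w) by rewrite (inj_eq (inv_inj flipK)).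
have genv z : (z.1 < n)%N -> z != y -> z != flip y -> Bf (siegel z) v = 0.
  by move=> hz zy zf; rewrite siegel_gen // BfBl BfZl fv mulr1 subrr.
have genf z : (z.1 < n)%N -> z != y -> z != flip y -> Bf (siegel z) (a (flip y)) = 0.
  by move=> hz zy zf; rewrite siegel_gen // BfBl BfZl Bff mulr0 subr0 azf.
have Q z : (z.1 < n)%N -> Qf (siegel z) = 0.
  move=> hz; have [->|zy] := eqVneq z y; first by rewrite siegel_y.
  have [->|zf] := eqVneq z (flip y); first by rewrite siegel_fy.
  rewrite siegel_gen // QfD QfN QfZ qf mulr0 BfNr BfZr azf // mulr0 oppr0 !addr0.
  by case: (frame_sv fa hz).
move=> z w hz hw; split; first exact: Q.
have sym : forall z w, (z.1 < n)%N -> (w.1 < n)%N -> w = y \/ w = flip y ->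
    Bf (siegel z) (siegel w) = (w == flip z)%:R.
  clear z w hz hw => z w hz hw [->|->].
    rewrite siegel_y; have [->|zy] := eqVneq z y.
      by rewrite siegel_y Bfxx0 // eq_sym (negPf (flip_neq y)).
    have [->|zf] := eqVneq z (flip y); first by rewrite siegel_fy fv ?flipK ?eqxx.
    by rewrite genv // -(inj_eq (inv_inj flipK)) flipK eq_sym (negPf zf).
  rewrite siegel_fy ff; have [->|zy] := eqVneq z y; first by rewrite siegel_y vy ?eqxx.
  have [->|zf] := eqVneq z (flip y).
    by rewrite siegel_fy Bff.
  by rewrite genf // ?(eq_sym y z) ?(negPf zy).
have [e|wy] := eqVneq w y; first by apply: sym => //; left.
have [e|wf] := eqVneq w (flip y); first by apply: sym => //; right.
have eqs x x' : (x == flip x') = (x' == flip x).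
  by rewrite -(inj_eq (inv_inj flipK)) flipK eq_sym.
have [e|zy] := eqVneq z y; first by rewrite BfC sym //; [rewrite eqs|left].
have [e|zf] := eqVneq z (flip y); first by rewrite BfC sym //; [rewrite eqs|right].
rewrite [siegel w]siegel_gen // BfBr BfZr genf // mulr0 subr0.
by rewrite siegel_gen // BfBl BfZl [Bf (a (flip y)) _]BfC azf // mulr0 subr0 (frame_B fa).
Qed.

Hypothesis vsupp : forall z, (z.1 < n)%N -> Bf v (a (flip z)) != 0 ->
  (rho z <= rho y)%N.

(** In a vertex containing index [y], the support condition leaves only the coordinate [c] of [v] at
    [flip y] as a possible obstruction. Removing it gives a vector of a singular subspace on which
    [Qf] is [- c], so [c = 0]. *)
Lemma siegel_fl : fl siegel = fl a.
Proof.
apply: functional_extensionality => j; rewrite /fl.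
apply/eqP; rewrite eqEdim; apply/andP; split; last first.
  by rewrite (dim_Sp fa) (dim_Sp siegel_frame).
have hj := ltn_ord j; have tJ := ts_Jset hn fa hj.
apply: Sp_sub => z hz Jz.
have [ez|zy] := eqVneq z y; last first.
  have [ezf|zf] := eqVneq z (flip y).
    by rewrite ezf siegel_fy; apply: mem_Sp; rewrite -?ezf.
  rewrite siegel_gen //; have [->|nz] := eqVneq (Bf (a z) v) 0.
    by rewrite scale0r subr0 mem_Sp.
  rewrite memvB ?memvZ // mem_Sp //.
  have hle : (rho (flip z) <= rho y)%N by apply: vsupp => //; rewrite flipK BfC.
  apply: (Jset_mono hn (y := z)) => //; last by rewrite flipK.
  have ne : rho (flip y) != rho z.
    by apply: contra zf => /eqP/(rho_inj hn) ->.
  rewrite ltn_neqAle ne /=; move: hle; rewrite !rho_flip //.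
  by have := rho_lt hn hz; have := rho_lt hn hy; lia.
rewrite ez siegel_y; rewrite ez in Jz.
have offJ x : (x.1 < n)%N -> ~~ Jset j x -> x != flip y -> Bf v (a (flip x)) = 0.
  move=> hx Jx xf; apply/eqP/negPn/negP => /(vsupp hx) le.
  have ne : rho x != rho y.
    by apply: contra Jx => /eqP/(rho_inj hn) ->.
  case/negP: Jx; apply: (Jset_mono hn (y := y)) => //; first by rewrite ltn_neqAle ne.
  by apply: contra xf => /eqP ->; rewrite flipK.
have wJ : v - Bf v (a y) *: a (flip y) \in Sp a (Jset j).
  apply/(SpP fa) => x hx Jx; rewrite BfBl BfZl (frame_Bflip fa) //.
  have [->|xf] := eqVneq x (flip y); first by rewrite flipK ?eqxx mulr1 subrr.
  by rewrite offJ // ?(eq_sym _ x) ?(negPf xf) mulr0 subr0.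
have := tJ _ wJ; rewrite QfD QfN QfZ qv (proj1 (frame_sv fa (x := flip y) hy)).
rewrite mulr0 !add0r BfNr BfZr vy mulr1 => /eqP; rewrite oppr_eq0 => /eqP c0.
by move: wJ; rewrite c0 scale0r subr0.
Qed.

End Siegel.

(** Gaussian elimination in the style of the Bruhat decomposition: the part of [v] outside the flag
    already fitted is scaled to have coordinate 1 at its last index [y] for [rho], then replaces
    [a y]; by [siegel_fl] the chamber of [a] is kept. *)
Lemma frame_absorb a u m v : isframe a -> (m < n)%N ->
  Qf v = 0 -> v \in perp (Sp (fun x => a (weval u x)) (Aset m)) ->
  v \notin Sp (fun x => a (weval u x)) (Aset m) ->
  exists a' x, [/\ isframe a', fl a' = fl a,
    forall j, (j <= m)%N -> Sp (fun x => a' (weval u x)) (Aset j) =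
                            Sp (fun x => a (weval u x)) (Aset j),
    (m <= x.1 < n)%N &
    v \in (Sp (fun x => a (weval u x)) (Aset m) + <[a' (weval u x)]>)%VS].
Proof.
move=> fa hm qv vP vS; have fc := frame_weval hn fa u.
pose c := fun x => a (weval u x).
pose A x := Aset m (weval (rev u) x).
have cA : Sp c (Aset m) = Sp a A.
  apply/eqP; rewrite eqEsubv; apply/andP; split; apply: Sp_sub => x hx Ax.
    by apply: (@mem_Sp K n a A (weval u x)); rewrite ?weval_lt // /A weval_revK.
  rewrite -(weval_Krev hn u x).
  by apply: (@mem_Sp K n c) => //; rewrite weval_lt.
rewrite -/c cA in vP vS *.
have [v1 v1C sA] : exists2 v1, v1 \in Sp a [pred x | ~~ A x] & v - v1 \in Sp a A.
  exists (\sum_(x <- idx n | ~~ A x) Bf v (a (flip x)) *: a x).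
    rewrite big_seq_cond; apply: memv_suml => x; rewrite mem_idx => /andP[hx Ax].
    by rewrite memvZ // mem_Sp.
  rewrite {1}(frame_expand fa v) (bigID A) /= addrK.
  rewrite big_seq_cond; apply: memv_suml => x; rewrite mem_idx => /andP[hx Ax].
  by rewrite memvZ // mem_Sp.
have tA : ts (Sp a A) by rewrite -cA; exact: ts_Aset.
have v1P w : w \in Sp a A -> Bf v1 w = 0.
  move=> wA; have -> : v1 = v - (v - v1) by rewrite subKr.
  by rewrite BfBl (perp_mem' vP wA) (ts_orth tA sA wA) subr0.
have qv1 : Qf v1 = 0.
  have -> : v1 = v - (v - v1) by rewrite subKr.
  by rewrite QfD qv QfN (tA _ sA) BfNr (perp_mem' vP sA) oppr0 !addr0.
have [y ys ymax] : exists2 y, y \in [seq x <- idx n | Bf v1 (a (flip x)) != 0] &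
    forall z, z \in [seq x <- idx n | Bf v1 (a (flip x)) != 0] -> (rho z <= rho y)%N.
  apply: max_rho => e; case/negP: vS.
  suff v10 : v1 = 0 by move: sA; rewrite v10 subr0.
  rewrite (frame_expand fa v1) big_seq big1 // => x hx.
  have : x \notin [seq x <- idx n | Bf v1 (a (flip x)) != 0] by rewrite e.
  by rewrite mem_filter hx andbT negbK => /eqP ->; rewrite scale0r.
move: ys; rewrite mem_filter mem_idx => /andP[m0 hy].
set mu := Bf v1 (a (flip y)) in m0.
pose v2 := mu^-1 *: v1.
have qv2 : Qf v2 = 0 by rewrite QfZ qv1 mulr0.
have v2y : Bf v2 (a (flip y)) = 1 by rewrite BfZl mulVf.
have v2P w : w \in Sp a A -> Bf v2 w = 0 by move=> wA; rewrite BfZl v1P ?mulr0.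
have v2s z : (z.1 < n)%N -> Bf v2 (a (flip z)) != 0 -> (rho z <= rho y)%N.
  move=> hz h; apply: ymax; rewrite mem_filter mem_idx hz andbT.
  by apply: contra h => /eqP h'; rewrite /v2 BfZl h' mulr0.
have nAfy : ~~ A (flip y).
  apply/negP => Af; move/eqP: v2y; rewrite v2P ?mem_Sp //.
  by rewrite eq_sym oner_eq0.
have nAy : ~~ A y.
  by apply/negP => Ay; case/negP: m0; rewrite /mu; move/(SpP fa): v1C => -> //=; rewrite Ay.
have eqA x : (x.1 < n)%N -> A x -> siegel a y v2 x = a x.
  move=> hx Ax; rewrite siegel_gen; last 2 first.
  - by apply: contraTneq Ax => ->.
  - by apply: contraTneq Ax => ->.
  by rewrite BfC v2P ?mem_Sp // scale0r subr0.
exists (siegel a y v2), (weval (rev u) y); split.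
- exact: siegel_frame.
- exact: siegel_fl.
- move=> j jm; apply: eq_Sp_frame => x hx /andP[x2 xj].
  by apply: eqA; rewrite ?weval_lt // /A weval_revK // /Aset x2 (leq_trans xj).
- rewrite weval_lt // hy andbT leqNgt; apply/negP => lt.
  have [b2|b2] := boolP (weval (rev u) y).2.
    by case/negP: nAfy; rewrite /A weval_flip /Aset /flip /= lt b2.
  by case/negP: nAy; rewrite /A /Aset lt b2.
- apply/add_line_mem; exists mu; rewrite weval_Krev // siegel_y.
  by rewrite /v2 scalerA mulfV // scale1r.
Qed.

(** The flag [G] is fitted one dimension at a time: [frame_absorb] places the new vector at some
    index, and [word_reach] carries [(m, false)] there. It stops at [n - 1], because changing the
    last sign alone is not in the group of type D. *)
Lemma flag_frame a (G : nat -> sub) m : isframe a -> (m <= n - 1)%N ->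
  (forall j, (j <= m)%N -> ts (G j) /\ \dim (G j) = j) ->
  (forall j, (j < m)%N -> (G j <= G j.+1)%VS) ->
  exists a' u, [/\ isframe a', wordW u, fl a' = fl a &
    forall j, (j <= m)%N -> Sp (fun x => a' (weval u x)) (Aset j) = G j].
Proof.
move=> fa; elim: m => [|m IH] hm hG sG.
  exists a, [::]; split=> // j; rewrite leqn0 => /eqP ->.
  have [_ /eqP] := hG 0%N isT; rewrite dimv_eq0 => /eqP ->.
  by apply/eqP; rewrite -dimv_eq0 (dim_Aset fa).
have hm1 : (m < n - 1)%N by [].
have hmn : (m < n)%N by apply: leq_trans hm1 (leq_subr _ _).
have [j jm|j jm|a1 [u1 [f1 w1 e1 h1]]] := IH (ltnW hm).
- by apply: hG; exact: leqW.
- by apply: sG; exact: leqW.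
have [tG dG] := hG m.+1 (leqnn _); have [_ dGm] := hG m (leqnSn _).
have GS := sG m (leqnn _).
have : ~~ (G m.+1 <= G m)%VS by apply/negP => /dimvS; rewrite dG dGm ltnn.
case/subvPn' => v vG vn.
have eGm := h1 m (leqnn m).
have eG : G m.+1 = (G m + <[v]>)%VS.
  by apply/esym/eqP; rewrite eqEdim subv_add GS -memvE vG dim_add_line // dGm dG /=.
have vP : v \in perp (Sp (fun x => a1 (weval u1 x)) (Aset m)).
  by rewrite eGm; apply: (subvP (subv_trans (tsP tG) (perpS GS))).
have vS : v \notin Sp (fun x => a1 (weval u1 x)) (Aset m) by rewrite eGm.
have [a2 [x [f2 e2 h2 hx vx]]] := frame_absorb f1 hmn (tG _ vG) vP vS.
have [v0 [wv0 ev0 fv0]] := word_reach hn x.2 hm1 hx.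
have wj j d : (j < m)%N -> weval (u1 ++ v0) (j, d) = weval u1 (j, d).
  by move=> jm; rewrite weval_cat fv0.
have old j : (j <= m)%N -> Sp (fun x => a2 (weval (u1 ++ v0) x)) (Aset j) = G j.
  move=> jm; rewrite -h1 // -h2 //; apply: eq_Sp_frame => -[k b] hk /andP[/= _ kj].
  by rewrite wj // (leq_trans kj).
have w2 : wordW (u1 ++ v0) by rewrite /Pilot.Defs.wordW all_cat; apply/andP.
exists a2, (u1 ++ v0); split=> //; first by rewrite e2.
move=> j; rewrite leq_eqVlt => /orP[/eqP ->|]; last exact: old.
rewrite (AsetS (frame_weval hn f2 _)) // old //.
have ex : weval (u1 ++ v0) (m, false) = weval u1 x.
  by rewrite weval_cat ev0 -surjective_pairing.
rewrite ex eG; rewrite eGm in vx.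
have [k hk] := (add_line_mem _ _ _).1 vx.
have k0 : k != 0.
  by apply: contra vn => /eqP k0; move: hk; rewrite k0 scale0r subr0.
apply/eqP; rewrite eq_sym eqEdim subv_add addvSl -memvE vx /=.
rewrite (dim_add_line vn); apply: leq_trans (dimv_add_leqif _ _).1 _.
by rewrite addnC dim_vline; case: (_ != 0).
Qed.

Lemma std_frame : exists a, isframe a /\ chamber (fl a).
Proof.
pose e (k : nat) (b : bool) : V :=
  if insub k is Some i then delta_mx 0 (if b then rshift n i else lshift n i) else 0.
have eE k (hk : (k < n)%N) (b : bool) : e k b =
    delta_mx 0 (if b then rshift n (Ordinal hk) else lshift n (Ordinal hk)).
  by rewrite /e insubT.
(* Exchanging the last hyperbolic pair makes the vertex [n - 2] equal to [M0], which is of class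
   [cls_low]. *)
pose a x := e x.1 (x.2 (+) (x.1 == n - 1)%N).
have Be k l (b d : bool) : (k < n)%N -> (l < n)%N -> Bf (e k b) (e l d) = ((l == k) && (d == ~~ b))%:R.
  move=> hk hl; rewrite !eE.
  case: d; rewrite ?Bf_delta_l ?Bf_delta_r mxE eqxx /=; case: b => /=.
  - by rewrite eq_lrshift andbF.
  - by rewrite eq_lshift -val_eqE /= andbT.
  - by rewrite eq_rshift -val_eqE /= andbT.
  - by rewrite eq_sym eq_lrshift andbF.
have fa : isframe a.
  move=> [k b] [l d] /= hk hl; split.
    rewrite /a /= eE /Qf big1 // => i _; rewrite !mxE eqxx /=.
    case: (b (+) _); first by rewrite eq_lrshift mul0r.
    by rewrite [rshift n i == _]eq_sym eq_lrshift mulr0.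
  rewrite /a /= Be // /flip xpair_eqE /=; have [->|] //= := eqVneq l k.
  by congr (nat_of_bool _)%:R; case: d; case: b; case: (k == _).
exists a; split=> //; apply: fl_chamber => //.
have M0e : Sp a (Jset (n - 2)) = M0 K n.
  have h2 : (n - 2 < n)%N by clear -hn; lia.
  apply/eqP; rewrite eqEdim M0_dim (dim_Jset hn fa h2) ltnn leqnn andbT.
  apply: Sp_sub => -[k b] /= hk; rewrite Jset_low /a /= => h.
  have -> : b (+) (k == n - 1)%N = false.
    by case/orP: h => /andP[]; case: b => //= _; [move=> lt; rewrite ltn_eqF|move=> /eqP ->; rewrite eqxx].
  rewrite (eE _ hk); apply: memv_span; apply/mapP.
  by exists (Ordinal hk); rewrite ?mem_enum.
by rewrite /low M0e /cls_low capvv M0_dim.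
Qed.

(** [flag_frame] fits the flag of [D] up to the intersection of its last two vertices; the two
    maximal subspaces through it ([two_max]) are told apart by their class. *)
Lemma Rel_frame a D : isframe a -> chamber (fl a) -> chamber D ->
  exists u, Rel (fl a) D u.
Proof.
move=> fa ca cD; have n1 : (n - 1 < n)%N by clear -hn; lia.
have n2 : (n - 2 < n)%N by clear -hn; lia.
have n21 : (n - 2).+1 = (n - 1)%N by clear -hn; lia.
pose o1 := Ordinal n1; pose o2 := Ordinal n2.
have [t2 t1 d2 d1 nD] := chamber_two cD (erefl : val o2 = _) (erefl : val o1 = _).
have [h1 [h2 [h3 [h4 h5]]]] := cD.
pose D0 (j : nat) : sub := if insub j is Some i then D i else 0%VS.
have D0E j (hj : (j < n)%N) : D0 j = D (Ordinal hj) by rewrite /D0 insubT.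
pose G (j : nat) : sub := if j == 0%N then 0%VS else
  if (j < n - 1)%N then D0 j.-1 else (D o2 :&: D o1)%VS.
have GE j : (j.+1 < n - 1)%N -> forall hj : (j < n)%N, G j.+1 = D (Ordinal hj).
  by move=> h hj; rewrite /G /= h (D0E _ hj).
have ltn1 j : (j < n - 1)%N -> (j < n)%N by move=> h; apply: leq_trans h (leq_subr _ _).
have Glast : G (n - 1)%N = (D o2 :&: D o1)%VS.
  by rewrite /G ltnn ifF //; move: hn; clear; lia.
have [j jm|j jm|a' [u [fa' wu ea hj]]] := @flag_frame a G (n - 1) fa (leqnn _).
- case: j jm => [|j] jm; first by rewrite /G /= dimv0; split=> //; exact: ts0.
  have [lt|le] := ltnP j.+1 (n - 1).
    have hj := ltn1 _ (ltnW lt); rewrite (GE _ lt hj); apply: h1 => /=.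
    by clear -lt; lia.
  have -> : j.+1 = (n - 1)%N by clear -le jm; lia.
  by rewrite Glast; split; [exact: ts_cap|rewrite h5].
- case: j jm => [|j] jm; first by rewrite {1}/G /= sub0v.
  have hj := ltn1 _ (ltnW jm); rewrite (GE _ jm hj).
  have lt2 : (j < n - 2)%N by clear -jm; lia.
  have [lt|le] := ltnP j.+2 (n - 1).
    by rewrite (GE _ lt (ltn1 _ jm)); apply: h2 => /=.
  have -> : j.+2 = (n - 1)%N by clear -le jm; lia.
  by rewrite Glast subv_cap !h2 //= (leq_trans lt2) // leq_sub2l.
exists u; split=> //; exists a'; split=> //.
set c := fun x => a' (weval u x) in hj *.
have fc : isframe c by exact: frame_weval.
have cc : chamber (fl c) by apply: fl_weval_chamber => //; rewrite ea.
have [c2t c1t c2d c1d nc] := chamber_two cc (erefl : val o2 = _) (erefl : val o1 = _).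
have eG : Sp c (Aset (n - 1)) = (D o2 :&: D o1)%VS by rewrite hj.
have dA : (\dim (Sp c (Aset (n - 1)))).+1 = n.
  by rewrite (dim_Aset fc) ?leq_subr //; clear -hn; lia.
have c2A : (Sp c (Aset (n - 1)) <= fl c o2)%VS by rewrite Aset_cap // capvSl.
have c1A : (Sp c (Aset (n - 1)) <= fl c o1)%VS by rewrite Aset_cap // capvSr.
have [_ [_ [g2 [g1 _]]]] := cc.
have cls2 := (g2 o2 erefl).2; have cls1 := (g1 o1 erefl).2.
have cD2 := (h3 o2 erefl).2; have cD1 := (h4 o1 erefl).2.
have e2 : D o2 = fl c o2.
  have A2 : (Sp c (Aset (n - 1)) <= D o2)%VS by rewrite eG capvSl.
  have [//|e] := two_max c2t c1t t2 c2d c1d d2 dA c2A c1A A2 nc.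
  by move: cD2; rewrite e (negPf cls1).
have e1 : D o1 = fl c o1.
  have A1 : (Sp c (Aset (n - 1)) <= D o1)%VS by rewrite eG capvSr.
  have [e|//] := two_max c2t c1t t1 c2d c1d d1 dA c2A c1A A1 nc.
  by move: cD1; rewrite e cls2.
apply: functional_extensionality => j.
case: (idx_cases hn (ltn_ord j)) => [lt|[e|e]].
- have lt1 : (j.+1 < n - 1)%N by clear -lt; lia.
  have -> : fl c j = Sp c (Aset j.+1) by apply: eq_Sp => x hx; rewrite Jset_small.
  by rewrite hj ?(ltnW lt1) // (GE _ lt1 (ltn_ord j)); congr D; exact: val_inj.
- by rewrite (_ : j = o2) //; exact: val_inj.
- by rewrite (_ : j = o1) //; exact: val_inj.
Qed.

Lemma chamber_frame C : chamber C -> exists a, isframe a /\ C = fl a.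
Proof.
move=> cC; have [a0 [f0 c0]] := std_frame.
have [u [hu [a [fa e1 e2]]]] := Rel_frame f0 c0 cC.
by exists (fun x => a (weval u x)); split=> //; exact: frame_weval.
Qed.

Lemma Rel_exists C D : chamber C -> chamber D -> exists u, Rel C D u.
Proof.
by move=> cC cD; have [a [fa e]] := chamber_frame cC; subst C; exact: Rel_frame.
Qed.

Lemma min_gallery_Rel C D u : min_gallery C D u -> Rel C D u.
Proof.
move=> [g h]; have [u' [r le e]] := gallery_Rel_sub g (chamber_frame g.1).
have := h _ (Rel_gallery hn g.1 r) => le2; rewrite -e //.
by apply/eqP; rewrite eqn_leq le.
Qed.

Lemma min_gallery_exists C D : chamber C -> chamber D -> exists u, min_gallery C D u.
Proof.
move=> cC cD; have [u r] := Rel_exists cC cD.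
have : exists u, gallery C D u by exists u; exact: Rel_gallery.
case=> w; have [k] := ubnP (size w); elim: k w => // k IH w hk gw.
case: (classic (exists w', gallery C D w' /\ (size w' < size w)%N)).
  by move=> [w' [g' lt]]; apply: IH g'; apply: leq_trans lt _.
move=> h; exists w; split=> // w' gw'; rewrite leqNgt; apply/negP => lt.
by apply: h; exists w'.
Qed.

Lemma Rel_sym C D u : Rel C D u -> Rel D C (rev u).
Proof.
move=> [hu [a [fa eC eD]]]; split; first by rewrite /Pilot.Defs.wordW all_rev.
exists (fun x => a (weval u x)); split=> //; first exact: frame_weval.
rewrite eC; congr fl; apply: functional_extensionality => x.
by rewrite weval_Krev.
Qed.

End Weyldistance.

(** * Collineations acting on chambers *)

Section Chambers.
Variables (K : fieldType) (n : nat).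
Hypothesis hn : (4 <= n)%N.
Notation V := 'rV[K]_(n + n).
Notation sub := {vspace V}.
Notation sigma := (sigma n).
Implicit Types (C D : 'I_n -> sub) (u : seq nat) (M : sub).

Lemma sigma_lt sw (i : nat) : (i < n)%N -> (sigma sw i < n)%N.
Proof. by rewrite /sigma; case: sw => //; do ! case: ifP => //; lia. Qed.

Lemma sigmaK sw : involutive (sigma sw).
Proof.
move=> i; rewrite /sigma; case: sw => //.
have n12 : (n - 1 == n - 2)%N = false by apply/negP => /eqP; lia.
have [->|h2] := eqVneq i (n - 2)%N; first by rewrite n12 eqxx.
have [->|h1] := eqVneq i (n - 1)%N; first by rewrite eqxx.
by rewrite (negPf h2) (negPf h1).
Qed.

Lemma sigma_small sw (i : nat) : (i < n - 2)%N -> sigma sw i = i.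
Proof. by move=> h; rewrite /sigma; case: sw => //; rewrite !ifF //; lia. Qed.

Lemma sigma_big sw (i : nat) : (n - 2 <= i < n)%N -> (n - 2 <= sigma sw i)%N /\
  (sigma sw i == n - 2)%N = (i == n - 2)%N (+) sw.
Proof.
move=> h; rewrite /sigma; case: sw; last by rewrite addbF; split=> //; lia.
have [->|->] : i = (n - 2)%N \/ i = (n - 1)%N by lia.
  by rewrite eqxx /= ; split; lia.
have n12 : (n - 1 == n - 2)%N = false by apply/negP => /eqP; lia.
by rewrite n12 eqxx leqnn eqxx.
Qed.

Definition sigo sw (i : 'I_n) : 'I_n := Ordinal (sigma_lt sw (ltn_ord i)).

Lemma sigoK sw : involutive (sigo sw).
Proof. by move=> i; apply: val_inj; rewrite /= sigmaK. Qed.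

Lemma chamber_ts C i : chamber C -> ts (C i).
Proof.
move=> [h1 [_ [h3 [h4 _]]]]; case: (idx_cases hn (ltn_ord i)) => [h|[h|h]].
- by case: (h1 i h).
- by have [/maxsingP[]] := h3 i h.
- by have [/maxsingP[]] := h4 i h.
Qed.

Lemma chamber_dim C i : chamber C ->
  \dim (C i) = if (i < n - 2)%N then i.+1 else n.
Proof.
move=> [h1 [_ [h3 [h4 _]]]]; case: (idx_cases hn (ltn_ord i)) => [h|[h|h]].
- by rewrite h; case: (h1 i h).
- by have [/maxsingP[_ ->]] := h3 i h; rewrite ifF //; lia.
- by have [/maxsingP[_ ->]] := h4 i h; rewrite ifF //; lia.
Qed.

Lemma chamber_cls C (i : 'I_n) : chamber C -> (n - 2 <= i)%N ->
  cls_low (C i) = (val i == n - 2)%N.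
Proof.
move=> [_ [_ [h3 [h4 _]]]] hi; have := ltn_ord i => lt.
have [h|h] : nat_of_ord i = (n - 2)%N \/ nat_of_ord i = (n - 1)%N by lia.
  by have [_ ->] := h3 i h; rewrite /= h eqxx.
have [_ /negPf ->] := h4 i h; rewrite /= h; apply/esym/negP => /eqP; lia.
Qed.

Section Action.
Variable th : sub -> sub.
Hypothesis hth : collineation th.
Notation im := (im th).
Variable sw : bool.
Hypothesis hsw : forall M, ts M -> \dim M = n -> cls_low (im M) = cls_low M (+) sw.

(** If the classes are swapped, images of the last two vertices have exchanged types; [sigo]
    restores the labelling required by [chamber]. *)
Definition thC C : 'I_n -> sub := fun i => im (C (sigo sw i)).

Lemma thC_chamber C : chamber C -> chamber (thC C).
Proof.
move=> cC; have tC i : ts (C i) := chamber_ts cC; have dC i := chamber_dim i cC.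
have dI i : \dim (thC C i) = \dim (C (sigo sw i)) by rewrite dim_im.
have sm (i : 'I_n) : (i < n - 2)%N -> sigo sw i = i.
  by move=> h; apply: val_inj; rewrite /= sigma_small.
have big (i : 'I_n) : (n - 2 <= i)%N -> \dim (C i) = n.
  by move=> h; rewrite dC ltnNge h.
have clsI (i : 'I_n) : (n - 2 <= i)%N -> maxsing (thC C i) /\
    cls_low (thC C i) = (val i == n - 2)%N.
  move=> h; have [] := @sigma_big sw i; first by rewrite h ltn_ord.
  move=> h1 h2; split.
    by apply/maxsingP; split; [exact: im_ts|rewrite dI big].
  by rewrite hsw ?big // chamber_cls //= h2 -addbA addbb addbF.
have n12 : (n - 1 == n - 2)%N = false by apply/negP => /eqP; lia.
have [h1 [h2 [h3 [h4 h5]]]] := cC.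
split; [|split; [|split; [|split]]].
- move=> i hi; split; first exact: im_ts.
  by rewrite dI sm // dC hi.
- move=> i j ij hi; rewrite /thC imS // sm //; apply: h2 => //.
  have [hj|hj] := ltnP j (n - 2); first by rewrite sm.
  have hj2 : (n - 2 <= j < n)%N by rewrite hj ltn_ord.
  have [h _] := sigma_big sw hj2.
  exact: leq_trans hi h.
- move=> i hi; have [|m c] := clsI i; first by rewrite -[nat_of_ord i]/(val i) hi leqnn.
  by rewrite c hi eqxx.
- move=> i hi; have [|m c] := clsI i; first by rewrite -[nat_of_ord i]/(val i) hi; lia.
  by rewrite c hi n12.
- move=> i j hi hj; rewrite /thC -im_cap // dim_im //; last exact: ts_cap.
  case: sw => /=.
    have e1 : val (sigo true i) = (n - 1)%N by rewrite /= /sigma hi eqxx.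
    have e2 : val (sigo true j) = (n - 2)%N.
      by rewrite /= /sigma hj n12 eqxx.
    by rewrite capvC h5.
  have sf (k : 'I_n) : sigo false k = k by exact: val_inj.
  by rewrite !sf h5.
Qed.

Lemma thC_img C : chamber C -> imgC th C (thC C).
Proof.
move=> cC; split; first exact: thC_chamber.
move=> i; exists (sigo sw i); rewrite /thC sigoK; apply: imP => //.
exact: chamber_ts.
Qed.

(** [imgC] leaves the matching of types open; dimension settles it below [n - 2], the class of the
    image on the last two nodes. *)
Lemma imgC_uniq C D : chamber C -> imgC th C D -> D = thC C.
Proof.
move=> cC [cD h]; apply: functional_extensionality => j.
have [k hk] := h (sigo sw j); have tC : ts (C (sigo sw j)) := chamber_ts cC.
have e := im_uniq hth tC hk; rewrite /thC -e; congr D; apply: val_inj.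
have := dim_im hth tC; rewrite -e !chamber_dim //=.
have hj := ltn_ord j; have hk' := ltn_ord k.
have [lt|le] := ltnP j (n - 2); first by rewrite sigma_small // lt; case: ifP; lia.
have [|s1 s2] := @sigma_big sw j; first by rewrite le.
rewrite [(sigma sw j < _)%N]ltnNge s1 /=; case: ltnP => [|hk2 _]; first lia.
have ck := chamber_cls cD hk2.
rewrite e hsw // in ck; last by rewrite chamber_dim //= ltnNge s1.
rewrite (chamber_cls cC) //= s2 -addbA addbb addbF in ck.
move: ck; have [->|h1] := eqVneq (nat_of_ord j) (n - 2)%N; first by move/esym/eqP.
by move/esym/negbT => h2; lia.
Qed.

Lemma thC_adj C D (i : nat) : chamber C -> chamber D -> adj i C D ->
  adj (sigma sw i) (thC C) (thC D).
Proof.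
move=> cC cD [hi [hj [i0 [ei ne]]]]; split; first exact: sigma_lt.
split.
  move=> j hjs; rewrite /thC hj // => e; apply: hjs.
  by rewrite -e /= sigmaK.
exists (sigo sw i0); split; first by rewrite /= -[nat_of_ord i0]/(val i0) ei.
rewrite /thC sigoK => e; apply: ne; apply: (im_inj hth) e; exact: chamber_ts.
Qed.

Lemma thC_galleryP C cs u : chamber C -> galleryP C cs u ->
  galleryP (thC C) (map thC cs) (map (sigma sw) u).
Proof.
elim: cs C u => [|D cs IH] C [|i u] //= cC [h1 [cD h2]].
by split; [exact: thC_adj|split; [exact: thC_chamber|exact: IH]].
Qed.

Lemma thC_gallery C D u : gallery C D u -> gallery (thC C) (thC D) (map (sigma sw) u).
Proof.
move=> [cC [cs [g e]]]; split; first exact: thC_chamber.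
by exists (map thC cs); split; [exact: thC_galleryP|rewrite last_map e].
Qed.

End Action.

Section Companion.
Variable th : sub -> sub.
Hypothesis hth : collineation th.
Variable sw : bool.
Hypothesis hsw : forall M, ts M -> \dim M = n -> cls_low (im th M) = cls_low M (+) sw.

Lemma thi_cls M : ts M -> \dim M = n -> cls_low (im (thi th) M) = cls_low M (+) sw.
Proof.
move=> tM dM; have [U tU e] := im_surj hth tM; rewrite -e im_thiK //.
have dU : \dim U = n by rewrite -(dim_im hth tU) e.
by rewrite hsw // -addbA addbb addbF.
Qed.

Lemma thiC C : chamber C -> thC (thi th) sw (thC th sw C) = C.
Proof.
move=> cC; apply: functional_extensionality => i; rewrite /thC sigoK.
by rewrite im_thiK //; exact: chamber_ts.
Qed.

Lemma companion_th : companion th sw.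
Proof.
move=> C D C' D' u cC cD hC hD [g m].
rewrite (imgC_uniq hth hsw cC hC) (imgC_uniq hth hsw cD hD).
exists (map (sigma sw) u); split=> //; split; first exact: thC_gallery.
move=> u' g'; rewrite size_map.
have := thC_gallery (collineation_thi hth) thi_cls g'.
by rewrite !thiC // => /m; rewrite size_map.
Qed.

End Companion.
End Chambers.

(** * The Weyl distance between a chamber and its image *)

Section Displacement.
Variables (K : fieldType) (n : nat).
Hypothesis hn : (4 <= n)%N.
Notation V := 'rV[K]_(n + n).
Notation sub := {vspace V}.
Notation sgen := (sgen n).
Notation weval := (weval n).
Notation wordW := (wordW n).
Notation Jset := (Jset n).
Notation isframe := (@isframe K n).
Notation Sp := (@Sp K n).
Notation fl := (@fl K n).
Notation Rel := (@Rel K n).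
Implicit Types (x y z : nat * bool) (p q v : V) (U W M N : sub).
Implicit Types (C D : 'I_n -> sub) (u : seq nat).
Variable th : sub -> sub.
Hypothesis hth : collineation th.
Notation tau := (tau th).
Notation im := (im th).
Notation fixv := (fixv th).
Variable sw : bool.
Hypothesis hsw : forall M, ts M -> \dim M = n -> cls_low (im M) = cls_low M (+) sw.
Notation thC := (thC hn th sw).

Section OneChamber.
Variables (a : nat * bool -> V) (u : seq nat).
Hypotheses (fa : isframe a) (ca : chamber (fl a)) (wu : wordW u).
Hypothesis hD : thC (fl a) = fl (fun x => a (weval u x)).

(* Exchanging the last two nodes is the sign change of the last coordinate. *)
Definition tw x := if sw && (x.1 == n - 1)%N then flip x else x.
Definition wt x := weval u (tw x).
Definition bt x : V := a (wt x).

Lemma twK : involutive tw.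
Proof.
move=> x; rewrite /tw; have [h|h] := boolP (sw && (x.1 == n - 1)%N).
  by rewrite /= h flipK.
by rewrite (negPf h).
Qed.
Lemma tw_flip x : tw (flip x) = flip (tw x).
Proof. by rewrite /tw /=; case: ifP. Qed.
Lemma tw1 x : (tw x).1 = x.1.
Proof. by rewrite /tw; case: ifP. Qed.
Lemma wt_flip x : wt (flip x) = flip (wt x).
Proof. by rewrite /wt tw_flip weval_flip. Qed.
Lemma wt_inj : injective wt.
Proof. exact: inj_comp (@weval_inj n hn u) (inv_inj twK). Qed.
Lemma wt_lt x : ((wt x).1 < n)%N = (x.1 < n)%N.
Proof. by rewrite /wt weval_lt // tw1. Qed.
Lemma wt_surj x : (x.1 < n)%N -> exists2 y, (y.1 < n)%N & wt y = x.
Proof.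
move=> hx; exists (tw (weval (rev u) x)); first by rewrite tw1 weval_lt.
by rewrite /wt twK weval_Krev.
Qed.
Lemma wt_abs k d : (wt (k, d)).1 = (weval u (k, false)).1.
Proof.
rewrite /wt /tw; case: ifP => _; case: d => //; rewrite ?weval_flip //.
by rewrite -[(k, true)]/(flip (k, false)) weval_flip.
Qed.

Lemma bt_frame : isframe bt.
Proof.
move=> x y hx hy; rewrite /bt (frame_B fa) ?wt_lt //; split.
  by case: (frame_sv fa (x := wt x)); rewrite ?wt_lt.
by rewrite -wt_flip (inj_eq wt_inj).
Qed.

Lemma ord_im (k : nat) (hk : (k < n)%N) : im (Sp a (Jset k)) =
  Sp (fun x => a (weval u x)) (Jset (sigma n sw k)).
Proof.
have := congr1 (fun f => f (sigo hn sw (Ordinal hk))) hD.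
by rewrite /(thC _) sigoK.
Qed.

(** When [sw] holds, [Aset n] is mapped to the vertex [n - 2] of the image chamber; the twist [tw]
    of the last index makes that vertex an [Aset n] again. *)
Lemma im_flag k : (k <= n)%N -> im (Sp a (Aset k)) = Sp bt (Aset k).
Proof.
move=> hk; have n2 : (n - 2 < n)%N by clear -hn; lia.
have n1 : (n - 1 < n)%N by clear -hn; lia.
have agree j : (j <= n - 1)%N ->
    Sp (fun x => a (weval u x)) (Aset j) = Sp bt (Aset j).
  move=> hj; apply: eq_Sp_frame => x hx /andP[_ xj]; rewrite /bt /wt /tw ifF //.
  by apply/negP => /andP[_ /eqP e]; move: xj; rewrite e ltnNge hj.
have n12 : (n - 1 == n - 2)%N = false by apply/negP => /eqP; clear -hn; lia.
have fw := frame_weval hn fa u.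
have [->|k0] := posnP k.
  have z c : isframe c -> Sp c (Aset 0) = 0%VS.
    by move=> fc; apply/eqP; rewrite -dimv_eq0 (dim_Aset fc).
  by rewrite z // z ?im0 //; exact: bt_frame.
have [lt|le] := ltnP k.-1 (n - 2).
  have e c : Sp c (Aset k) = Sp c (Jset k.-1).
    by apply: eq_Sp => x _; rewrite Jset_small // prednK.
  have k1 : (k.-1 < n)%N by rewrite prednK.
  rewrite e (ord_im k1) sigma_small // -e agree //.
  by clear -lt k0; lia.
have [->|->] : k = (n - 1)%N \/ k = n by clear -le hk k0; lia.
  rewrite -agree // Aset_cap // im_cap //; try exact: (ts_Jset hn fa).
  rewrite (ord_im n2) (ord_im n1) Aset_cap // /sigma eqxx n12.
  by case: sw; rewrite ?eqxx // capvC.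
rewrite Aset_max // (ord_im n1) /sigma n12 eqxx.
have [e|/negPf e] := boolP sw; last first.
  rewrite -Aset_max //; apply: eq_Sp_frame => x hx _.
  by rewrite /bt /wt /tw e.
apply/eqP; rewrite eqEdim (dim_Aset bt_frame) // (dim_Jset hn fw n2) ltnn leqnn andbT.
apply: Sp_sub => x hx; rewrite Jset_low => Jx.
have -> : a (weval u x) = bt (tw x) by rewrite /bt /wt twK.
apply: mem_Sp; first by rewrite tw1.
rewrite /Aset tw1 hx andbT /tw e /=; move: Jx; case: x hx => l [] /= hx.
  by move/eqP => ->; rewrite eqxx.
by rewrite orbF => lt; rewrite ifF //; apply/negP => /eqP e2; rewrite e2 ltnn in lt.
Qed.

Notation abs k := (weval u (k, false)).1.

Lemma im_Aset (k : nat) v : (k <= n)%N -> sv v ->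
  (tau v \in Sp bt (Aset k)) = (v \in Sp a (Aset k)).
Proof. by move=> hk svv; rewrite -im_flag // mem_im //; exact: ts_Aset. Qed.

Lemma Aset_btP k x : (x.1 < n)%N -> (a x \in Sp bt (Aset k)) ->
  exists2 i, (i < k)%N & wt (i, false) = x.
Proof.
move=> hx; have [y hy <-] := wt_surj hx.
rewrite -[a (wt y)]/(bt y) (mem_SpE bt_frame) // /Aset.
by case: y hy => i [] //= _ h; exists i.
Qed.

(** If [a (j, false)] is fixed, it lies in the image flag; if it is opposite to its image, that
    image has a nonzero coordinate at the index sent to [(j, true)]. Either way an index below [k]
    is sent to [j] up to sign; letting [k] grow, [abs] is the identity. *)
Lemma fix_or_opp_sub (k j : nat) : fix_or_opp th -> (j < k <= n)%N ->
  exists2 i, (i < k)%N & abs i = j.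
Proof.
move=> h /andP[jk kn]; have hj : (j < n)%N by apply: leq_trans kn.
have se := frame_sv fa (x := (j, false)) hj.
have eA : a (j, false) \in Sp a (Aset k) by apply: mem_Sp.
have [f|nf] := h _ se.
  have : a (j, false) \in Sp bt (Aset k).
    by rewrite -im_flag // fix_im //; exact: ts_Aset.
  by case/(Aset_btP (x := (j, false)) hj) => i hi e; exists i; rewrite // -(wt_abs i false) e.
have [y hy ey] := wt_surj (x := (j, true)) hj.
have : Aset k y.
  apply/negPn/negP => Ay; case/negP: nf; rewrite BfC; apply/eqP.
  have : tau (a (j, false)) \in Sp bt (Aset k) by rewrite im_Aset.
  by move/(SpP bt_frame)/(_ y hy Ay); rewrite /bt wt_flip ey.
case: y hy ey => i [] //= hi ey; rewrite /Aset /= => ik.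
by exists i; rewrite // -(wt_abs i false) ey.
Qed.

Lemma fix_or_opp_abs (k : nat) : fix_or_opp th -> (k < n)%N -> abs k = k.
Proof.
move=> h; have [m] := ubnP k; elim: m k => // m IH k km hk.
have [i ik e] := @fix_or_opp_sub k.+1 k h ltac:(by rewrite ltnSn hk).
move: ik; rewrite ltnS leq_eqVlt => /orP[/eqP ik|ik]; first by rewrite ik in e.
have : abs i = i by apply: IH; [exact: leq_trans ik _|exact: ltn_trans hk].
by rewrite e => e2; move: ik; rewrite -e2 ltnn.
Qed.

(** A positive sign would put [a (k, false)] into the image of [Aset k.+1] as well, and its preimage
    would be orthogonal to it. *)
Lemma opp_wt (k : nat) : (forall v, sv v -> Bf v (tau v) != 0) -> (k < n)%N ->
  wt (k, false) = (k, true).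
Proof.
move=> h hk.
have fo : fix_or_opp th by move=> x sx; right; exact: h.
have e1 : (wt (k, false)).1 = k by rewrite wt_abs fix_or_opp_abs.
case e : (wt (k, false)) e1 => [k' []] /= ek; rewrite ek // in e *.
have eA : a (k, false) \in im (Sp a (Aset k.+1)).
  rewrite im_flag // -e; apply: (@mem_Sp K n bt (Aset k.+1) (k, false)) => //.
  by rewrite /Aset /= ltnSn.
have se := frame_sv fa (x := (k, false)) hk.
have [y [sy yA hy]] := mem_im' hth (ts_Aset fa (m := k.+1)) se eA.
have /vlineP[d td] := line_sym (proj2 se) hy.
case/negP: (h y sy); rewrite td BfZr (ts_orth (ts_Aset fa (m := k.+1))) ?mulr0 //.
by apply: mem_Sp; rewrite // /Aset /= ltnSn.
Qed.

(** * The displacement of a chamber in the spread case *)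

Section SpreadLike.
Hypothesis hS : spread_like th.

Lemma sp_orth (x : V) : sv x -> Bf x (tau x) = 0. Proof. by case/hS. Qed.

(* [Bf x (tau y)] behaves as an alternating form on a singular subspace. *)
Lemma sp_sym (x y : V) : sv x -> sv y -> Bf x y = 0 -> Bf x (tau y) = 0 -> Bf y (tau x) = 0.
Proof.
move=> sx sy o xy; have [yx|ni] := boolP (y \in <[x]>%VS).
  by case/vlineP: yx => c ->; rewrite BfZl sp_orth ?mulr0.
have hL := line2 sx sy o ni.
have mL : x + y \in (<[x]> + <[y]>)%VS by rewrite memvD ?mem2l ?mem2r.
have m0 : x + y != 0.
  apply: contraNneq ni => /eqP; rewrite addrC addr_eq0 => /eqP ->.
  by rewrite memvN memv_line.
have sm := svP hL.1 mL m0.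
have : tau (x + y) \in (<[tau x]> + <[tau y]>)%VS.
  by rewrite -(im2 hth sx sy o ni) mem_im //; case: hL.
case/mem2P => c [d e]; apply/eqP/negPn/negP => yx.
have : Bf (x + y) (tau (x + y)) = 0 by exact: sp_orth.
rewrite e !BfE (sp_orth sx) (sp_orth sy) xy !mulr0 !addr0 ?add0r => /eqP.
rewrite mulf_eq0 (negPf yx) orbF => /eqP c0.
have : tau (x + y) \in <[tau y]>%VS by rewrite e c0 scale0r add0r memvZ ?memv_line.
move/(tau_inj hth sy sm)/vlineP => [f ef]; case/negP: ni.
apply: (line_sym (proj2 sx)); apply/vlineP; exists (f - 1).
by rewrite scalerBl scale1r -ef addrK.
Qed.

Lemma sp_preimage (k l : nat) d : (k < n)%N -> (l < n)%N -> wt (k, false) = (l, d) ->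
  exists y : V, [/\ sv y, y \in Sp a (Aset k.+1), y \notin Sp a (Aset k),
    a (l, d) \in <[tau y]>%VS & tau y \in <[a (l, d)]>%VS].
Proof.
move=> hk hl e; have se := frame_sv fa (x := (l, d)) hl.
have eA : a (l, d) \in im (Sp a (Aset k.+1)).
  rewrite im_flag // -e; apply: (@mem_Sp K n bt (Aset k.+1) (k, false)) => //.
  by rewrite /Aset /= ltnSn.
have [y [sy yA hy]] := mem_im' hth (ts_Aset fa (m := k.+1)) se eA.
have ty := line_sym (proj2 se) hy.
exists y; split=> //; apply/negP => yA2.
have : a (l, d) \in Sp bt (Aset k).
  rewrite -im_flag ?(ltnW hk) //.
  apply: (subvP (_ : <[tau y]> <= im (Sp a (Aset k)))%VS) => //.
  by rewrite -memvE mem_im //; exact: ts_Aset.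
rewrite -e -[a _]/(bt (k, false)) (mem_SpE bt_frame) // /Aset /=.
by rewrite ltnn.
Qed.

Lemma coordA (k : nat) v : (k < n)%N -> v \in Sp a (Aset k.+1) -> v \notin Sp a (Aset k) ->
  Bf v (a (k, true)) != 0.
Proof.
move=> hk h1 h2; apply: (Sp_coord fa (z := (k, false)) hk h1 _ h2) => -[l []] //= _.
by rewrite /Aset /= xpair_eqE andbT ltnS leq_eqVlt orbC.
Qed.

Lemma coordB (k : nat) v : (k < n)%N -> v \in Sp bt (Aset k.+1) ->
  v \notin Sp bt (Aset k) -> Bf v (a (flip (wt (k, false)))) != 0.
Proof.
move=> hk h1 h2; rewrite -wt_flip -[a _]/(bt _).
apply: (Sp_coord bt_frame (z := (k, false)) hk h1 _ h2) => -[l []] //= _.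
by rewrite /Aset /= xpair_eqE andbT ltnS leq_eqVlt orbC.
Qed.

Lemma tau_basis_coord (k : nat) : (k < n)%N ->
  Bf (tau (a (k, false))) (a (flip (wt (k, false)))) != 0.
Proof.
move=> hk; have se := frame_sv fa (x := (k, false)) hk.
apply: coordB => //; rewrite im_Aset ?(ltnW hk) //.
  by apply: mem_Sp => //; rewrite /Aset /= ltnSn.
by rewrite (mem_SpE fa) // /Aset /= ltnn.
Qed.

(** A negative sign makes [a (k, false)] non-orthogonal to its image. For a positive sign, the
    invariant line of the preimage [y] meets [Aset k] in a point [z] whose image is in [Aset k] too;
    so the line lies in [Aset k], although [y] does not. *)
Lemma sp_abs_neq (k : nat) : (k < n)%N -> (wt (k, false)).1 != k.
Proof.
move=> hk; apply/eqP; case e : (wt (k, false)) => [l d] /= el; subst l.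
have se := frame_sv fa (x := (k, false)) hk.
case: d e => e.
  have := tau_basis_coord hk; rewrite e /flip /= BfC sp_orth ?eqxx //.
have [y [sy yA yA' ey ty]] := sp_preimage hk hk e.
have [oy nfy iL] := hS sy; have sty := tau_sv hth sy.
have [tL dL] := line2 sy sty oy nfy.
have eL : a (k, false) \in (<[y]> + <[tau y]>)%VS.
  by apply: (subvP (addvSr _ _)).
have eA : a (k, false) \in Sp a (Aset k.+1) by apply: mem_Sp => //; rewrite /Aset /= ltnSn.
pose c := Bf y (a (k, true)).
pose z := y - c *: a (k, false).
have zA : z \in Sp a (Aset k).
  apply/(SpP fa) => -[l d] hl Al; rewrite /z BfBl BfZl (frame_Bflip fa) //=.
  have [<-|ne] := eqVneq (k, false) (l, d); first by rewrite mulr1 /c /flip /= subrr.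
  rewrite mulr0 subr0; move/(SpP fa): yA => -> //.
  apply: contra Al; rewrite /Aset ltnS leq_eqVlt /= => /andP[dl /orP[/eqP elk|->]].
    by case/negP: ne; rewrite elk; case: (d) dl.
  by rewrite dl.
have zL : z \in (<[y]> + <[tau y]>)%VS by rewrite memvB ?memvZ // mem2l.
have z0 : z != 0.
  rewrite subr_eq0; apply: contra nfy => /eqP ey2; rewrite /(fixv _).
  by apply: (line_sym (proj2 sy)); rewrite [X in X \in _]ey2 memvZ.
have sz := svP tL zL z0; have [_ nfz _] := hS sz.
have tzL : tau z \in (<[y]> + <[tau y]>)%VS by rewrite -iL mem_im.
have LA : (<[y]> + <[tau y]> <= Sp a (Aset k.+1))%VS.
  by apply: sub2 => //; apply: (subvP _ _ ty); rewrite -memvE.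
have tzA : tau z \in Sp a (Aset k).
  have tzB : tau z \in Sp bt (Aset k) by rewrite im_Aset // ltnW.
  apply/negPn/negP => nA; have := coordA hk (subvP LA _ tzL) nA.
  have := (SpP bt_frame _ _ tzB) (k, false) hk.
  rewrite /bt wt_flip e /Aset /= ltnn => /(_ isT) ->.
  by rewrite eqxx.
case/negP: yA'; apply: (subvP (_ : <[y]> + <[tau y]> <= _)%VS); last exact: mem2l.
by rewrite (dim2_eq dL zL tzL z0 nfz) sub2.
Qed.

(** By [sp_sym], the preimage [y] of [a (l, true)] is orthogonal to the image of [Aset l] but not to
    that of [a (l, false)], hence not to [bt (l, false)]. As [y] lies in [Aset k.+1], this locates
    [wt (l, false)]. *)
Lemma sp_neg_le (k l : nat) : (k < n)%N -> wt (k, false) = (l, true) ->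
  exists2 j, (j <= k)%N & wt (l, false) = (j, true).
Proof.
move=> hk e; have hl : (l < n)%N by rewrite -[l]/((l, true).1) -e wt_lt.
have [y [sy yA yA' ey ty]] := sp_preimage hk hl e.
have se := frame_sv fa (x := (l, false)) hl.
have tn : ts (Sp a (Aset n)) := ts_Aset fa (m := n).
have yn : y \in Sp a (Aset n) by apply: (subvP (Aset_mono a _)) yA.
have symA (z : V) : sv z -> z \in Sp a (Aset n) -> (Bf z (a (l, true)) = 0) <-> (Bf y (tau z) = 0).
  move=> sz zn; have o : Bf z y = 0 by rewrite (ts_orth tn).
  have /vlineP[c1 e1] := ey; have /vlineP[c2 e2] := ty.
  split=> h; first by apply: sp_sym => //; rewrite e2 BfZr h mulr0.
  by rewrite e1 BfZr (sp_sym sy sz) ?mulr0 // BfC.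
have en : a (l, false) \in Sp a (Aset n) by apply: mem_Sp.
have ye : Bf y (tau (a (l, false))) != 0.
  apply/negP => /eqP /(symA _ se en); rewrite (frame_B fa) // /flip eqxx => /eqP.
  by rewrite oner_eq0.
have tA : tau (a (l, false)) \in Sp bt (Aset l.+1).
  by rewrite im_Aset // mem_Sp // /Aset /= ltnSn.
have yperp : y \in perp (Sp bt (Aset l)).
  apply/perpP => w; have [->|w0] := eqVneq w 0; first by rewrite Bf0l.
  move=> wB; have hl' := ltnW hl; rewrite -(im_flag hl') in wB.
  have tl : ts (Sp a (Aset l)) := ts_Aset fa (m := l); have sw' := svP (im_ts hth tl) wB w0.
  have [z [sz zA /vlineP[c ->]]] := mem_im' hth tl sw' wB.
  rewrite BfZl BfC; have -> : Bf y (tau z) = 0; last by rewrite mulr0.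
  apply/(symA z sz); first by apply: (subvP (Aset_mono a _)) zA.
  by move/(SpP fa): zA => /(_ (l, false) hl); rewrite /Aset /= ltnn; apply.
have yb : Bf y (bt (l, false)) != 0.
  apply: contra ye => /eqP h; move: tA; rewrite (AsetS bt_frame) //.
  case/add_line_mem => c hc.
  rewrite -(subrK (c *: bt (l, false)) (tau _)) BfDr BfZr h mulr0 addr0.
  by rewrite (perp_mem' yperp).
have hwl : ((wt (l, false)).1 < n)%N by rewrite wt_lt.
have : Aset k.+1 (flip (wt (l, false))).
  apply/negPn/negP => nA; case/negP: yb; move/(SpP fa): yA => /(_ (flip (wt (l, false))) hwl nA).
  by rewrite flipK /bt => ->.
rewrite /Aset; case: (wt (l, false)) => j [] //=; rewrite ltnS => jk.
by exists j.
Qed.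

(** Two uses of [sp_neg_le] give [j <= k] and then [i <= l]; if [j < k], the induction hypothesis at
    [j] and injectivity of [wt] give [i = l] and then [j = k]. *)
Lemma sp_neg (k l : nat) : (k < n)%N -> wt (k, false) = (l, true) ->
  wt (l, false) = (k, true).
Proof.
have [m] := ubnP k; elim: m k l => // m IH k l km hk e.
have hl : (l < n)%N by rewrite -[l]/((l, true).1) -e wt_lt.
have [j jk ej] := sp_neg_le hk e.
move: jk; rewrite leq_eqVlt => /orP[/eqP <- //|jk].
have [i il ei] := sp_neg_le hl ej.
have hj := ltn_trans jk hk.
have := IH j i (leq_trans jk km) hj ei; rewrite -ej => /wt_inj[eil].
by move: ei; rewrite eil -e => /wt_inj[ekj]; rewrite ekj ltnn in jk.
Qed.

(** The image of [a (l, false)] is on the invariant line through [y], off [a (l, false)] itself, so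
    it inherits from [y] a nonzero coordinate at [(k, false)]. *)
Lemma sp_pos_le (k l : nat) : (k < n)%N -> wt (k, false) = (l, false) ->
  exists2 i, (i <= l)%N & wt (i, false) = (k, false).
Proof.
move=> hk e; have hl : (l < n)%N by rewrite -[l]/((l, false).1) -e wt_lt.
have [y [sy yA yA' ey ty]] := sp_preimage hk hl e.
have [oy nfy iL] := hS sy; have sty := tau_sv hth sy.
have [tL dL] := line2 sy sty oy nfy.
have se := frame_sv fa (x := (l, false)) hl.
have eL : a (l, false) \in (<[y]> + <[tau y]>)%VS by apply: (subvP (addvSr _ _)).
have ne : y \notin <[a (l, false)]>%VS.
  by apply: contra nfy; rewrite (line_eqP (proj2 se) ey) => h; exact: (line_sym (proj2 sy) h).
have teL : tau (a (l, false)) \in (<[a (l, false)]> + <[y]>)%VS.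
  have := dim2_eq dL eL (mem2l _ _) (proj2 se) ne => <-.
  by rewrite -iL mem_im.
have [c [d ete]] := mem2P _ _ _ teL.
have [_ nfe _] := hS se.
have d0 : d != 0.
  apply: contra nfe => /eqP d0; rewrite /(fixv _) ete d0 scale0r addr0.
  by rewrite memvZ // memv_line.
have lk : l != k by have := sp_abs_neq hk; rewrite e.
have co : Bf (tau (a (l, false))) (a (k, true)) != 0.
  rewrite ete BfDl !BfZl (frame_B fa) // /flip xpair_eqE /= [k == l]eq_sym (negPf lk) mulr0 add0r.
  by rewrite mulf_neq0 // coordA.
have tA : tau (a (l, false)) \in Sp bt (Aset l.+1).
  by rewrite im_Aset // mem_Sp // /Aset /= ltnSn.
have [x hx ex] := wt_surj (x := (k, false)) hk.
have : Aset l.+1 x.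
  apply/negPn/negP => nA; case/negP: co; move/(SpP bt_frame): tA => /(_ x hx nA).
  by rewrite /bt wt_flip ex => ->.
rewrite /Aset; case: x hx ex => i [] //= _ ex; rewrite ltnS => il.
by exists i.
Qed.

Lemma sp_pos (k l : nat) : (k < n)%N -> wt (k, false) = (l, false) ->
  wt (l, false) = (k, false).
Proof.
have [m] := ubnP l; elim: m k l => // m IH k l lm hk e.
have [i il ei] := sp_pos_le hk e.
move: il; rewrite leq_eqVlt => /orP[/eqP <- //|il].
have hl : (l < n)%N by rewrite -[l]/((l, false).1) -e wt_lt.
have hi := ltn_trans il hl.
have [j jk ej] := sp_pos_le hi ei.
have hj : (j < n)%N by exact: leq_ltn_trans jk hk.
have := IH j i (leq_trans il lm) hj ej; rewrite ei => -[ekj].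
by move: ej; rewrite -ekj e => -[eli]; rewrite eli ltnn in il.
Qed.

Lemma spread_like_abs (k : nat) : (k < n)%N -> abs (abs k) = k /\ abs k != k.
Proof.
move=> hk; rewrite -(wt_abs k false); split; last exact: sp_abs_neq.
rewrite -(wt_abs _ false); case e : (wt (k, false)) => [l []] /=.
  by rewrite (sp_neg hk e).
by rewrite (sp_pos hk e).
Qed.

End SpreadLike.
End OneChamber.

Definition uniform := fix_or_opp th \/ spread_like th.

Lemma Rel_flat C u : uniform -> chamber C -> Rel C (thC C) u ->
  (fix_or_opp th -> forall k, (k < n)%N -> (weval u (k, false)).1 = k) /\
  (spread_like th ->
   forall k, (k < n)%N -> (weval u ((weval u (k, false)).1, false)).1 = k /\
                          (weval u (k, false)).1 != k).
Proof.
move=> un cC [wu [a [fa eC eD]]]; rewrite eC in cC eD.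
split=> h k hk; first exact: (fix_or_opp_abs fa eD).
exact: (spread_like_abs fa eD).
Qed.

Lemma sgen_abs i k d : (sgen i (k, d)).1 = (sgen i (k, false)).1.
Proof.
by case: d => //; rewrite -[(k, true)]/(flip (k, false)) sgen_flip.
Qed.

Lemma weval_abs u k d : (weval u (k, d)).1 = (weval u (k, false)).1.
Proof.
by case: d => //; rewrite -[(k, true)]/(flip (k, false)) weval_flip.
Qed.

Lemma abs_cons i u k : (weval (i :: u) (k, false)).1 = (sgen i ((weval u (k, false)).1, false)).1.
Proof. by rewrite /= -(sgen_abs _ _ (weval u (k, false)).2) -surjective_pairing. Qed.

Lemma abs_rcons i u k : (weval (rcons u i) (k, false)).1 =
  (weval u ((sgen i (k, false)).1, false)).1.
Proof.
by rewrite weval_rcons -[in RHS](weval_abs _ _ (sgen i (k, false)).2) -surjective_pairing.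
Qed.

Lemma sgen_swap i : (i < n)%N -> exists p q : nat, [/\ (p < n)%N, (q < n)%N, p != q &
  [/\ (sgen i (p, false)).1 = q, (sgen i (q, false)).1 = p &
   forall k, k != p -> k != q -> (sgen i (k, false)).1 = k]].
Proof.
move=> hi; have [h|h] := ltnP i.+1 n.
  exists i, i.+1; split=> //; first by rewrite neq_ltn ltnSn.
  have ii : (i.+1 == i)%N = false by apply/negP => /eqP; clear; lia.
  by split=> [||k /negPf k1 /negPf k2]; rewrite sgenE // h ?eqxx ?ii ?k1 ?k2 ?eqxx.
have n12 : (n - 1 == n - 2)%N = false by apply/negP => /eqP; clear -hn; lia.
exists (n - 2)%N, (n - 1)%N; split; try (by clear -hn; lia).
by split=> [||k /negPf k1 /negPf k2]; rewrite sgenE // ltnNge h /= ?eqxx ?n12 ?k1 ?k2 ?eqxx.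
Qed.

(** Without signs, [sgen i] is a transposition s of [p] and [q]. If X and sX are both involutions
    they commute with s, so X preserves the pair; having no fixed point, X swaps [p] and [q], and
    then sX fixes [p]. The other side is the same. *)
Lemma odd_step_abs u u' i : uniform -> (i < n)%N ->
  (exists2 C, chamber C & Rel C (thC C) u) -> (exists2 C, chamber C & Rel C (thC C) u') ->
  (forall k, (k < n)%N -> (weval u' (k, false)).1 = (weval (i :: u) (k, false)).1) \/
  (forall k, (k < n)%N -> (weval u' (k, false)).1 = (weval (rcons u i) (k, false)).1) ->
  False.
Proof.
move=> un hi [C cC rC] [D cD rD] h.
have [p [q [hp hq pq [sp sq sk]]]] := sgen_swap hi.
have [f1 g1] := Rel_flat un cC rC; have [f2 g2] := Rel_flat un cD rD.
case: (un) => hy; [have {f1} f1 := f1 hy; have {f2} f2 := f2 hy|].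
  case: h => /(_ p hp); rewrite (f2 p hp).
    by rewrite abs_cons (f1 p hp) sp => /eqP; rewrite (negPf pq).
  by rewrite abs_rcons sp (f1 q hq) => /eqP; rewrite (negPf pq).
have {g1} g1 := g1 hy; have {g2} g2 := g2 hy.
pose X k := (weval u (k, false)).1.
have Xlt k : (k < n)%N -> (X k < n)%N by move=> hk; rewrite weval_lt.
have XX k : (k < n)%N -> X (X k) = k by move=> /g1[].
have Xn k : (k < n)%N -> X k != k by move=> /g1[].
have Xpq : X p = q \/ X p <> q by case: (eqVneq (X p) q); [left|right; apply/eqP].
have Xpp := Xn p hp.
case: h => h.
  have Y k : (k < n)%N -> (weval u' (k, false)).1 = (sgen i (X k, false)).1.
    by move=> hk; rewrite h // abs_cons.
  case: Xpq => e; first by have [_] := g2 p hp; rewrite Y // e sq eqxx.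
  have hXp := Xlt p hp.
  have [e2 _] := g2 (X p) hXp; rewrite (Y _ hXp) XX // sp (Y _ hq) in e2.
  have [eq|nq] := eqVneq (X q) p; first by apply: e; rewrite -eq XX.
  have sX : (sgen i (X q, false)).1 = X q by apply: sk => //; exact: Xn.
  by rewrite sX in e2; move: pq; rewrite -(XX p) // -e2 XX // eqxx.
have Y k : (k < n)%N -> (weval u' (k, false)).1 = X (sgen i (k, false)).1.
  by move=> hk; rewrite h // abs_rcons.
case: Xpq => e.
  by have [_] := g2 p hp; rewrite Y // sp -e XX // eqxx.
have hXp := Xlt p hp.
have [e2 _] := g2 q hq; rewrite (Y _ hq) sq (Y _ hXp) in e2.
rewrite sk // in e2; last exact/eqP.
by rewrite XX // in e2; rewrite e2 eqxx in pq.
Qed.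

Lemma Rel_map C D u i : (i < n)%N -> chamber C -> chamber D -> adj i C D ->
  uniform -> Rel C (thC C) u ->
  Rel D (thC D) u \/ Rel D (thC D) (i :: rcons u (sigma n sw i)).
Proof.
move=> hi cC cD ad un r.
have cC' := thC_chamber hn hth hsw cC; have cD' := thC_chamber hn hth hsw cD.
have ad' := thC_adj hn hth sw cC cD ad; have hs := sigma_lt hn sw hi.
have left_step (g : seq nat) : Rel C (thC D) g -> Rel D (thC D) g \/ Rel D (thC D) (i :: g).
  move=> /(Rel_sym hn) ry; case: (Rel_step hn cC cD ad ry) => /(Rel_sym hn).
    by rewrite revK; left.
  by rewrite rev_rcons revK; right.
have exC : exists2 C, chamber C & Rel C (thC C) u by exists C.
case: (Rel_step hn cC' cD' ad' r) => /left_step[] h; [by left| | |by right].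
  by case: (odd_step_abs (u := u) (u' := i :: u) un hi exC (ex_intro2 _ _ D cD h)); left.
case: (odd_step_abs (u := u) (u' := rcons u (sigma n sw i)) un hs exC (ex_intro2 _ _ D cD h)).
by right.
Qed.

Lemma uniform_uniclass : uniform -> uniclass th.
Proof.
move=> un; exists sw; split; first exact: companion_th.
have [a0 [f0 c0]] := @std_frame K n hn.
have c0' := thC_chamber hn hth hsw c0.
have [w r0] := Rel_exists hn c0 c0'; exists w; split; first by case: r0.
move=> C D u cC hD hu; rewrite (imgC_uniq hn hth hsw cC hD) in hu.
have r := min_gallery_Rel hn hu.
(* Along a gallery from the standard chamber to [C], the word [v] collects the letters by which the
   distance gets conjugated and skips the others. *)
suff [v [hv rv]] : exists v : seq nat, wordW v /\ Rel C (thC C) (rev v ++ w ++ map (sigma n sw) v).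
  by exists v; split=> //; exact: (Rel_uniq hn r rv).
have [g [[_ [cs [hg eC]]] _]] := min_gallery_exists hn c0 cC; rewrite -eC.
clear u hu r hD D; clear C cC eC.
have : exists v : seq nat, wordW v /\ Rel (fl a0) (thC (fl a0)) (rev v ++ w ++ map (sigma n sw) v).
  by exists [::]; rewrite /= cats0.
elim: cs g (fl a0) c0 hg => [|D cs IH] [|i g] C0 //= cC [ad [cD hg]] [v [hv r]].
have hi : (i < n)%N by case: ad.
apply: (IH g D cD hg); case: (Rel_map hi cC cD ad un r) => h; first by exists v.
exists (rcons v i); split; first by rewrite /Pilot.Defs.wordW all_rcons hi.
by rewrite rev_rcons map_rcons /= -!rcons_cat.
Qed.

End Displacement.

(** * Anisotropic collineations *)

Section Anisotropic.
Variables (K : fieldType) (n : nat).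
Hypothesis hn : (4 <= n)%N.
Notation V := 'rV[K]_(n + n).
Notation sub := {vspace V}.
Notation weval := (weval n).
Notation Jset := (Jset n).
Notation isframe := (@isframe K n).
Notation Sp := (@Sp K n).
Notation fl := (@fl K n).
Implicit Types (p q v : V) (L U W M N : sub) (C D : 'I_n -> sub) (u : seq nat).
Variable th : sub -> sub.
Hypothesis hth : collineation th.
Notation tau := (tau th).
Notation im := (im th).
Variable sw : bool.
Hypothesis hsw : forall M, ts M -> \dim M = n -> cls_low (im M) = cls_low M (+) sw.
Notation thC := (thC hn th sw).

Lemma opp_anisotropic : (forall v, sv v -> Bf v (tau v) != 0) -> anisotropic th.
Proof.
move=> h C D cC hD; rewrite (imgC_uniq hn hth hsw cC hD).
have cD := thC_chamber hn hth hsw cC.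
have [g mg] := min_gallery_exists hn cC cD; have [wg [a [fa eC eD]]] := min_gallery_Rel hn mg.
exists g; split=> //; rewrite eC in cC eD.
(* [M0] meets its image trivially, so parity decides whether classes are swapped. The twist [tw]
   then accounts for the last coordinate that [w0f] leaves alone when [n] is odd. *)
have odd_sw : sw = odd n.
  have tM := @M0_ts K n; have dM := M0_dim K n; have tI := im_ts hth tM.
  have dI : \dim (im (M0 K n)) = n by rewrite dim_im.
  have := cls_dim tM tI dM dI; rewrite (hsw tM dM).
  have -> : (M0 K n :&: im (M0 K n) = 0)%VS.
    apply/eqP/negPn/negP => /cap_pick[x [xM xI x0]]; have sx := svP tM xM x0.
    by case/negP: (h x sx); rewrite (ts_orth tI xI) // mem_im.
  by rewrite dimv0; case: sw; case: (odd n); case: (cls_low _).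
have key k : (k < n)%N -> wt n sw g (k, false) = (k, true).
  by move=> hk; exact: (opp_wt hth fa eD h hk).
have key' k d : (k < n)%N -> wt n sw g (k, d) = (k, ~~ d).
  move=> hk; case: d; last exact: key.
  by rewrite -[(k, true)]/(flip (k, false)) wt_flip key.
move=> k b hk; rewrite /w0f -odd_sw.
have := key' k b hk; have := key' k (~~ b) hk.
rewrite /wt /tw /flip /= negbK; by case: (sw && _).
Qed.

Lemma line_frame L p : is_line L -> sv p -> p \in L -> exists c,
  [/\ isframe c, chamber (fl c), Sp c (Aset 1) = <[p]>%VS & Sp c (Aset 2) = L].
Proof.
move=> [tL dL] sp pL; have [a0 [f0 c0]] := @std_frame K n hn.
pose G (j : nat) : sub := if j is j'.+1 then (if j' is 0%N then <[p]>%VS else L) else 0%VS.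
have p0 : p != 0 by case: sp.
have n2 : (2 <= n - 1)%N by lia.
have [| |a [u [fa wu ea hG]]] := flag_frame (G := G) (m := 2) hn f0 n2.
- case=> [|[|[|j]]] // _; first by rewrite /= dimv0; split=> //; exact: ts0.
  by rewrite /= dim_vline p0; split=> //; exact: ts_line sp.1.
- by case=> [|[|j]] // _; rewrite /= ?sub0v // -memvE.
exists (fun x => a (weval u x)); split.
- exact: frame_weval.
- by apply: fl_weval_chamber; rewrite ?ea.
- exact: (hG 1%N).
- exact: (hG 2%N).
Qed.

Lemma thC_Aset C (b : nat * bool -> V) (k : nat) (a : nat * bool -> V) :
  (k < n - 2)%N -> C = fl a -> thC C = fl b -> im (Sp a (Aset k.+1)) = Sp b (Aset k.+1).
Proof.
move=> hk -> e; have hk' : (k < n)%N by lia.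
have z c : Sp c (Aset k.+1) = Sp c (Jset k) by apply: eq_Sp => x _; rewrite Jset_small.
have := congr1 (fun f => f (Ordinal hk')) e; rewrite /(thC _) /fl /= => e2.
by rewrite !z -e2 sigma_small.
Qed.

(** As [n] is at least 4, [w0f] flips the indices 0 and 1, so [L] and its image are in perfect
    pairing and [L :&: perp (im L)] is zero, which voids both clauses. *)
Lemma anisotropic_kang : anisotropic th -> kang th.
Proof.
move=> h L hL; have [x sx xL] := line_pick hL; have [tL dL] := hL.
have [c [fc cc _ eL]] := line_frame hL sx xL.
have [u [mg ew]] := h _ _ cc (thC_img hn hth hsw cc).
have [wu [a [fa eC eD]]] := min_gallery_Rel hn mg.
have n2 : (1 < n - 2)%N by lia.
have n2' : (2 <= n)%N by lia.
have iL := thC_Aset n2 eC eD.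
have eLa : L = Sp a (Aset 2) by rewrite -eL; apply: fl_Aset.
rewrite -eLa in iL.
have L0 : (L :&: perp (im L) = 0)%VS.
  apply/eqP/negPn/negP => /cap_pick[v [vL vP v0]]; case/negP: v0; apply/eqP.
  apply: (frame_nondeg fa) => -[k d] /= hk; rewrite eLa in vL.
  have [/andP[dk k2]|nA] := boolP (Aset 2 (k, ~~ d)); last first.
    by move/(SpP fa): vL => /(_ (k, ~~ d) hk nA); rewrite /flip /= negbK.
  have ed : d = true by move: dk; rewrite /= negbK.
  rewrite ed; have : a (k, true) \in im L.
    have -> : (k, true) = weval u (k, false).
      rewrite ew // /w0f ifF //; apply/negP => /andP[_ /eqP e].
      by move: k2; rewrite /= e; clear -hn; lia.
    by rewrite iL; apply: (@mem_Sp K n (fun x => a (weval u x)) (Aset 2) (k, false)).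
  exact: perp_mem'.
split=> [LP|_]; last by rewrite L0 eqxx.
by move: dL; rewrite -(capv_idPl LP) L0 dimv0.
Qed.

End Anisotropic.

(** * Uniclass collineations *)

Section Parity.
Variable n : nat.
Hypothesis hn : (4 <= n)%N.

(** Without signs every generator, the last one included, is a transposition, so the sign of the
    permutation records the parity of the length. *)
Lemma word_perm (u : seq nat) : wordW n u -> exists2 s : 'S_n,
  (forall k : 'I_n, val (s k) = (weval n u (val k, false)).1) &
  odd_perm s = odd (size u).
Proof.
elim: u => [_|i u IH /= /andP[hi hu]].
  by exists 1%g; [move=> k; rewrite perm1|rewrite odd_perm1].
have [s hs os] := IH hu.
have [p [q [hp hq pq [sp sq sk]]]] := sgen_swap hn hi.
exists (s * tperm (Ordinal hp) (Ordinal hq))%g; last first.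
  by rewrite odd_permM os odd_tperm -val_eqE /= pq addbT.
move=> k; rewrite permM; have := abs_cons n i u (val k); rewrite /= -hs => ->.
case: tpermP => [->|->|/eqP h1 /eqP h2] //=.
by rewrite sk // -val_eqE.
Qed.

Lemma weq_odd u u' : wordW n u -> wordW n u' -> weq n u u' -> odd (size u) = odd (size u').
Proof.
move=> hu hu' e; have [s hs <-] := word_perm hu; have [s' hs' <-] := word_perm hu'.
congr odd_perm; apply/permP => k; apply: val_inj; by rewrite hs hs' (e _ false (ltn_ord k)).
Qed.
End Parity.

Section Uniclass.
Variables (K : fieldType) (n : nat).
Hypothesis hn : (4 <= n)%N.
Notation V := 'rV[K]_(n + n).
Notation sub := {vspace V}.
Notation weval := (weval n).
Notation wordW := (wordW n).
Notation isframe := (@isframe K n).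
Notation Sp := (@Sp K n).
Notation fl := (@fl K n).
Notation Rel := (@Rel K n).
Implicit Types (p q r v x y z : V) (L U W M N : sub) (C D : 'I_n -> sub) (u : seq nat).
Variable th : sub -> sub.
Hypothesis hth : collineation th.
Notation tau := (tau th).
Notation im := (im th).
Notation fixv := (fixv th).
Variable sw : bool.
Hypothesis hsw : forall M, ts M -> \dim M = n -> cls_low (im M) = cls_low M (+) sw.
Notation thC := (thC hn th sw).
Hypothesis hU : uniclass th.

Lemma uniclass_odd C D u u' : chamber C -> chamber D ->
  Rel C (thC C) u -> Rel D (thC D) u' -> odd (size u) = odd (size u').
Proof.
have [sw' [_ [w [hw h]]]] := hU.
suff key E t : chamber E -> Rel E (thC E) t -> odd (size t) = odd (size w).
  by move=> cC cD rC rD; rewrite (key _ _ cC rC) (key _ _ cD rD).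
move=> cE rE; have [g mg] := min_gallery_exists hn cE (thC_chamber hn hth hsw cE).
have rg := min_gallery_Rel hn mg.
rewrite (weq_odd hn rE.1 rg.1 (Rel_uniq hn rE rg)).
have [v [hv e]] := h _ _ _ cE (thC_img hn hth hsw cE) mg.
have hs : wordW (map (sigma n sw') v).
  rewrite /Pilot.Defs.wordW all_map; apply: sub_all hv => i /= hi.
  exact: sigma_lt.
have hrv : wordW (rev v ++ w ++ map (sigma n sw') v).
  by rewrite /Pilot.Defs.wordW !all_cat all_rev; apply/and3P.
rewrite (weq_odd hn rg.1 hrv e) !size_cat size_rev size_map !oddD.
by rewrite addbCA addbb addbF.
Qed.

(* The pair (x0, x1) is the relative position of the flag (p, L) and its image. *)
Definition posn L p (x0 x1 : nat * bool) := exists a, [/\ isframe a,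
  p \in <[a (0%N, false)]>%VS, L = (<[a (0%N, false)]> + <[a (1%N, false)]>)%VS,
  tau p \in <[a x0]>%VS & im L = (<[a x0]> + <[a x1]>)%VS].

Definition valid_pair (x0 x1 : nat * bool) :=
  [/\ (x0.1 < n)%N, (x1.1 < n)%N, x0 <> x1 & x1 <> flip x0].

Definition sw01 (x : nat * bool) := sgen n 0 x.

Lemma Rel_posn c L p u : isframe c -> sv p -> Sp c (Aset 1) = <[p]>%VS ->
  Sp c (Aset 2) = L -> Rel (fl c) (thC (fl c)) u ->
  posn L p (weval u (0%N, false)) (weval u (1%N, false)).
Proof.
move=> fc sp e1 e2 [wu [a [fa eC eD]]].
have n1 : (1 < n - 2)%N by lia.
have n0 : (0 < n - 2)%N by lia.
have two b : isframe b -> Sp b (Aset 2) = (<[b (0%N, false)]> + <[b (1%N, false)]>)%VS.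
  move=> fb; have f1 := AsetS fb (m := 1) ltac:(lia).
  have f0 := AsetS fb (m := 0) ltac:(lia).
  have f00 : Sp b (Aset 0) = 0%VS by apply/eqP; rewrite -dimv_eq0 (dim_Aset fb).
  by rewrite f1 f0 f00 add0v.
have one b : isframe b -> Sp b (Aset 1) = <[b (0%N, false)]>%VS.
  move=> fb; have f0 := AsetS fb (m := 0) ltac:(lia).
  have f00 : Sp b (Aset 0) = 0%VS by apply/eqP; rewrite -dimv_eq0 (dim_Aset fb).
  by rewrite f0 f00 add0v.
have fau := frame_weval hn fa u.
have a1 : Sp a (Aset 1) = <[p]>%VS by rewrite -e1; apply/esym/fl_Aset => //; lia.
have a2 : Sp a (Aset 2) = L by rewrite -e2; apply/esym/fl_Aset => //; lia.
have i1 := thC_Aset n0 eC eD; have i2 := thC_Aset n1 eC eD.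
rewrite a1 (one _ fau) in i1; rewrite a2 (two _ fau) in i2.
exists a; split=> //.
- by rewrite -one // a1 memv_line.
- by rewrite -two.
- by rewrite -i1 im1 // memv_line.
Qed.

(* By adjacency the Weyl distance d from a chamber to its image changes to d,
   s_0 d, d s_0 or s_0 d s_0; parity excludes the two in the middle. *)
Lemma posn_line L p r : is_line L -> sv p -> sv r -> p \in L -> r \in L ->
  exists x0 x1 : nat * bool, [/\ valid_pair x0 x1, posn L p x0 x1 &
    posn L r x0 x1 \/ posn L r (sw01 x1) (sw01 x0)].
Proof.
move=> hL sp sr pL rL; have [c [fc cc e1 e2]] := line_frame hn hL sp pL.
have [u ru] := Rel_exists hn cc (thC_chamber hn hth hsw cc).
have n2 : (0 < n - 2)%N by lia.
have n0 : (0 < n)%N by lia.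
exists (weval u (0%N, false)), (weval u (1%N, false)).
have P := Rel_posn fc sp e1 e2 ru.
split=> //.
  split; rewrite ?weval_lt //=; first lia.
    by move/(@weval_inj n hn u).
  by rewrite -weval_flip => /(@weval_inj n hn u).
have [rp|rp] := boolP (r \in <[p]>%VS).
  by left; apply: (Rel_posn fc sr) ru => //; rewrite e1 (line_eqP (proj2 sr) rp).
have ha := alp_lt hn n0; have hb := bet_lt hn n0.
have ab := alp_neq_bet hn n0; have bfa := bet_neq hn n0.
have ea : alp n 0 = (0%N, false) by exact: alp_first.
have eb : bet n 0 = (1%N, false) by exact: bet_first.
have rB : Bf r (c (flip (bet n 0))) != 0.
  apply: (Sp_coord fc (J := Aset 2) (J' := Aset 1)) => //; first by rewrite e2.
    by rewrite eb => -[[|[|k]] []].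
  by rewrite e1.
pose t := Bf r (c (flip (alp n 0))) / Bf r (c (flip (bet n 0))).
have red : c (bet n 0) + t *: c (alp n 0) \in <[r]>%VS.
  apply: (Sp_reduce (J := Aset 0)) => //; rewrite ?ea ?eb ?memv_line //.
    by rewrite -e2 in rL; apply: (subvP _ _ rL); apply: Sp_sub => x hx Jx; apply: mem_Sp;
      rewrite //=; case: x Jx {hx} => [[|[|k]] []].
  by apply: Sp_sub => x hx; rewrite /Aset ltn0 andbF.
pose c1 := rootE c (alp n 0) (bet n 0) t.
have f1 : isframe c1 by exact: rootE_frame.
have ec1 : fl c1 = fl c by rewrite rootE_fl // rho_alp_bet.
pose d := fun i => c1 (sgen n 0 i).
have fd : isframe d by exact: frame_sgen.
have ad : adj 0 (fl c) (fl d) by rewrite -ec1; exact: fl_adj.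
have cd : chamber (fl d).
  by apply: (fl_weval_chamber hn (u := [:: 0%N]) f1); rewrite ?ec1 //= n0.
have d1 : Sp d (Aset 1) = <[r]>%VS.
  apply/eqP; rewrite eqEdim (dim_Aset fd) ?dim_vline; last lia.
  rewrite (proj2 sr) andbT; apply: Sp_sub => x hx Jx.
  have -> : x = alp n 0 by rewrite ea; case: x Jx {hx} => [[|k] []].
  by rewrite /d sgen_alp /c1 /rootE eqxx.
have d2 : Sp d (Aset 2) = L.
  apply/esym/eqP; rewrite eqEdim; apply/andP; split; last first.
    by rewrite (dim_Aset fd) ?hL.2 //; lia.
  have cA : Sp c (Aset 2) = Sp c1 (Aset 2) by apply: fl_Aset => //; lia.
  rewrite -e2 cA; apply: Sp_sub => x hx Jx; rewrite -[x](sgenK hn 0).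
  apply: (@mem_Sp K n d (Aset 2) (sgen n 0 x)); first by rewrite sgen_lt.
  have n1 : (1 < n)%N by exact: leq_trans hn.
  by case: x Jx hx => [[|[|k]] []] //= _ _; rewrite n1.
have adT := thC_adj hn hth sw cc cd ad.
rewrite sigma_small // in adT.
have cc' := thC_chamber hn hth hsw cc; have cd' := thC_chamber hn hth hsw cd.
have left_step g : Rel (fl c) (thC (fl d)) g ->
    Rel (fl d) (thC (fl d)) g \/ Rel (fl d) (thC (fl d)) (0%N :: g).
  move=> /(Rel_sym hn) rg; case: (Rel_step hn cc cd ad rg) => /(Rel_sym hn).
    by rewrite revK; left.
  by rewrite rev_rcons revK; right.
have par g : Rel (fl d) (thC (fl d)) g -> odd (size u) = odd (size g).
  by move=> rg; exact: uniclass_odd cc cd ru rg.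
case: (Rel_step hn cc' cd' adT ru) => /left_step[] h.
- by left; exact: (Rel_posn fd sr d1 d2 h).
- by have := par _ h => /=; case: (odd _).
- by have := par _ h; rewrite size_rcons /=; case: (odd _).
right; have := Rel_posn fd sr d1 d2 h.
rewrite /= !weval_rcons /sw01.
have n1 : (1 < n)%N by exact: leq_trans hn.
have -> : sgen n 0 (0%N, false) = (1%N, false) by rewrite sgenE // n1.
by have -> : sgen n 0 (1%N, false) = (0%N, false) by rewrite sgenE // n1.
Qed.

Lemma sw01E k d : sw01 (k, d) =
  if k == 0%N then (1%N, d) else if k == 1%N then (0%N, d) else (k, d).
Proof.
have n1 : (1 < n)%N by exact: leq_trans hn.
by rewrite /sw01 sgenE ?n1 // ltnW.
Qed.

Lemma sw01_id (x : nat * bool) : x.1 <> 0%N -> x.1 <> 1%N -> sw01 x = x.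
Proof. by case: x => k d; rewrite sw01E => /= /eqP/negPf -> /eqP/negPf ->. Qed.

Lemma frame_line a (x y : nat * bool) : isframe a -> (x.1 < n)%N -> (y.1 < n)%N ->
  a x \in <[a y]>%VS -> x = y.
Proof.
move=> fa hx hy /vlineP[k e]; apply/eqP/negPn/negP => ne.
have := frame_Bflip fa hx hx; rewrite e BfZl (frame_Bflip fa) // eq_sym (negPf ne).
by rewrite mulr0 eqxx => /eqP; rewrite eq_sym oner_eq0.
Qed.

Lemma frame_plane a (x y z : nat * bool) : isframe a -> (x.1 < n)%N -> (y.1 < n)%N -> (z.1 < n)%N ->
  a x \in (<[a y]> + <[a z]>)%VS -> x = y \/ x = z.
Proof.
move=> fa hx hy hz /mem2P[k [l e]].
have [->|xy] := eqVneq x y; first by left.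
have [->|xz] := eqVneq x z; first by right.
have := frame_Bflip fa hx hx; rewrite e BfDl !BfZl !(frame_Bflip fa) //.
rewrite (eq_sym y) (eq_sym z) (negPf xy) (negPf xz) !mulr0 addr0 eqxx => /eqP.
by rewrite eq_sym oner_eq0.
Qed.

(** Off [<x>] there are two points [y] and [y + x], and at most one of them is mapped to [<w>]. *)
Lemma third_point L x w : is_line L -> sv x -> x \in L ->
  exists r, [/\ sv r, r \in L, r \notin <[x]>%VS & tau r \notin <[w]>%VS].
Proof.
move=> hL sx xL; have [y [sy yx o eL]] := line_basis hL xL (proj2 sx).
have yL : y \in L by rewrite eL mem2r.
have [h|h] := boolP (tau y \in <[w]>%VS); last by exists y.
have yxL : y + x \in L by rewrite memvD.
have yxx : y + x \notin <[x]>%VS.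
  by apply: contra yx => h2; rewrite -(addrK x y) memvB ?memv_line.
have sm : sv (y + x).
  by apply: (svP hL.1 yxL); apply: contraNneq yxx => ->; exact: mem0v.
exists (y + x); split=> //; apply/negP => h2.
rewrite -(line_eqP (tau_neq0 hth sy) h) in h2.
case/negP: yx; apply: (line_sym (proj2 sx)).
by rewrite -(addKr y x) memvD ?memvN ?memv_line // (tau_inj hth sy sm).
Qed.

(** The position of [p] is [(0, false)], [(1, false)], which the exchange in [posn_line] reproduces;
    so [r] has it too. *)
Lemma fixed_line_all L p r : is_line L -> im L = L -> sv p -> sv r -> p \in L ->
  r \in L -> fixv p -> fixv r.
Proof.
move=> hL iL sp sr pL rL fp.
have [x0 [x1 [[h0 h1 n01 _] [a [fa p0 eL t0 eI]] Pr]]] := posn_line hL sp sr pL rL.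
have z0 : (0 < n)%N by exact: leq_trans hn.
have z1 : (1 < n)%N by exact: leq_trans hn.
have ax0 : x0 = (0%N, false).
  apply: (frame_line fa) => //.
  by rewrite -(line_eqP (proj2 sp) p0) -(line_eqP (tau_neq0 hth sp) fp)
    (line_eqP (tau_neq0 hth sp) t0) memv_line.
have ax1 : x1 = (1%N, false).
  have : a x1 \in L by rewrite -iL eI mem2r.
  rewrite eL => /(frame_plane fa h1 (z := (1%N, false))) [] // e.
  by case: n01; rewrite ax0.
have fin b : r \in <[b]>%VS -> tau r \in <[b]>%VS -> fixv r.
  by move=> rb; rewrite /(fixv _) (line_eqP (proj2 sr) rb).
case: Pr => [[b [_ r0 _ tr _]]|[b [_ r0 _ tr _]]]; apply: fin r0 _.
  by rewrite ax0 in tr.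
by rewrite ax1 sw01E in tr.
Qed.

(** The pairing being perfect, [x0] and [x1] are [(0, true)] and [(1, true)] in some order, and
    [Bf p (tau p) = 0] selects [x0 = (1, true)]. The exchange in [posn_line] reproduces this
    position. *)
Lemma opp_line_all L p r : is_line L -> (L :&: perp (im L) = 0)%VS -> sv p -> sv r ->
  p \in L -> r \in L -> Bf p (tau p) = 0 -> Bf r (tau r) = 0.
Proof.
move=> hL L0 sp sr pL rL pp.
have [x0 [x1 [[h0 h1 n01 _] [a [fa p0 eL t0 eI]] Pr]]] := posn_line hL sp sr pL rL.
have z0 : (0 < n)%N by exact: leq_trans hn.
have z1 : (1 < n)%N by exact: leq_trans hn.
have zero v : v \in L -> v \in perp (im L) -> v = 0.
  by move=> vL vP; apply/eqP; rewrite -memv0 -L0 memv_cap vL.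
have see (k : nat) : (k < 2)%N -> x0 = (k, true) \/ x1 = (k, true).
  move=> k2; have hk : ((k, false).1 < n)%N by exact: leq_trans z1.
  have aL : a (k, false) \in L.
    by rewrite eL; case: k k2 {hk} => [|[|k]] // _; [exact: mem2l|exact: mem2r].
  have [e|ne] := eqVneq x0 (k, true); first by left.
  have [e|ne'] := eqVneq x1 (k, true); first by right.
  have [_ /eqP[]] := frame_sv fa hk; apply: zero => //; rewrite eI.
  by apply: perp2; rewrite BfC (frame_B fa) // /flip /= ?(negPf ne) ?(negPf ne').
have n0 : x0 <> (0%N, true).
  move=> e; move: pp t0; rewrite e => pp /vlineP[k ek].
  have [l el] := vlineP _ _ p0; have k0 : k != 0.
    by apply: contraTneq (tau_neq0 hth sp) => k0; rewrite ek k0 scale0r eqxx.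
  have l0 : l != 0.
    by apply: contraTneq (proj2 sp) => l0; rewrite el l0 scale0r eqxx.
  move/eqP: pp; rewrite ek el BfZl BfZr (frame_B fa) // eqxx mulr1.
  by rewrite mulf_eq0 (negPf l0) (negPf k0).
have ax1 : x1 = (0%N, true) by case: (see 0%N isT).
have ax0 : x0 = (1%N, true) by case: (see 1%N isT) => //; rewrite ax1.
have fin b : isframe b -> r \in <[b (0%N, false)]>%VS -> tau r \in <[b (1%N, true)]>%VS ->
    Bf r (tau r) = 0.
  move=> fb /vlineP[k ->] /vlineP[l ->].
  by rewrite BfZl BfZr (frame_B fb) // !mulr0.
case: Pr => [[b [fb r0 _ tr _]]|[b [fb r0 _ tr _]]]; apply: (fin b fb r0).
  by rewrite ax0 in tr.
by rewrite ax1 sw01E in tr.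
Qed.

(** A moved [x] has [x1 = (0, false)]. For a further point [r], the two positions allowed by
    [posn_line] put [r] on [im L] or [tau r] on [L], a second common point. *)
Lemma shared_fixed L x : is_line L -> L <> im L -> sv x -> x \in L -> x \in im L -> fixv x.
Proof.
move=> hL ne sx xL xI; apply/negPn/negP => nf.
have hI := im_line hth hL.
have [r [sr rL rx trx]] := third_point x hL sx xL.
have [x0 [x1 [[h0 h1 n01 _] [a [fa p0 eL t0 eI]] Pr]]] := posn_line hL sx sr xL rL.
have z0 : (0 < n)%N by exact: leq_trans hn.
have z1 : (1 < n)%N by exact: leq_trans hn.
have e0 := line_eqP (proj2 sx) p0.
have ax1 : x1 = (0%N, false).
  have : a (0%N, false) \in im L by rewrite memvE -e0 -memvE.
  rewrite eI => /(frame_plane fa (x := (0%N, false)) z0 h0 h1) [] // e; case/negP: nf.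
  by rewrite /(fixv _) e0 e.
have both y : y \in L -> y \in im L -> y \notin <[x]>%VS -> L = im L.
  move=> yL yI yx; have [_ dL] := hL; have [_ dI] := hI.
  exact: etrans (dim2_eq dL xL yL (proj2 sx) yx) (esym (dim2_eq dI xI yI (proj2 sx) yx)).
case: Pr => [[b [fb r0 eLb tr eIb]]|[b [fb r0 eLb tr eIb]]]; apply: ne.
  apply: (both r) => //; rewrite eIb ax1; apply: (subvP (addvSr _ _)).
  exact: r0.
rewrite ax1 sw01E /= in tr.
apply: (both (tau r)) => //; last by rewrite mem_im //; case: hL.
by rewrite eLb; apply: (subvP (addvSr _ _)).
Qed.

(** [y] and [v] span the radicals of a pairing of rank one. If [tau y] is not in [<v>], then
    [x0 = (1, true)] and [x1] has index above 1, so [sw01] fixes it; neither position allowed for a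
    third point [r] is then compatible with the radicals. *)
Lemma rank1_image L y v : is_line L -> (L :&: im L = 0)%VS -> ~~ (L <= perp (im L))%VS ->
  sv y -> y \in L -> y \in perp (im L) -> v != 0 -> v \in im L -> v \in perp L ->
  tau y \in <[v]>%VS.
Proof.
move=> hL L0 LP sy yL yP v0 vI vP; apply/negPn/negP => nty.
have hI := im_line hth hL; have [tI dI] := hI.
have [r [sr rL ry trv]] := third_point v hL sy yL.
have [x0 [x1 [[h0 h1 n01 nf01] [a [fa p0 eL t0 eI]] Pr]]] := posn_line hL sy sr yL rL.
have z0 : (0 < n)%N by exact: leq_trans hn.
have z1 : (1 < n)%N by exact: leq_trans hn.
have e0 := line_eqP (proj2 sy) p0.
have et := line_eqP (tau_neq0 hth sy) t0.
have a0P : a (0%N, false) \in perp (im L) by rewrite memvE -e0 -memvE.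
have ax0I : a x0 \in im L by rewrite eI mem2l.
have ax1I : a x1 \in im L by rewrite eI mem2r.
have a1L : a (1%N, false) \in L by rewrite eL mem2r.
have a0L : a (0%N, false) \in L by rewrite eL mem2l.
have no (x : nat * bool) : (x.1 < n)%N -> Bf (a (0%N, false)) (a x) = 0 -> x <> (0%N, true).
  move=> hx h e; move/eqP: h; rewrite (frame_B fa) // e /flip eqxx.
  by rewrite oner_eq0.
have n0 : x0 <> (0%N, true) by apply: no => //; exact: (perp_mem' a0P).
have n1 : x1 <> (0%N, true) by apply: no => //; exact: (perp_mem' a0P).
have disj (x : nat * bool) : (x.1 < n)%N -> a x \in L -> a x \in im L -> False.
  move=> hx xL xI; have [_ /eqP[]] := frame_sv fa hx; apply/eqP.
  by rewrite -memv0 -L0 memv_cap xL.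
have d0 (x : nat * bool) : (x.1 < n)%N -> a x \in im L -> x <> (0%N, false).
  by move=> hx xI e; apply: (disj x); rewrite // e.
have d1 (x : nat * bool) : (x.1 < n)%N -> a x \in im L -> x <> (1%N, false).
  by move=> hx xI e; apply: (disj x); rewrite // e.
have see : x0 = (1%N, true) \/ x1 = (1%N, true).
  have [e|m0] := eqVneq x0 (1%N, true); first by left.
  have [e|m1] := eqVneq x1 (1%N, true); first by right.
  case/negP: LP; rewrite [X in (X <= _)%VS]eL sub2 // eI.
  by apply: perp2; rewrite BfC (frame_B fa) // /flip /= ?(negPf m0) ?(negPf m1).
have ax0 : x0 = (1%N, true).
  case: see => // e1; case/negP: nty.
  have := vI; rewrite eI => /mem2P[k [l ev]].
  have l0 : l = 0.
    have := perp_mem' vP a1L; rewrite ev e1 !BfE !(frame_B fa) //.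
    have -> : ((1%N, false) == flip x0) = false.
      by apply/negP => /eqP e; apply: n01; rewrite e1 -[x0]flipK -e.
    by rewrite eqxx mulr1 mulr0 add0r.
  have v1 : v \in <[a x0]>%VS by rewrite ev l0 scale0r addr0 memvZ ?memv_line.
  by rewrite (line_eqP v0 v1).
have sx1 : sw01 x1 = x1.
  have := d0 _ h1 ax1I; have := d1 _ h1 ax1I.
  case: x1 h1 n01 nf01 n1 {ax1I see Pr eI} => [k d] h1 n01 nf01 n1 m1 m0.
  apply: sw01_id => /= ek; clear h1; rewrite ek in n01 n1 m1 m0.
    by case: d n01 nf01 n1 m1 m0.
  by case: d n01 nf01 n1 m1 m0 => // n01; case: n01; rewrite ax0.
case: Pr => [[b [fb r0 eLb tr eIb]]|[b [fb r0 eLb tr eIb]]].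
  case/negP: ry; rewrite ax0 in tr.
  have trI : tau r \in im L by rewrite mem_im //; case: hL.
  have [k [l ey]] : exists k l, y = k *: b (0%N, false) + l *: b (1%N, false).
    by apply/mem2P; rewrite -eLb.
  have bI : b (1%N, true) \in im L.
    by rewrite memvE -(line_eqP (tau_neq0 hth sr) tr) -memvE.
  have l0 : l = 0.
    have := perp_mem' yP bI; rewrite ey !BfE !(frame_B fb) //.
    by rewrite eqxx mulr1 mulr0 add0r.
  have y1 : y \in <[b (0%N, false)]>%VS.
    by rewrite ey l0 scale0r addr0 memvZ ?memv_line.
  by rewrite (line_eqP (proj2 sy) y1).
rewrite sx1 in tr eIb.
case/negP: LP; have trI : tau r \in im L by rewrite mem_im //; case: hL.
apply: perp_sym; rewrite (dim2_eq dI vI trI v0 trv) sub2 //.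
have x1n : forall k, (k < 2)%N -> x1 <> (k, true).
  case=> [|[|k]] // _ e1.
  by apply: n01; rewrite ax0 e1.
have /vlineP[k ->] := tr; rewrite memvZ // eLb.
apply: perp2; rewrite (frame_B fb) //; case: eqP => // e.
by case: (x1n 1%N isT).
Qed.

(** Otherwise the common point [x] is fixed, and another point [p] of [L] gives an invariant line
    [R = <p, tau p>] without fixed points; yet the plane [P] spanned by [R] and [x] produces one on
    [R]. *)
Lemma uniclass_kang_perp L : is_line L -> (L <= perp (im L))%VS ->
  (L :&: im L != 0)%VS -> L = im L.
Proof.
move=> hL LP /cap_pick[x [xL xI x0]]; apply: NNPP => ne.
have [tL dL] := hL; have sx := svP tL xL x0.
have hI := im_line hth hL; have [tI dI] := hI.
have fx := shared_fixed hL ne sx xL xI.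
have [p [sp px xp eL]] := line_basis hL xL x0.
have pL : p \in L by rewrite eL mem2r.
have tpI : tau p \in im L by rewrite mem_im.
have xtp : x \in <[tau x]>%VS by exact: fixv_sym.
have nfp : ~~ fixv p.
  apply/negP => fp; apply: ne.
  have pI : p \in im L by rewrite fix_im.
  exact: etrans (dim2_eq dL xL pL x0 px) (esym (dim2_eq dI xI pI x0 px)).
have stp := tau_sv hth sp.
have optp : Bf p (tau p) = 0 by rewrite (perp_mem' (subvP LP _ pL)).
pose R := (<[p]> + <[tau p]>)%VS.
have hR : is_line R by exact: line2.
have [tR dR] := hR.
have iR : im R = R.
  apply: NNPP => neR; have : fixv (tau p).
    apply: (shared_fixed hR) => //; [exact: nesym|exact: mem2r|].
    by rewrite mem_im // mem2l.
  by move=> f; case/negP: nfp; apply: tau_inj f.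
have noR y : sv y -> y \in R -> ~ fixv y.
  move=> sy yR fy; case/negP: nfp.
  exact: (fixed_line_all hR iR sy sp yR (mem2l _ _) fy).
have xR : x \notin R by apply/negP => xR; apply: (noR x).
have xtp0 : Bf x (tau p) = 0 by rewrite (ts_orth tI).
(* With this third point of [<x, tau p>], the line [Z = <p, q>] of [P] misses [x] and is not
   invariant. It meets its image in a fixed point [z], and [<x, z>], fixed pointwise, crosses
   [R]. *)
pose q := x + tau p.
have qq : Qf q = 0 by rewrite QfD sx.1 stp.1 xtp0 !addr0.
have pq : Bf p q = 0 by rewrite BfDr BfC xp optp addr0.
have indep c : x + tau p \notin (<[p]> + <[c *: tau p]>)%VS.
  apply: contra xR => h; rewrite -(addrK (tau p) x) memvB ?mem2r //.
  apply: (subvP _ _ h); apply: sub2; [exact: mem2l|rewrite memvZ ?mem2r //].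
have qp : q \notin <[p]>%VS.
  by apply: contra (indep 1) => h; apply: (subvP (addvSl _ _)).
have q0 : q != 0 by apply: contraNneq qp => ->; exact: mem0v.
have sq : sv q by [].
pose Z := (<[p]> + <[q]>)%VS.
have hZ : is_line Z by exact: line2.
have [tZ dZ] := hZ.
pose P := (R + <[x]>)%VS.
have dP : \dim P = 3 by rewrite dim_add_line // dR.
have xP : x \in P by apply: (subvP (addvSr _ _)); exact: memv_line.
have RP : (R <= P)%VS by exact: addvSl.
have tpR : tau p \in R by exact: mem2r.
have tpP : tau p \in P by exact: (subvP RP).
have qP : q \in P by rewrite memvD.
have ZP : (Z <= P)%VS by rewrite sub2 // (subvP RP) ?mem2l.
have tpx : tau p \notin <[x]>%VS.
  by apply: contra xR => /(line_sym (proj2 stp)) h; apply: (subvP _ _ h); rewrite -memvE.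
have tqP : tau q \in P.
  have [tA _] := line2 sx stp xtp0 tpx.
  have qA : q \in (<[x]> + <[tau p]>)%VS by rewrite memvD ?mem2l ?mem2r.
  have : tau q \in im (<[x]> + <[tau p]>) by rewrite mem_im.
  rewrite (im2 hth) // => h; apply: (subvP _ _ h); apply: sub2.
    by apply: (subvP (_ : <[x]> <= P)%VS) => //; rewrite -memvE.
  by apply: (subvP RP); rewrite -iR mem_im.
have iZ : im Z = (<[tau p]> + <[tau q]>)%VS by rewrite (im2 hth).
have IP : (im Z <= P)%VS by rewrite iZ sub2.
have xZ : x \notin Z.
  apply/negP => xZ; have ZeP : (P <= Z)%VS.
    have tpZ : tau p \in Z by rewrite -(addKr x (tau p)) memvD ?memvN ?mem2r.
    by rewrite subv_add sub2 ?mem2l // -memvE.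
  by have := dimvS ZeP; rewrite dP dZ.
have neZ : Z <> im Z.
  move=> e; case/negP: xZ; rewrite -(addrK (tau p) x) memvB ?mem2r //.
  by rewrite e iZ mem2l.
have meet A B : (A <= P)%VS -> (B <= P)%VS -> \dim A = 2 -> \dim B = 2 ->
    exists z, [/\ z \in A, z \in B & z != 0].
  by move=> AP BP dA dB; apply: cap_pick; apply: (cap_dim AP BP); rewrite dA dB dP.
have [z [zZ zI z0]] := meet _ _ ZP IP dZ (im_line hth hZ).2.
have sz := svP tZ zZ z0; have fz := shared_fixed hZ neZ sz zZ zI.
have zx : z \notin <[x]>%VS.
  by apply: contra xZ => /(line_sym z0) h; apply: (subvP _ _ h); rewrite -memvE.
have xz : Bf x z = 0.
  by case/mem2P: zZ => a [b ->]; rewrite /q !BfE xp xtp0 (Bfxx0 sx.1) addr0 !mulr0 addr0.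
have hW := line2 sx sz xz zx.
have iW : im (<[x]> + <[z]>) = (<[x]> + <[z]>)%VS.
  by rewrite (im2 hth) // (line_eqP (tau_neq0 hth sx) fx) (line_eqP (tau_neq0 hth sz) fz).
have zP := subvP ZP _ zZ.
have [w [wW wR w0]] := meet _ _ (sub2 xP zP) RP hW.2 dR.
have sw' := svP tR wR w0.
by apply: (noR w) => //; exact: (fixed_line_all hW iW sx sw' (mem2l _ _) wW fx).
Qed.

(** If [L] misses its image, [key] makes every point orthogonal to [p] but not to [tau p] orthogonal
    to its own image. All points but [r] of a suitable line [Z] are of this kind, which clashes with
    [r] not being orthogonal to [tau r]. *)
Lemma uniclass_kang_meet L : is_line L -> ~~ (L <= perp (im L))%VS ->
  (L :&: perp (im L) != 0)%VS -> (L :&: im L != 0)%VS.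
Proof.
move=> hL LP LP0; apply/negP => /eqP L0.
have [tL dL] := hL; have hI := im_line hth hL; have [tI dI] := hI.
have [p [pL pP p0]] := cap_pick LP0; have sp := svP tL pL p0.
have [v [vI vP v0]] := cap_pick (cross_neq0 hL hI LP0).
have tpv := rank1_image hL L0 LP sp pL pP v0 vI vP.
have ev := line_eqP (tau_neq0 hth sp) tpv.
pose q := tau p; have sq : sv q by exact: tau_sv.
have qI : q \in im L by rewrite mem_im.
have qPL : q \in perp L by rewrite memvE -[<[q]>%VS]/(<[tau p]>%VS) ev -memvE.
have pq : Bf p q = 0 by exact: (perp_mem' pP).
have qL : q \notin L.
  by apply/negP => h; case: sq => _ /eqP[]; apply/eqP; rewrite -memv0 -L0 memv_cap h.
have qp : q \notin <[p]>%VS.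
  by apply: contra qL => h; apply: (subvP _ _ h); rewrite -memvE.
pose R := (<[p]> + <[q]>)%VS.
have hR : is_line R by exact: line2.
have [tR dR] := hR.
have iR : im R = R.
  apply: NNPP => neR; have fq : fixv q.
    apply: (shared_fixed hR) => //; [exact: nesym|exact: mem2r|].
    by rewrite mem_im // mem2l.
  by case/negP: qp; apply: (tau_inj hth sp sq).
have [r [sr rp pr eL]] := line_basis hL pL p0.
have rL : r \in L by rewrite eL mem2r.
have rq : Bf r q = 0 by rewrite (perp_mem qPL).
have eI : im L = (<[q]> + <[tau r]>)%VS by rewrite eL (im2 hth).
have ptr : Bf p (tau r) = 0 by rewrite (perp_mem' pP) // eI mem2r.
have rtr : Bf r (tau r) != 0.
  apply: contra LP => /eqP h; rewrite [X in (X <= _)%VS]eL sub2 // eI.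
  by apply: perp2; rewrite BfC.
have [p' sp' pp'] := tau_surj hth sp.
have p'R : p' \in R.
  by rewrite -(mem_im hth tR sp') iR; apply: (subvP (addvSl _ _)); exact: line_sym.
(* The line [<p, m>] is in perfect pairing with its image, so [opp_line_all] carries
   [Bf p (tau p) = 0] over to [m]. *)
have key m : sv m -> Bf p m = 0 -> Bf m q != 0 -> Bf m (tau m) = 0.
  move=> sm pm mq; have mp : m \notin <[p]>%VS.
    by apply: contra mq => /vlineP[k ->]; rewrite BfZl pq mulr0.
  have hA := line2 sp sm pm mp.
  have ptm : Bf p (tau m) != 0.
    have [a [b ep']] := mem2P _ _ _ p'R.
    have : Bf p' m != 0.
      rewrite ep' !BfE pm mulr0 add0r [Bf q m]BfC mulf_neq0 //.
      apply: contraNneq qp => b0; rewrite b0 scale0r addr0 in ep'.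
      have hp' : p' \in <[p]>%VS by rewrite ep' memvZ ?memv_line.
      rewrite (line_eqP p0 pp'); apply: (tau_prop hth sp' sp).
      exact: line_sym (proj2 sp') hp'.
    apply: contra => /eqP h; apply/eqP/(tau_orthE hth sp' sm).
    have p'p : tau p' \in <[p]>%VS by exact: line_sym.
    by have /vlineP[k ->] := p'p; rewrite BfZl h mulr0.
  apply: (opp_line_all hA _ sp sm (mem2l _ _) (mem2r _ _) pq).
  apply/eqP; rewrite -subv0; apply/subvP => w /memv_capP[wA wP].
  rewrite (im2 hth) // in wP; have [a [b ew]] := mem2P _ _ _ wA.
  have b0 : b = 0.
    have /eqP := perp_mem' wP (mem2l _ _); rewrite ew !BfE -/q pq mulr0 add0r.
    by rewrite mulf_eq0 (negPf mq) orbF => /eqP.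
  have /eqP := perp_mem' wP (mem2r _ _); rewrite ew b0 !BfE mul0r addr0.
  by rewrite mulf_eq0 (negPf ptm) orbF => /eqP ->; rewrite !scale0r addr0 mem0v.
have [z [qz zP zq]] := sing_sep tL qL.
have z0 : z != 0 by apply: contraNneq zq => ->; rewrite Bf0l.
have sz : sv z by [].
have rz : Bf r z = 0 by rewrite (perp_mem zP).
have pz : Bf p z = 0 by rewrite (perp_mem zP).
have zr : z \notin <[r]>%VS.
  by apply: contra zq => /vlineP[k ->]; rewrite BfZl rq mulr0.
have hZ := line2 sr sz rz zr.
pose Z := (<[r]> + <[z]>)%VS; rewrite -/Z in hZ; have [tZ dZ] := hZ.
have hJ := im_line hth hZ; have [tJ dJ] := hJ.
have eJ : im Z = (<[tau r]> + <[tau z]>)%VS by rewrite (im2 hth).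
have keyZ m : m \in Z -> m \notin <[r]>%VS -> Bf m (tau m) = 0.
  move=> mZ mr; have m0 : m != 0 by apply: contraNneq mr => ->; exact: mem0v.
  have [a [b em]] := mem2P _ _ _ mZ; apply: key; first exact: (svP tZ mZ m0).
    by rewrite em !BfE pr pz !mulr0 addr0.
  rewrite em !BfE rq mulr0 add0r mulf_neq0 //.
  by apply: contraNneq mr => b0; rewrite em b0 scale0r addr0 memvZ ?memv_line.
have ZP0 : (Z :&: perp (im Z) != 0)%VS.
  apply/negP => /eqP h; case/negP: rtr; apply/eqP.
  by apply: (opp_line_all hZ h sz sr (mem2r _ _) (mem2l _ _)); exact: (keyZ _ (mem2r _ _)).
have nZP : ~~ (Z <= perp (im Z))%VS.
  apply: contra rtr => /subvP/(_ _ (mem2l _ _)) h.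
  by rewrite (perp_mem' h) // eJ mem2l.
(* Both [y] and [tau y] are radical for the pairing of [Z] with its image. Then [r] orthogonal to
   [tau (r + y)] forces this vector into [<tau y>], against injectivity. *)
have [y [yZ yJ y0 tyZ]] : exists y, [/\ y \in Z, y \in perp (im Z), y != 0 & tau y \in perp Z].
  have [Z0|Z0] := eqVneq (Z :&: im Z)%VS 0%VS.
    have [y [yZ yJ y0]] := cap_pick ZP0; have sy := svP tZ yZ y0.
    have [w [wJ wZ w0]] := cap_pick (cross_neq0 hZ hJ ZP0).
    exists y; split=> //.
    by have := rank1_image hZ Z0 nZP sy yZ yJ w0 wJ wZ => h; apply: (subvP _ _ h); rewrite -memvE.
  have [y [yZ yJ y0]] := cap_pick Z0; have sy := svP tZ yZ y0.
  have neZ : Z <> im Z.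
    by move=> e; case/negP: nZP; rewrite -e; exact: tsP.
  have fy := shared_fixed hZ neZ sy yZ yJ.
  exists y; split=> //; first exact: (subvP (tsP tJ)).
  by apply: (subvP _ _ fy); rewrite -memvE; exact: (subvP (tsP tZ)).
have sy := svP tZ yZ y0.
have yr : y \notin <[r]>%VS.
  apply: contra rtr => /(line_sym y0)/vlineP[k e].
  by rewrite {1}e BfZl (perp_mem' yJ) ?mulr0 // eJ mem2l.
have mZ : r + y \in Z by rewrite memvD ?mem2l.
have mr : r + y \notin <[r]>%VS.
  by apply: contra yr => h; rewrite -(addKr r y) memvD ?memvN ?memv_line.
have m0 : r + y != 0 by apply: contraNneq mr => ->; exact: mem0v.
have sm := svP tZ mZ m0; have tmJ : tau (r + y) \in im Z by rewrite mem_im.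
have := keyZ _ mZ mr; rewrite BfDl (perp_mem' yJ tmJ) addr0 => rtm.
have eZ : Z = (<[r]> + <[y]>)%VS by apply: (dim2_eq dZ) => //; [exact: mem2l|case: sr].
have ry : Bf r y = 0 by rewrite (ts_orth tZ) ?mem2l.
have := tmJ; rewrite [X in im X]eZ (im2 hth) // => /mem2P[a [b etm]].
have rty : Bf r (tau y) = 0 by rewrite (perp_mem tyZ) ?mem2l.
have a0 : a = 0.
  by have /eqP := rtm; rewrite etm !BfE rty mulr0 addr0 mulf_eq0 (negPf rtr) orbF => /eqP.
have my : r + y \in <[y]>%VS.
  by apply: (tau_inj hth sy sm); rewrite etm a0 scale0r add0r memvZ ?memv_line.
case/negP: yr; apply: (line_sym (proj2 sr)).
by rewrite -(addrK y r) memvB ?memv_line.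
Qed.

Lemma uniclass_kang : kang th.
Proof.
move=> L hL; split; [exact: uniclass_kang_perp|exact: uniclass_kang_meet].
Qed.

End Uniclass.

Theorem theorem2p2 (K : fieldType) (n : nat) (hn : (4 <= n)%N)
    (theta : {vspace 'rV[K]_(n + n)} -> {vspace 'rV[K]_(n + n)}) :
  collineation theta ->
  (kangaroo12' theta <->
     anisotropic theta \/ ideal (fixed_points theta) \/ fixes_line_spread theta) /\
  (kangaroo12' theta <-> uniclass theta).
Proof.
move=> hth; have [sw hsw] := im_cls hth.
have trich : kang theta -> fix_or_opp theta \/ spread_like theta.
  by move=> hK; exact: kang_trichotomy.
split; split.
- move/(kangarooP hth)/trich => [h|/(spread_like_fixes hth)]; last by right; right.
  case: (classic (exists2 x, sv x & fixv theta x)) => [ex|nex].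
    by right; left; exact: fix_or_opp_ideal.
  left; apply: (opp_anisotropic hn hth hsw) => v sv_v.
  by case: (h _ sv_v) => // fv; case: nex; exists v.
- move=> h; apply/(kangarooP hth); case: h => [h|[h|h]].
  + exact: (anisotropic_kang hn hth hsw).
  + by apply: (fix_or_opp_kang hth); exact: ideal_fix_or_opp.
  + exact: spread_kang.
- by move/(kangarooP hth)/trich; exact: (uniform_uniclass hn hth hsw).
- by move=> h; apply/(kangarooP hth); exact: (uniclass_kang hn hth hsw).
Qed.
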